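(* Let $\alpha=[a_0;a_1,a_2,\dots]$ be irrational with convergents $p_k/q_k$, and assume that \[ \frac{\log a_k}{a_{k+1}} \le T \quad \text{for all } k \ge k_0 \] with some constants $k_0, T \ge 1$. Let $N=\sum_{k=0}^{K-1} b_k q_k$ be the Ostrowski expansion of a non-negative integer, and set \[ N^*=\sum_{k=0}^{K-1} b_k^* q_k, \qquad b_k^*=\lfloor (5/6) a_{k+1} \rfloor . \] Then \[ \log P_N(\alpha ) = \log P_{N^*}(\alpha ) - \sum_{k=0}^{K-1} d_k(N) + O_T \left( \sum_{k=1}^K \frac{1}{a_k} \right) + O_{\alpha}(1) \] with some real numbers $d_k(N)$ satisfying the following for all $0 \le k \le K-1$: (i) $d_k(N) \ge 0.2326\, (b_k- b_k^* )^2/a_{k+1}$, with equality if $b_k=b_k^*$; (ii) if $b_k \le 0.99\, a_{k+1}$, then \[ d_k (N) = a_{k+1} \int_{b_k/a_{k+1}}^{b_k^*/a_{k+1}} \log |2 \sin (\pi x)| \, \mathrm{d}x + O_T \left( \frac{|b_k-b_k^*|}{a_{k+1}} + I_{\{ b_k \le 0.01 a_{k+1} \}} \log a_{k+1} \right) , \] where $I_{\{ b_k \le 0.01 a_{k+1}\}}$ is $1$ if $b_k \le 0.01 a_{k+1}$ and $0$ otherwise.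
   Context: For real $\alpha$ and integer $N\ge 0$, $P_N(\alpha)=\prod_{n=1}^N |2\sin(\pi n\alpha)|$ (the Sudler product; empty product $=1$). $p_k/q_k=[a_0;a_1,\dots,a_k]$ are the convergents, so $q_0=1$, $q_1=a_1$, $q_{k+1}=a_{k+1}q_k+q_{k-1}$. The Ostrowski expansion of a non-negative integer $N$ is its unique representation $N=\sum_{k=0}^{K-1} b_k q_k$ with integers $0 \le b_0<a_1$, $0 \le b_k \le a_{k+1}$, such that $b_{k-1}=0$ whenever $b_k=a_{k+1}$. Notation: $O_T(\cdot)$ denotes a bound with implied constant depending only on $T$; $O_\alpha(\cdot)$ denotes a bound with implied constant that may depend on $\alpha$ (including $k_0,T$), but not on $N$ or $K$. *)

(* Defs.v *)
From HB Require Import structures.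
From mathcomp Require Import all_boot all_order all_algebra.
From mathcomp Require Import all_classical all_reals all_analysis.
Set Implicit Arguments. Unset Strict Implicit. Unset Printing Implicit Defensive.
Import Order.TTheory GRing.Theory Num.Theory.
Import numFieldNormedType.Exports.
Local Open Scope classical_set_scope.
Local Open Scope ring_scope.

Section Defs.
Variable R : realType.

Fixpoint cf_x (alpha : R) (k : nat) : R :=
  match k with
  | 0 => alpha - (Num.floor alpha)%:~R
  | k'.+1 => (cf_x alpha k')^-1 - (Num.floor ((cf_x alpha k')^-1))%:~R
  end.

Definition cf_a (alpha : R) (k : nat) : int :=
  match k with
  | 0 => Num.floor alpha
  | k'.+1 => Num.floor ((cf_x alpha k')^-1)
  end.

(* a_k as a natural number (a_k >= 1 for k >= 1 when alpha is irrational) *)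
Definition cf_an (alpha : R) (k : nat) : nat := `|cf_a alpha k|%N.

Fixpoint cf_qq (alpha : R) (k : nat) : nat * nat :=
  match k with
  | 0 => (1%N, 0%N)
  | k'.+1 => let: (qk, qkm1) := cf_qq alpha k' in
             (cf_an alpha k'.+1 * qk + qkm1, qk)%N
  end.

Definition cf_q (alpha : R) (k : nat) : nat := (cf_qq alpha k).1.

Definition ostrowski (alpha : R) (K : nat) (b : nat -> nat) (N : nat) : Prop :=
  [/\ N = (\sum_(k < K) b k * cf_q alpha k)%N,
      (0 < K)%N -> (b 0%N < cf_an alpha 1)%N,
      forall k, (k < K)%N -> (b k <= cf_an alpha k.+1)%N &
      forall k, (0 < k)%N -> (k < K)%N -> b k = cf_an alpha k.+1 -> b k.-1 = 0%N].

Definition sudler (alpha : R) (N : nat) : R :=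
  \prod_(1 <= n < N.+1) `|2 * sin (pi * (n%:R * alpha))|.

Definition bstar (alpha : R) (k : nat) : nat :=
  `|Num.floor ((5%:R / 6%:R) * (cf_an alpha k.+1)%:R : R)|%N.

Definition Nstar (alpha : R) (K : nat) : nat :=
  (\sum_(k < K) bstar alpha k * cf_q alpha k)%N.

Definition oint (u v : R) (f : R -> R) : R :=
  if u <= v then Rintegral lebesgue_measure `[u, v] f
  else - Rintegral lebesgue_measure `[v, u] f.

End Defs.

(* Main.v *)
(** Let [f x = ln |2 sin (pi x)|], so that [ln (P_N alpha)] is the sum of [f (n alpha)] over
[1 <= n <= N].  The digits of [N] are replaced by those of [N*] one level at a time.
Changing the digit at level [j] adds or removes blocks of [q = q_j] consecutive integers,
and on a block the points [n alpha] are [s/q - w - e_s h] with [s] running over the residues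
mod [q], [|e_s| <= 1] and [h = |q_j alpha - p_j|].  The product formula
[prod_s 2 sin (pi (s/q - w)) = 2 sin (pi q w)] evaluates the unperturbed sum; over all blocks
it is a Riemann sum for [a_{j+1}] times the integral in the statement.  By concavity of
[f] the perturbation costs at most a cotangent sum [sum_s e_s cot (pi (s/q - w))].  Here [e_s]
is a sawtooth sequence whose sums over windows of length [Q_i], a denominator of the reversed
continued fraction [[0; a_j, ..., a_1]], are bounded up to a linear drift; Abel summation makes
the contribution [O_T (1 / a_{j+1})] per block, unless the digit [b_{j-1}] is within 1% of an
end of its range, when it is [O_T ((1 + log a_j) / a_{j+1})].  The logarithms, [O (log a_j)] in
total, are charged to level [j - 1]: there [|b_{j-1} - b*_{j-1}|] is of order [a_j], and the
integral of [f] from [x] to [5/6] is at least [kappa (x - 5/6)^2] with a [kappa] slightly above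
[0.2326], so the surplus of the quadratic term absorbs them. *)
Require Import Defs.
From HB Require Import structures.
From mathcomp Require Import all_boot all_order all_algebra.
From mathcomp Require Import all_classical all_reals all_analysis.
From mathcomp Require Import complex measurable_realfun.
From mathcomp Require Import zify ring lra.
Import Order.TTheory GRing.Theory Num.Theory.
Import numFieldNormedType.Exports.
Local Open Scope classical_set_scope.
Local Open Scope ring_scope.
Set Implicit Arguments.
Unset Strict Implicit.
Unset Printing Implicit Defensive.

(** When the digit at level [j] changes, all digits above it already have their starred values.
    Because [q_k alpha - p_k] alternates in sign, those digits displace a block by at most [5/6] of
    the gap on either side. So they never push a point onto a zero of the sine, and the only
    obstruction comes from the digit just below. The number [5/6] is where the integrand turns
    negative, hence where the integral is largest.

    Claim (i) has no error term, while a level difference obeys it only up to linear and logarithmic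
    losses. Each cost is therefore the level difference corrected by two carries and then raised, if
    necessary, to the quadratic. The carries telescope, and the raising costs [O(1 / a)] because
    [kappa] exceeds [0.2326] by [3 / 10^6]. For digits above [0.99 a] only one-sided block estimates
    hold; they suffice, since (ii) does not concern such digits.

    The hypothesis on [log a_k / a_(k+1)] bounds the sum over [i >= 1] of
    [log (Q_(i+1) / Q_i) / Q_i], for levels beyond a threshold depending on [alpha]. The levels
    below the threshold go into [O_alpha(1)]. *)

Section MeanValue.
Variable R : realType.
Implicit Types (f df : R -> R) (x y a b : R).

Lemma derive_ge0_le f df a b : a <= b ->
  (forall x, a <= x <= b -> is_derive x 1 f (df x)) ->
  (forall x, a <= x <= b -> 0 <= df x) -> f a <= f b.
Proof.
move=> ab fdf df0.
have [c|x|c cab E] := @MVT_segment R f df a b ab.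
- by rewrite in_itv /= => /andP[ac cb]; apply: fdf; rewrite !ltW.
- apply: derivable_within_continuous => z zab.
  by have := fdf z _; rewrite in_itv in zab; move/(_ zab) => H; apply: ex_derive.
by rewrite -subr_ge0 E mulr_ge0 ?subr_ge0// df0//; rewrite in_itv in cab.
Qed.

Lemma derive_ge0_ge0 f df x : 0 <= x -> f 0 = 0 ->
  (forall x, is_derive x 1 f (df x)) ->
  (forall x, 0 <= x -> 0 <= df x) -> 0 <= f x.
Proof.
move=> x0 f0 fdf df0; rewrite -f0; apply: (@derive_ge0_le f df) => //.
by move=> y /andP[y0 _]; exact: df0.
Qed.

(** In this chain the difference of the two sides of each bound is the derivative of the next
    difference, and all differences vanish at [0]. So [derive_ge0_ge0] climbs from order 1 to order
    7; orders 5 and 7 serve to locate [pi]. *)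
Lemma sin_le_taylor1 x : 0 <= x -> sin x <= x.
Proof.
move=> x0; rewrite -subr_ge0.
apply: (@derive_ge0_ge0 (fun t => t - sin t) (fun t => 1 - cos t)).
- by [].
- by rewrite sin0 subrr.
- by move=> t _; rewrite subr_ge0 cos_le1.
Qed.

Lemma cos_ge_taylor2 x : 0 <= x -> 1 + (- 2^-1) * x ^+ 2 <= cos x.
Proof.
move=> x0; rewrite -subr_ge0.
apply: (@derive_ge0_ge0 (fun t => cos t - (1 + (- 2^-1) * t ^+ 2)) (fun t => t - sin t)).
- by [].
- by rewrite cos0 !expr0n /= !(mulr0,mulr1,addr0,subrr).
- move=> t; apply: is_derive_eq.
  by rewrite /GRing.scale /=; field.
- by move=> t t0; rewrite subr_ge0 sin_le_taylor1.
Qed.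

Lemma sin_ge_taylor3 x : 0 <= x -> x + (- 6^-1) * x ^+ 3 <= sin x.
Proof.
move=> x0; rewrite -subr_ge0.
apply: (@derive_ge0_ge0 (fun t => sin t - (t + (- 6^-1) * t ^+ 3)) (fun t => cos t - (1 + (- 2^-1) * t ^+ 2))).
- by [].
- by rewrite sin0 !expr0n /= !(mulr0,mulr1,addr0,subrr).
- move=> t; apply: is_derive_eq.
  by rewrite /GRing.scale /=; field.
- by move=> t t0; rewrite subr_ge0 cos_ge_taylor2.
Qed.

Lemma cos_le_taylor4 x : 0 <= x -> cos x <= 1 + (- 2^-1) * x ^+ 2 + 24^-1 * x ^+ 4.
Proof.
move=> x0; rewrite -subr_ge0.
apply: (@derive_ge0_ge0 (fun t => 1 + (- 2^-1) * t ^+ 2 + 24^-1 * t ^+ 4 - cos t) (fun t => sin t - (t + (- 6^-1) * t ^+ 3))).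
- by [].
- by rewrite cos0 !expr0n /= !(mulr0,mulr1,addr0,subrr).
- move=> t; apply: is_derive_eq.
  by rewrite /GRing.scale /=; field.
- by move=> t t0; rewrite subr_ge0 sin_ge_taylor3.
Qed.

Lemma sin_le_taylor5 x : 0 <= x -> sin x <= x + (- 6^-1) * x ^+ 3 + 120^-1 * x ^+ 5.
Proof.
move=> x0; rewrite -subr_ge0.
apply: (@derive_ge0_ge0 (fun t => t + (- 6^-1) * t ^+ 3 + 120^-1 * t ^+ 5 - sin t) (fun t => 1 + (- 2^-1) * t ^+ 2 + 24^-1 * t ^+ 4 - cos t)).
- by [].
- by rewrite sin0 !expr0n /= !(mulr0,mulr1,addr0,subrr).
- move=> t; apply: is_derive_eq.
  by rewrite /GRing.scale /=; field.
- by move=> t t0; rewrite subr_ge0 cos_le_taylor4.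
Qed.

Lemma cos_ge_taylor6 x : 0 <= x -> 1 + (- 2^-1) * x ^+ 2 + 24^-1 * x ^+ 4 + (- 720^-1) * x ^+ 6 <= cos x.
Proof.
move=> x0; rewrite -subr_ge0.
apply: (@derive_ge0_ge0 (fun t => cos t - (1 + (- 2^-1) * t ^+ 2 + 24^-1 * t ^+ 4 + (- 720^-1) * t ^+ 6)) (fun t => t + (- 6^-1) * t ^+ 3 + 120^-1 * t ^+ 5 - sin t)).
- by [].
- by rewrite cos0 !expr0n /= !(mulr0,mulr1,addr0,subrr).
- move=> t; apply: is_derive_eq.
  by rewrite /GRing.scale /=; field.
- by move=> t t0; rewrite subr_ge0 sin_le_taylor5.
Qed.

Lemma sin_ge_taylor7 x : 0 <= x -> x + (- 6^-1) * x ^+ 3 + 120^-1 * x ^+ 5 + (- (720 * 7)^-1) * x ^+ 7 <= sin x.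
Proof.
move=> x0; rewrite -subr_ge0.
apply: (@derive_ge0_ge0 (fun t => sin t - (t + (- 6^-1) * t ^+ 3 + 120^-1 * t ^+ 5 + (- (720 * 7)^-1) * t ^+ 7)) (fun t => cos t - (1 + (- 2^-1) * t ^+ 2 + 24^-1 * t ^+ 4 + (- 720^-1) * t ^+ 6))).
- by [].
- by rewrite sin0 !expr0n /= !(mulr0,mulr1,addr0,subrr).
- move=> t; apply: is_derive_eq.
  by rewrite /GRing.scale /=; field.
- by move=> t t0; rewrite subr_ge0 cos_ge_taylor6.
Qed.

Lemma sin_pi6 : sin (pi / 6 : R) = 1 / 2.
Proof.
have h : 3 * sin (pi / 6 : R) - 4 * sin (pi / 6 : R) ^+ 3 = 1.
  have := @sin_pihalf R; rewrite (_ : pi / 2 = pi / 6 *+ 2 + pi / 6 :> R); last by field.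
  rewrite sinD sin_mulr2n cos_mulr2n.
  have := cos2Dsin2 (pi / 6 : R); move: (sin _) (cos _) => s c cs e.
  have -> : 3 * s - 4 * s ^+ 3 = (c * s) *+ 2 * c + (c ^+ 2 *+ 2 - 1) * s + 4 * s * (1 - (c ^+ 2 + s ^+ 2)) by ring.
  by rewrite cs e subrr mulr0 addr0.
have s0 : 0 < sin (pi / 6 : R).
  by apply: sin_gt0_pihalf; have := @pi_gt0 R; lra.
(* The triple angle identity at [pi / 6] is a cubic with double root [1 / 2]; the other root [- 1]
   is excluded by positivity. *)
have : (sin (pi / 6 : R) + 1) * (2 * sin (pi / 6 : R) - 1) ^+ 2 = 0.
  move: h; move: (sin _) => s h.
  have -> : (s + 1) * (2 * s - 1) ^+ 2 = 1 - (3 * s - 4 * s ^+ 3) by ring.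
  by rewrite h subrr.
move/eqP; rewrite mulf_eq0 sqrf_eq0 => /orP[/eqP|/eqP]; lra.
Qed.

Lemma pi_gt31415 : (3 * 100 * 100 + 14 * 100 + 15) / (100 * 100) < pi :> R.
Proof.
have p2 := @pi_ge2 R.
(* The comparison point is [0.52359], slightly above [3.1415 / 6]. *)
have h : sin (((5 * 100 * 100 + 23 * 100 + 59) / (10 * 100 * 100)) : R) < sin (pi / 6).
  rewrite sin_pi6; apply: le_lt_trans (@sin_le_taylor5 _ _) _; first by lra.
  by lra.
rewrite ltr_sin ?in_itv/= in h; lra.
Qed.

Lemma pi_lt31416 : pi < (3 * 100 * 100 + 14 * 100 + 16) / (100 * 100) :> R.
Proof.
have p2 := @pi_ge2 R.
have h : sin (pi / 6) < sin (((52 * 100 + 36) / (100 * 100)) : R).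
  rewrite sin_pi6; apply: lt_le_trans (@sin_ge_taylor7 _ _); last by lra.
  by lra.
rewrite ltr_sin ?in_itv/= in h; lra.
Qed.

Lemma pi_gt3 : 3 < pi :> R.
Proof. by apply: lt_trans pi_gt31415; clear; lra. Qed.

Lemma pi_lt4 : pi < 4 :> R.
Proof. by apply: lt_trans pi_lt31416 _; clear; lra. Qed.

End MeanValue.

(** * The function [log |2 sin (pi x)|], its tangents and the cotangent *)

Section Lsin.
Variable R : realType.
Implicit Types x y w : R.

(** At integers the value is the default [ln 0 = 0], hence the nonvanishing assumption in
    [lsin_le_ln]. The absolute value makes evenness and period 1 hold everywhere. *)
Definition lsin x : R := ln `|2 * sin (pi * x)|.
Definition ctg x : R := cos (pi * x) / sin (pi * x).

Lemma sin_pi_gt0 x : 0 < x < 1 -> 0 < sin (pi * x).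
Proof.
move=> /andP[x0 x1]; apply: sin_gt0_pi; have := @pi_gt0 R => p0.
by rewrite mulr_gt0//= -[ltRHS]mulr1 ltr_pM2l.
Qed.

Lemma sin_pi1B x : sin (pi * (1 - x)) = sin (pi * x).
Proof. by rewrite mulrBr mulr1 addrC sinDpi sinN opprK. Qed.

Lemma cos_pi1B x : cos (pi * (1 - x)) = - cos (pi * x).
Proof. by rewrite mulrBr mulr1 addrC cosDpi cosN. Qed.

Lemma lsinN x : lsin (- x) = lsin x.
Proof. by rewrite /lsin mulrN sinN mulrN normrN. Qed.

Lemma lsinD1 x : lsin (x + 1) = lsin x.
Proof. by rewrite /lsin mulrDr mulr1 sinDpi mulrN normrN. Qed.

Lemma lsinDn x n : lsin (x + n%:R) = lsin x.
Proof. by elim: n => [|n IH]; rewrite ?addr0// -natr1 addrA lsinD1. Qed.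

Lemma lsinDz x (z : int) : lsin (x + z%:~R) = lsin x.
Proof.
case: z => n; first by rewrite -pmulrn lsinDn.
rewrite -[LHS](lsinDn _ n.+1) NegzE; congr lsin.
by rewrite mulrNz -pmulrn subrK.
Qed.

Lemma lsin1B x : lsin (1 - x) = lsin x.
Proof. by rewrite /lsin sin_pi1B. Qed.

Lemma ctg1B x : ctg (1 - x) = - ctg x.
Proof. by rewrite /ctg sin_pi1B cos_pi1B mulNr. Qed.

Lemma lsinE x : 0 < x < 1 -> lsin x = ln 2 + ln (sin (pi * x)).
Proof.
move=> x01; have s0 := sin_pi_gt0 x01.
by rewrite /lsin gtr0_norm ?mulr_gt0// lnM ?posrE.
Qed.

Lemma lsin_le_ln2 x : lsin x <= ln 2.
Proof.
rewrite /lsin; have [->|n0] := eqVneq (2 * sin (pi * x)) 0.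
  by rewrite normr0 ln0// ln_ge0//; lra.
rewrite ler_ln ?posrE ?normr_gt0//.
by rewrite normrM ger0_norm ?ler0n// ler_piMr// sin_max.
Qed.

Lemma norm_sin_le x : `|sin x| <= `|x|.
Proof.
wlog x0 : x / 0 <= x.
  move=> H; have [/H//|x0] := leP 0 x.
  by have := H (- x); rewrite sinN !normrN; apply; lra.
rewrite [leRHS]ger0_norm// ler_norml sin_le_taylor1// andbT.
have [x1|x1] := leP x 1; last by rewrite (le_trans _ (sin_geN1 _))//; lra.
apply: (@le_trans _ _ 0); first by lra.
by apply: sin_ge0_pi; rewrite x0/=; have := @pi_ge2 R; lra.
Qed.

Lemma lsin_le_ln x : sin (pi * x) != 0 -> lsin x <= ln (2 * pi * `|x|).
Proof.
move=> s0; have p0 := @pi_gt0 R.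
have x0 : x != 0 by apply: contraNneq s0 => ->; rewrite mulr0 sin0.
rewrite /lsin ler_ln ?posrE ?normr_gt0 ?mulf_neq0 ?mulr_gt0//; last by rewrite normr_gt0.
rewrite normrM ger0_norm ?ler0n// -mulrA ler_pM2l//.
by rewrite (le_trans (norm_sin_le _))// normrM gtr0_norm.
Qed.

Lemma sin_pi_ge x : 0 <= x <= 1 / 2 -> x <= sin (pi * x).
Proof.
move=> /andP[x0 x1]; have p0 := pi_gt31415 R; have p1 := pi_lt31416 R.
apply: le_trans (sin_ge_taylor3 _); last by rewrite mulr_ge0//; lra.
have h : pi * x <= 16 / 10.
  by have := @ler_pM R pi (32 / 10) x (1 / 2) ltac:(lra) x0 ltac:(lra) x1; lra.
have h1 : x <= pi * x / 3 by rewrite ler_pdivlMr// mulrC ler_wpM2r//; lra.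
have t0 : 0 <= pi * x by rewrite mulr_ge0//; lra.
move: (pi * x) h h1 t0 => t t2 xt t0; apply: (le_trans xt).
rewrite -subr_ge0 (_ : _ - _ = t * (2 / 3 - t * t / 6)); last by field.
by rewrite mulr_ge0// subr_ge0; have := ler_pM t0 t0 t2 t2; lra.
Qed.

(** A single bound for both ends of the period: it turns denominators of cotangent estimates into
    products of distances to [0] and [1]. *)
Lemma sin_pi_ge_xx x : 0 <= x <= 1 -> x * (1 - x) <= sin (pi * x).
Proof.
move=> /andP[x0 x1]; have [h|h] := leP x (1 / 2).
  by apply: le_trans (sin_pi_ge _); [nra|lra].
by rewrite -sin_pi1B; apply: le_trans (sin_pi_ge _); [nra|lra].
Qed.

Lemma ctg_subE x y : sin (pi * x) != 0 -> sin (pi * y) != 0 ->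
  ctg x - ctg y = sin (pi * (y - x)) / (sin (pi * x) * sin (pi * y)).
Proof.
by move=> x0 y0; rewrite /ctg mulrBr sinB; field; rewrite x0 y0.
Qed.

Lemma ctg_decr x y : 0 < x -> x <= y -> y < 1 -> ctg y <= ctg x.
Proof.
move=> x0 xy y1; have [->//|ne] := eqVneq x y.
have lt : x < y by rewrite lt_neqAle ne.
have sx : 0 < sin (pi * x) by apply: sin_pi_gt0; apply/andP; split; lra.
have sy : 0 < sin (pi * y) by apply: sin_pi_gt0; apply/andP; split; lra.
have syx : 0 < sin (pi * (y - x)) by apply: sin_pi_gt0; apply/andP; split; lra.
by rewrite -subr_ge0 ctg_subE ?gt_eqF// divr_ge0// ?mulr_ge0// ltW.
Qed.

Lemma ctg_diff_le x y : 0 < x -> x <= y -> y < 1 ->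
  ctg x - ctg y <= pi * (y - x) / (x * (1 - x) * (y * (1 - y))).
Proof.
move=> x0 xy y1.
rewrite ctg_subE ?gt_eqF ?sin_pi_gt0 ?(lt_le_trans x0) ?(le_lt_trans xy)//.
have sx := sin_pi_gt0 (x := x) ltac:(apply/andP; split; lra).
have sy := sin_pi_gt0 (x := y) ltac:(apply/andP; split; lra).
have gx := sin_pi_ge_xx (x := x) ltac:(apply/andP; split; lra).
have gy := sin_pi_ge_xx (x := y) ltac:(apply/andP; split; lra).
have px : 0 < x * (1 - x) by rewrite mulr_gt0; lra.
have py : 0 < y * (1 - y) by rewrite mulr_gt0; lra.
have p0 := @pi_gt0 R.
have px' : 0 <= pi * (y - x) by rewrite mulr_ge0 ?subr_ge0// ltW.
apply: (@le_trans _ _ (pi * (y - x) / (sin (pi * x) * sin (pi * y)))).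
  rewrite ler_pM2r ?invr_gt0 ?mulr_gt0//.
  exact: sin_le_taylor1.
rewrite ler_wpM2l// lef_pV2 ?posrE ?(mulr_gt0 px py) ?(mulr_gt0 sx sy)//.
by apply: ler_pM => //; exact: ltW.
Qed.

Lemma ctg_diff_le_box x y (u d v d' : R) : 0 < u -> 0 < d -> 0 < v -> 0 < d' ->
  u <= x -> x <= 1 - d -> v <= y -> y <= 1 - d' -> x <= y ->
  `|ctg x - ctg y| <= 4 * (y - x) * (u * d * (v * d'))^-1.
Proof.
move=> u0 d0 v0 d0' ux xd vy yd xy.
have x0 := lt_le_trans u0 ux; have y1 : y < 1 by rewrite (le_lt_trans yd)// gtrBl.
have := ctg_diff_le x0 xy y1; have := ctg_decr x0 xy y1.
rewrite -subr_ge0 => /ger0_norm -> /le_trans; apply.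
have yx : 0 <= y - x by rewrite subr_ge0.
have p4 : pi <= 4 :> R by exact/ltW/pi_lt4.
have dx : d <= 1 - x by rewrite lerBrDl -lerBrDr.
have dy : d' <= 1 - y by rewrite lerBrDl -lerBrDr.
have X0 := mulr_gt0 u0 d0; have Y0 := mulr_gt0 v0 d0'.
have X := ler_pM (ltW u0) (ltW d0) ux dx; have Y := ler_pM (ltW v0) (ltW d0') vy dy.
apply: ler_pM; rewrite ?mulr_ge0 ?pi_ge0// ?invr_ge0.
- exact: ltW (mulr_gt0 (lt_le_trans X0 X) (lt_le_trans Y0 Y)).
- by rewrite ler_wpM2r.
rewrite lef_pV2 ?posrE; [exact: ler_pM (ltW X0) (ltW Y0) X Y|exact: mulr_gt0 (lt_le_trans X0 X) (lt_le_trans Y0 Y)|exact: mulr_gt0].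
Qed.

Lemma norm_ctg_le x : 0 < x < 1 -> `|ctg x| <= (x * (1 - x))^-1.
Proof.
move=> x01; have s0 := sin_pi_gt0 x01; have /andP[x0 x1] := x01.
rewrite /ctg normrM normfV (gtr0_norm s0) -[leRHS]mul1r.
apply: ler_pM => //; rewrite ?invr_ge0 ?(ltW s0)// ?cos_max//.
rewrite lef_pV2 ?posrE ?mulr_gt0 ?subr_gt0//.
by apply: sin_pi_ge_xx; rewrite !ltW.
Qed.

Lemma norm_ctg_le_box x (m d : R) : 0 < m -> 0 < d -> m <= x -> x <= 1 - d -> `|ctg x| <= (m * d)^-1.
Proof.
move=> m0 d0 mx xd; apply: le_trans (norm_ctg_le _) _; first by apply/andP; split; lra.
rewrite lef_pV2 ?posrE ?mulr_gt0//; [|lra|lra].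
by apply: ler_pM; lra.
Qed.

Lemma is_derive_lnsin x : 0 < x < 1 ->
  is_derive x 1 (fun t => ln (sin (pi * t))) (pi * ctg x).
Proof.
move=> x01; have s0 := sin_pi_gt0 x01.
have d1 : is_derive x 1 (fun t => sin (pi * t)) (pi * cos (pi * x)).
  by apply: is_derive_eq; rewrite /GRing.scale /=; ring.
have := @is_derive1_comp R (@ln R) (fun t => sin (pi * t)) x _ _ (is_derive1_ln s0) d1.
by move/is_derive_eq; apply; rewrite /ctg; field; rewrite gt_eqF.
Qed.

(** Concavity: the derivative [pi * ctg] is decreasing. Taken with the tangent at either of two
    points it bounds the increment from both sides, so curvature enters only as a difference of two
    cotangents. *)
Lemma lsin_tangent x y : 0 < x < 1 -> 0 < y < 1 ->
  lsin y - lsin x <= pi * ctg x * (y - x).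
Proof.
move=> x01 y01; rewrite !lsinE//.
have p0 := @pi_gt0 R.
have [/andP[x0 x1] /andP[y0 y1]] := (x01, y01).
have mv a b : 0 < a -> a < b -> b < 1 -> exists2 c, a < c < b &
    ln (sin (pi * b)) - ln (sin (pi * a)) = pi * ctg c * (b - a).
  move=> a0 ab b1.
  have [c|c|c cab ->] := @MVT R (fun t => ln (sin (pi * t))) (fun t => pi * ctg t) a b ab.
  - by rewrite in_itv /= => /andP[ac cb]; apply: is_derive_lnsin; apply/andP; split; lra.
  - apply: derivable_within_continuous => z; rewrite in_itv /= => /andP[ac cb].
    have : is_derive z 1 (fun t => ln (sin (pi * t))) (pi * ctg z).
      by apply: is_derive_lnsin; apply/andP; split; lra.
    by move=> H; apply: ex_derive.
  by exists c.
case: (ltgtP x y) => [xy|yx|->]; last by rewrite !subrr mulr0.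
- have [c /andP[xc cy] E] := mv _ _ x0 xy y1.
  rewrite [leLHS](_ : _ = ln (sin (pi * y)) - ln (sin (pi * x))); last by ring.
  rewrite E ler_pM2r ?subr_gt0// ler_pM2l// ctg_decr//; lra.
- have [c /andP[xc cy] E] := mv _ _ y0 yx x1.
  rewrite [leLHS](_ : _ = - (ln (sin (pi * x)) - ln (sin (pi * y)))); last by ring.
  rewrite E -mulrN opprB -subr_ge0 -mulrBl mulr_le0// ?subr_le0 ?(ltW yx)//.
  by rewrite ler_pM2l// ctg_decr//; lra.
Qed.

End Lsin.

(** * The product formula for sines, from the factorisation of [X^q - 1] *)

Section ProductFormula.
Variable R : realType.
Implicit Types (a b : R) (z w : R[i]).

Definition expi a : R[i] := Complex (cos a) (sin a).
(** The squared modulus: polynomial in the coordinates, so that multiplicativity is a ring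
    identity. *)
Definition sqnorm z : R := let: Complex a b := z in a ^+ 2 + b ^+ 2.

Lemma expiD a b : expi (a + b) = expi a * expi b.
Proof. by rewrite /expi cosD sinD; congr Complex; rewrite addrC mulrC [X in _ + X]mulrC. Qed.

Lemma expi_pow a n : expi a ^+ n = expi (n%:R * a).
Proof.
elim: n => [|n IH]; first by rewrite mul0r /expi cos0 sin0 expr0.
by rewrite exprS IH -expiD -natr1 mulrDl mul1r addrC.
Qed.

Lemma expi_2pi (n : nat) : expi (2 * pi * n%:R) = 1.
Proof.
have -> : 2 * pi * n%:R = n%:R * (pi *+ 2) :> R by ring.
by rewrite -expi_pow /expi cos2pi sin2pi (_ : Complex 1 0 = 1) ?expr1n.
Qed.

Lemma sqnormM z w : sqnorm (z * w) = sqnorm z * sqnorm w.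
Proof. by case: z => a b; case: w => c d; rewrite /sqnorm /=; ring. Qed.

Lemma sqnorm_expi_sub a b : sqnorm (expi a - expi b) = (2 * sin ((a - b) / 2)) ^+ 2.
Proof.
have -> : sqnorm (expi a - expi b) = 2 - 2 * cos (a - b).
  rewrite cosB /sqnorm /=.
  have := cos2Dsin2 a; have := cos2Dsin2 b.
  move: (cos a) (sin a) (cos b) (sin b) => p q r s h1 h2.
  have -> : (p - r) ^+ 2 + (q - s) ^+ 2 = (p ^+ 2 + q ^+ 2) + (r ^+ 2 + s ^+ 2) - 2 * (p * r + q * s) by ring.
  by rewrite h1 h2.
rewrite [in LHS](_ : a - b = ((a - b) / 2) *+ 2); last by field.
by rewrite cos_mulr2n exprMn sin2cos2; ring.
Qed.

Lemma expi_inj_lt q (s t : nat) : (s < q)%N -> (t < q)%N ->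
  expi (2 * pi * (s%:R / q%:R)) = expi (2 * pi * (t%:R / q%:R)) -> s = t.
Proof.
wlog st : s t / (s <= t)%N.
  move=> H sq tq e; have [st|ts] := leqP s t; first exact: H.
  by apply/esym/H => //; exact: ltnW.
move=> sq tq e.
have q0 : (0 : R) < q%:R by rewrite ltr0n; lia.
have : sqnorm (expi (2 * pi * (t%:R / q%:R)) - expi (2 * pi * (s%:R / q%:R))) = 0.
  by rewrite e subrr /sqnorm /= expr0n addr0.
rewrite sqnorm_expi_sub => /eqP; rewrite sqrf_eq0 mulf_eq0 pnatr_eq0 /=.
have -> : (2 * pi * (t%:R / q%:R) - 2 * pi * (s%:R / q%:R)) / 2 = pi * ((t - s)%:R / q%:R) :> R.
  by rewrite natrB//; field; rewrite gt_eqF.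
move=> h; apply/eqP; rewrite eqn_leq st /=; rewrite leqNgt; apply/negP => lt.
move: h; rewrite gt_eqF// sin_pi_gt0//.
apply/andP; split; first by rewrite divr_gt0// ltr0n subn_gt0.
by rewrite ltr_pdivrMr// mul1r ltr_nat; lia.
Qed.

Lemma Xn_sub1_expi q : (0 < q)%N ->
  'X^q - 1 = \prod_(s < q) ('X - (expi (2 * pi * (s%:R / q%:R)))%:P) :> {poly R[i]}.
Proof.
move=> q0; have qr : q%:R != 0 :> R by rewrite pnatr_eq0 -lt0n.
pose rs := [seq expi (2 * pi * ((val s)%:R / q%:R)) | s <- index_enum 'I_q].
have srs : size rs = q by rewrite size_map /index_enum -enumT size_enum_ord.
have := @all_roots_prod_XsubC _ ('X^q - 1 : {poly R[i]}) rs.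
rewrite size_XnsubC// srs (monicP (monicXnsubC 1 q0)) scale1r big_map; apply => //.
- apply/allP => _ /mapP[s _ ->]; rewrite rootE hornerD hornerN hornerC hornerXn expi_pow.
  rewrite (_ : q%:R * _ = 2 * pi * s%:R); last by field.
  by rewrite expi_2pi subrr.
- rewrite uniq_rootsE map_inj_uniq; first exact: index_enum_uniq.
  by move=> s t /expi_inj_lt h; apply/val_inj/h; exact: ltn_ord.
Qed.

(** Evaluate [X^q - 1] and its linear factors at [expi (2 pi w)] and take squared moduli: the
    distance of two points of the unit circle is twice the sine of half the angle between them. *)
Lemma prod_sin_pi q (w : R) : (0 < q)%N ->
  \prod_(s < q) `|2 * sin (pi * (s%:R / q%:R - w))| = `|2 * sin (pi * (q%:R * w))|.
Proof.
move=> q0; have qr : q%:R != 0 :> R by rewrite pnatr_eq0 -lt0n.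
apply/eqP; rewrite -(@eqrXn2 _ 2)// ?prodr_ge0//.
rewrite -prodrXl [eqbRHS]real_normK ?num_real//.
have := congr1 (fun p : {poly R[i]} => sqnorm p.[expi (2 * pi * w)]) (Xn_sub1_expi q0).
rewrite hornerD hornerN hornerC hornerXn horner_prod (big_morph _ sqnormM (_ : sqnorm 1 = 1)); last first.
  by rewrite /sqnorm /= expr0n addr0 expr1n.
have -> : (1 : R[i]) = expi 0 by rewrite /expi cos0 sin0.
rewrite expi_pow sqnorm_expi_sub.
have -> : (q%:R * (2 * pi * w) - 0) / 2 = pi * (q%:R * w) by field.
move=> ->; apply/eqP; apply: eq_bigr => s _.
rewrite hornerXsubC sqnorm_expi_sub real_normK ?num_real//.
have -> : (2 * pi * w - 2 * pi * (s%:R / q%:R)) / 2 = - (pi * (s%:R / q%:R - w)) by field.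
by rewrite sinN mulrN sqrrN.
Qed.

Lemma sum_lsin q (w : R) : (0 < q)%N -> sin (pi * (q%:R * w)) != 0 ->
  \sum_(s < q) lsin (s%:R / q%:R - w) = lsin (q%:R * w).
Proof.
move=> q0 s0; have := prod_sin_pi w q0.
have n0 : `|2 * sin (pi * (q%:R * w))| != 0 by rewrite normr_eq0 mulf_neq0.
move=> h; rewrite [in RHS]/lsin -h.
have p s : (s < q)%N -> 0 < `|2 * sin (pi * (s%:R / q%:R - w))|.
  move=> sq; rewrite lt_neqAle normr_ge0 andbT eq_sym; apply: contraNneq n0 => e.
  by rewrite -h (bigD1 (Ordinal sq))//= e mul0r.
suff [] : \sum_(s < q) lsin (s%:R / q%:R - w) = ln (\prod_(s < q) `|2 * sin (pi * (s%:R / q%:R - w))|) /\ 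
   0 < \prod_(s < q) `|2 * sin (pi * (s%:R / q%:R - w))| by [].
elim/big_rec2 : _ => [|s x y _ [-> y0]]; first by rewrite ln1.
have ps := p s (ltn_ord s).
by rewrite mulr_gt0// lnM.
Qed.

End ProductFormula.

(** * Sums of a sawtooth over a window whose length is a denominator of a good approximation *)

Section Sawtooth.
Variable R : realType.

Lemma sum_modn_coprime (Q P k : nat) (F : nat -> R) : (0 < Q)%N -> coprime P Q ->
  \sum_(i < Q) F ((i * P + k) %% Q)%N = \sum_(i < Q) F i.
Proof.
move=> Q0 PQ.
pose h (i : 'I_Q) : 'I_Q := Ordinal (ltn_pmod (i * P + k) Q0).
have hi : injective h.
  suff H (i j : 'I_Q) : (i <= j)%N -> h i = h j -> i = j.
    move=> i j e; have [/H|/ltnW/H H'] := leqP i j; first exact.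
    exact/esym/H'.
  move=> ij /(congr1 val) /= /eqP.
  rewrite eqn_modDr eq_sym eqn_mod_dvd ?leq_mul2r ?ij ?orbT// -mulnBl Gauss_dvdl; last by rewrite coprime_sym.
  move=> /dvdn_leq h'; apply/val_inj/eqP; rewrite eqn_leq ij /= -subn_eq0.
  by rewrite -leqn0 leqNgt; apply/negP => /h'; have := ltn_ord j; lia.
by rewrite [RHS](reindex_inj hi).
Qed.

Lemma sum_ord_id n : \sum_(i < n) i%:R = n%:R * (n%:R - 1) / 2 :> R.
Proof.
elim: n => [|n IH]; first by rewrite big_ord0 !mul0r.
by rewrite big_ord_recr /= IH -natr1; field.
Qed.

Lemma saw_term (q A Q P v c i K : nat) : (0 < q)%N -> (i < Q)%N ->
  (Q * A = P * q + v \/ Q * A + v = P * q)%N -> (Q * v <= q)%N ->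
  K = ((i * P + (Q * c) %/ q) %% Q)%N ->
  `| ((i * A + c) %% q)%:R / q%:R - K%:R / Q%:R |
    <= 2 / Q%:R + ((K == 0)%N%:R + (K == Q.-1)%N%:R) :> R.
Proof.
move=> q0 iQ hA hv eK.
have Q0 : (0 < Q)%N by lia.
have qr : (0 : R) < q%:R by rewrite ltr0n.
have Qr : (0 : R) < Q%:R by rewrite ltr0n.
set r := ((i * A + c) %% q)%N.
have rq : (r < q)%N by rewrite ltn_mod.
have KQ : (K < Q)%N by rewrite eK ltn_mod.
have [h|h] := boolP ((K == 0)%N || (K == Q.-1)%N).
  apply: (@le_trans _ _ 1).
    have : 0 <= (r%:R / q%:R : R) <= 1.
      by apply/andP; split; [rewrite divr_ge0 ?ler0n|rewrite ler_pdivrMr// mul1r ler_nat ltnW].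
    have : 0 <= (K%:R / Q%:R : R) <= 1.
      by apply/andP; split; [rewrite divr_ge0 ?ler0n|rewrite ler_pdivrMr// mul1r ler_nat ltnW].
    by move: (_ / _) (_ / _) => x y /andP[? ?] /andP[? ?]; rewrite ler_norml; apply/andP; split; lra.
  have : 0 <= 2 / Q%:R :> R by rewrite divr_ge0 ?ler0n.
  by case/orP: h => ->; case: eqP => _; rewrite /=; lra.
move: h; rewrite negb_or => /andP[K0 KQ1].
have e1 : (i * A + c = (i * A + c) %/ q * q + r)%N := divn_eq _ _.
have e2 : (i * P + (Q * c) %/ q = (i * P + (Q * c) %/ q) %/ Q * Q + K)%N by rewrite eK -divn_eq.
have e3 : (Q * c = (Q * c) %/ q * q + (Q * c) %% q)%N := divn_eq _ _.
have l3 : ((Q * c) %% q < q)%N by rewrite ltn_mod.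
have l4 : (i * v <= q)%N by apply: leq_trans hv; rewrite leq_mul2r ltnW ?orbT.
move: e1 e2 e3 l3; clear eK; move: r rq => r rq.
move: ((i * A + c) %/ q)%N ((i * P + (Q * c) %/ q) %/ Q)%N => F G.
move: ((Q * c) %/ q)%N ((Q * c) %% q)%N => k0 p e1 e2 e3 l3.
(* [th] collects the remainder of [Q c] modulo [q] and the drift [i v]; the right side counts wraps,
   each worth [Q q]. *)
have E : exists2 th : int, (- q%:Z <= th <= 2 * q%:Z)%R &
    (Q%:Z * r%:Z - q%:Z * K%:Z - th = Q%:Z * q%:Z * (G%:Z - F%:Z))%R.
  have e1' : (Q%:Z * (i%:Z * A%:Z + c%:Z) = Q%:Z * (F%:Z * q%:Z + r%:Z))%R by lia.
  have e2' : (q%:Z * (i%:Z * P%:Z + k0%:Z) = q%:Z * (G%:Z * Q%:Z + K%:Z))%R by lia.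
  case: hA => hA.
    exists (p%:Z + i%:Z * v%:Z)%R; first by lia.
    have h' : (i%:Z * (Q%:Z * A%:Z) = i%:Z * (P%:Z * q%:Z + v%:Z))%R by lia.
    by lia.
  exists (p%:Z - i%:Z * v%:Z)%R; first by lia.
  have h' : (i%:Z * (Q%:Z * A%:Z + v%:Z) = i%:Z * (P%:Z * q%:Z))%R by lia.
  by lia.
have [th thq E'] := E.
(* As [K] is neither [0] nor [Q - 1], the left side is too small for even one wrap. *)
have GF : G = F.
  have [gf|gf|//] := ltngtP G F.
    have : (Q%:Z * q%:Z * (F%:Z - G%:Z - 1) >= 0)%R by rewrite !mulr_ge0//; lia.
    have : (0 <= Q%:Z * r%:Z)%R by lia.
    have : (q%:Z * K%:Z <= q%:Z * (Q%:Z - 2))%R by rewrite ler_wpM2l//; lia.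
    by lia.
  have : (Q%:Z * q%:Z * (G%:Z - F%:Z - 1) >= 0)%R by rewrite !mulr_ge0//; lia.
  have : (Q%:Z * r%:Z <= Q%:Z * (q%:Z - 1))%R by rewrite ler_wpM2l//; lia.
  have : (q%:Z * 1 <= q%:Z * K%:Z)%R by rewrite ler_wpM2l//; lia.
  by lia.
have b : `|Q%:R * r%:R - q%:R * K%:R| <= 2 * q%:R :> R.
  move: E'; rewrite GF subrr mulr0 => /eqP; rewrite subr_eq0 => /eqP => E2.
  have : `|Q%:Z * r%:Z - q%:Z * K%:Z| <= 2 * q%:Z by rewrite E2; lia.
  by rewrite -(ler_int R) intr_norm !rmorphB /= !rmorphM /=.
have -> : r%:R / q%:R - K%:R / Q%:R = (Q%:R * r%:R - q%:R * K%:R) / (q%:R * Q%:R) :> R.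
  by field; rewrite !gt_eqF.
apply: (@le_trans _ _ (2 / Q%:R)); last by rewrite lerDl addr_ge0.
rewrite normrM normfV (gtr0_norm (mulr_gt0 qr Qr)) ler_pdivrMr ?mulr_gt0//.
by apply: le_trans b _; rewrite mulrCA [2 / _ * _]mulrAC -mulrA mulfV ?gt_eqF// mulr1 mulrC.
Qed.

Lemma sum_ord_delta n k : \sum_(i < n) (((i : nat) == k)%N%:R) <= 1 :> R.
Proof.
have [kn|nk] := ltnP k n.
  rewrite (bigD1 (Ordinal kn))//= eqxx big1 ?addr0// => i.
  by rewrite -val_eqE /= => /negPf ->.
by rewrite big1// => i _; case: eqP => // e; have := ltn_ord i; rewrite e ltnNge nk.
Qed.

(** The residues [K] run once through all classes mod [Q], so the sum of [K / Q - 1 / 2] is exactly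
    [- 1 / 2]. The errors of [saw_term] add up to at most [2 + 1 + 1], and [5] is a rounding up. *)
Lemma saw_block (q A Q P v c : nat) : (0 < q)%N -> (0 < Q)%N -> coprime P Q ->
  (Q * A = P * q + v \/ Q * A + v = P * q)%N -> (Q * v <= q)%N ->
  `| \sum_(i < Q) (((i * A + c) %% q)%:R / q%:R - 1 / 2) | <= 5 :> R.
Proof.
move=> q0 Q0 PQ hA hv.
have Qr : (0 : R) < Q%:R by rewrite ltr0n.
pose F (K : nat) : R := K%:R / Q%:R.
pose G (K : nat) : R := 2 / Q%:R + ((K == 0)%N%:R + (K == Q.-1)%N%:R).
pose k := ((Q * c) %/ q)%N.
have -> : \sum_(i < Q) (((i * A + c) %% q)%:R / q%:R - 1 / 2) =
  \sum_(i < Q) (((i * A + c) %% q)%:R / q%:R - F ((i * P + k) %% Q)%N) - 1 / 2 :> R.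
  have sF : \sum_(i < Q) F i = (Q%:R - 1) / 2.
    by rewrite -mulr_suml (sum_ord_id Q); field; rewrite gt_eqF.
  by rewrite !sumrB (sum_modn_coprime k F Q0 PQ) sF sumr_const card_ord -mulr_natr; field.
apply: le_trans (ler_normB _ _) _.
have : `|\sum_(i < Q) (((i * A + c) %% q)%:R / q%:R - F ((i * P + k) %% Q)%N)| <= 4.
  apply: le_trans (ler_norm_sum _ _ _) _.
  apply: (@le_trans _ _ (\sum_(i < Q) G ((i * P + k) %% Q)%N)).
    by apply: ler_sum => i _; apply: (saw_term (P := P) (v := v)).
  have Q2 : (2 / Q%:R) *+ Q = 2 :> R by rewrite -mulr_natr; field; rewrite gt_eqF.
  rewrite sum_modn_coprime// /G !big_split /= sumr_const card_ord Q2.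
  by have := sum_ord_delta Q 0; have := sum_ord_delta Q Q.-1; lra.
have -> : `|1 / 2 : R| = 1 / 2 by rewrite ger0_norm//; lra.
lra.
Qed.

End Sawtooth.

(** * Sums over arbitrary intervals, cut greedily into windows *)

Section WindowSums.
Variables (R : realType) (g : nat -> R) (Q : nat -> nat) (C : R).
Hypothesis Q0 : Q 0%N = 1%N.
Hypothesis Qgt0 : forall i, (0 < Q i)%N.

(** A bound for the number of windows in the greedy decomposition of [n]: length [Q i] is used at
    most [min (n, Q (i + 1)) / Q i] times, and only if [Q i <= n]. *)
Definition window_weight (J n : nat) : R :=
  \sum_(i < J) (Q i <= n)%N%:R * ((minn n (Q i.+1))%:R / (Q i)%:R).

Lemma window_weight_mono J m n : (m <= n)%N -> window_weight J m <= window_weight J n.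
Proof.
move=> mn; apply: ler_sum => i _; apply: ler_pM; rewrite ?divr_ge0//.
  by rewrite ler_nat; case: (leqP (Q i) m) => // h; rewrite (leq_trans h mn).
by rewrite ler_pM2r ?invr_gt0 ?ltr0n// ler_nat; lia.
Qed.

Lemma sum_window_cat a b s :
  \sum_(t < a + b) g (s + t)%N = \sum_(t < a) g (s + t)%N + \sum_(t < b) g (s + a + t)%N.
Proof. by rewrite big_split_ord /=; congr (_ + _); apply: eq_bigr => t _; rewrite addnA. Qed.

Lemma window_sum_le J : 0 <= C ->
  (forall i s, (i < J)%N -> `|\sum_(t < Q i) g (s + t)%N| <= C) ->
  forall n s, (n < Q J)%N -> `|\sum_(t < n) g (s + t)%N| <= C * window_weight J n.
Proof.
move=> C0; elim: J => [|J IH] hb n s nQ.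
  by move: nQ; rewrite Q0 ltnS leqn0 => /eqP ->; rewrite big_ord0 normr0 /window_weight big_ord0 mulr0.
have {}IH := IH (fun i s iJ => hb i s (ltnW iJ)).
have blocks a s' : `|\sum_(t < a * Q J) g (s' + t)%N| <= C * a%:R.
  elim: a => [|a IHa]; first by rewrite mul0n big_ord0 normr0 mulr0.
  rewrite mulSn addnC sum_window_cat.
  by apply: le_trans (ler_normD _ _) _; rewrite -natr1 mulrDr mulr1 lerD// hb.
rewrite /window_weight big_ord_recr /= -/(window_weight J n).
have [lt|ge] := ltnP n (Q J).
  by rewrite mul0r addr0; exact: IH.
set a := (n %/ Q J)%N.
have nE : n = (a * Q J + n %% Q J)%N by exact: divn_eq.
have := sum_window_cat (a * Q J) (n %% Q J) s; rewrite -nE => ->.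
apply: le_trans (ler_normD _ _) _; rewrite addrC mulrDr lerD//; last first.
  by apply: (le_trans (IH _ _ _)); rewrite ?ltn_mod// ler_wpM2l// window_weight_mono// leq_mod.
apply: (le_trans (blocks _ _)); rewrite ler_wpM2l// mul1r.
rewrite ler_pdivlMr ?ltr0n// -natrM ler_nat leq_min leq_divM /=.
by apply: leq_trans (leq_divM _ _) _; exact: ltnW.
Qed.

End WindowSums.

(** * Summation tools: weighted harmonic sums, Abel summation, cotangent increments *)

Section CotangentSums.
Variable R : realType.

Lemma invS_le_ln n : (0 < n)%N -> n.+1%:R^-1 <= ln n.+1%:R - ln n%:R :> R.
Proof.
move=> n0; have nr : (0 : R) < n%:R by rewrite ltr0n.
have sr : (0 : R) < n.+1%:R by rewrite ltr0n.
rewrite -opprB -ln_div ?posrE//.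
have -> : n%:R / n.+1%:R = 1 + - n.+1%:R^-1 :> R by rewrite -natr1; field; rewrite natr1 gt_eqF.
rewrite lerNr; apply: le_ln1Dx.
by rewrite ltrN2 invf_lt1// ltr1n.
Qed.

(** Below [B] the terms are [1 / (n + 1)] and sum to a logarithm; from [B] on they are
    [B / (n (n + 1))] and telescope to at most 1. The function [phi] in the proof is the primitive
    glued from these two regimes. *)
Lemma weighted_harmonic_le l B H : (0 < l)%N -> (l <= B)%N ->
  \sum_(n < H) (l <= n)%N%:R * ((minn n B)%:R / (n%:R * n.+1%:R)) <= ln (B%:R / l%:R) + 1 :> R.
Proof.
move=> l0 lB.
have lr : (0 : R) < l%:R by rewrite ltr0n.
have Br : (0 : R) < B%:R by rewrite ltr0n; lia.
pose phi (n : nat) : R := if (n <= l)%N then 0 else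
  if (n <= B)%N then ln n%:R - ln l%:R else ln B%:R - ln l%:R + 1 - B%:R / n%:R.
have lnlB : ln l%:R <= ln B%:R :> R by rewrite ler_ln ?posrE// ler_nat.
apply: (@le_trans _ _ (phi H)); last first.
  rewrite ln_div ?posrE// /phi; case: leqP => lH.
    by rewrite addr_ge0// subr_ge0.
  have Hr : (0 : R) < H%:R by rewrite ltr0n; lia.
  case: leqP => HB.
    by have : ln H%:R <= ln B%:R :> R; [rewrite ler_ln ?posrE// ler_nat|lra].
  by have : 0 <= B%:R / H%:R :> R; [rewrite divr_ge0|lra].
elim: H => [|H IH]; first by rewrite big_ord0 /phi.
rewrite big_ord_recr /=.
have [lH|Hl] := leqP l H; last first.
  by rewrite mul0r addr0 (le_trans IH)// /phi ltnW// Hl.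
rewrite mul1r.
have H0 : (0 < H)%N by lia.
have Hr : (0 : R) < H%:R by rewrite ltr0n.
have Sr : (0 : R) < H.+1%:R by rewrite ltr0n.
have iv := invS_le_ln H0.
have phiH : (H <= B)%N -> phi H = ln H%:R - ln l%:R.
  rewrite /phi => ->; case: leqP => // h; have -> : H = l by lia.
  by rewrite subrr.
have phiH' : (B <= H)%N -> phi H = ln B%:R - ln l%:R + 1 - B%:R / H%:R.
  rewrite leq_eqVlt => /orP[/eqP eB|BH].
    by rewrite phiH -?eB// mulfV ?gt_eqF// addrK.
  have lH' : (H <= l)%N = false by apply/negbTE; rewrite -ltnNge (leq_ltn_trans lB).
  by rewrite /phi lH' leqNgt BH.
have -> : phi H.+1 = if (H < B)%N then ln H.+1%:R - ln l%:R else ln B%:R - ln l%:R + 1 - B%:R / H.+1%:R.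
  by rewrite /phi leqNgt ltnS lH.
case: (ltnP H B) => HB.
  rewrite phiH in IH; last by lia.
  have -> : H%:R / (H%:R * H.+1%:R) = H.+1%:R^-1 :> R by field; rewrite !gt_eqF.
  by apply: le_trans (lerD IH iv) _; lra.
rewrite phiH' // in IH.
have -> : B%:R / (H%:R * H.+1%:R) = B%:R / H%:R - B%:R / H.+1%:R :> R.
  by rewrite -natr1; field; rewrite natr1 !gt_eqF.
apply: le_trans (lerD IH (lexx _)) _.
by move: (B%:R / H.+1%:R) (B%:R / H%:R) => y z; lra.
Qed.

Lemma sum_inv_sqr_le n : \sum_(1 <= t < n.+1) (t%:R ^+ 2)^-1 <= 2 :> R.
Proof.
(* The sharper bound is what the induction preserves. *)
suff : \sum_(1 <= t < n.+2) (t%:R ^+ 2)^-1 <= 2 - n.+1%:R^-1 :> R.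
  case: n => [|n] h; first by rewrite big_geq.
  have : 0 <= n.+1%:R^-1 :> R by rewrite invr_ge0.
  have : \sum_(1 <= t < n.+2) (t%:R ^+ 2)^-1 <= \sum_(1 <= t < n.+3) (t%:R ^+ 2)^-1 :> R.
    by rewrite [leRHS]big_nat_recr//= lerDl invr_ge0 exprn_ge0.
  have : 0 <= n.+2%:R^-1 :> R by rewrite invr_ge0.
  by move: (n.+2%:R^-1) h => x h; lra.
elim: n => [|n IH]; first by rewrite big_nat1 expr1n invr1; lra.
rewrite big_nat_recr//=.
apply: (le_trans (lerD IH (lexx _))).
have r1 : (0 : R) < n.+1%:R by rewrite ltr0n.
have e : n.+2%:R = n.+1%:R + 1 :> R by rewrite -natr1.
rewrite e; move: (n.+1%:R) r1 => x x0.
rewrite -subr_ge0.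
have -> : 2 - (x + 1)^-1 - (2 - x^-1 + ((x + 1) ^+ 2)^-1) = (x * (x + 1) ^+ 2)^-1.
  by field; rewrite !gt_eqF//; lra.
by rewrite invr_ge0 mulr_ge0 ?exprn_ge0//; lra.
Qed.

Lemma abel_sum (x c : nat -> R) (V : nat -> R) r H : (r <= H)%N ->
  (forall n, (r <= n <= H)%N -> `|\sum_(r.+1 <= s < n.+1) x s| <= V n) ->
  0 <= c H -> (forall n, (r <= n < H)%N -> c n.+1 <= c n) ->
  `|\sum_(r.+1 <= s < H.+1) x s * c s| <= V H * c H + \sum_(r <= n < H) V n * (c n - c n.+1).
Proof.
move=> rH hV cH hc.
have -> : \sum_(r.+1 <= s < H.+1) x s * c s = (\sum_(r.+1 <= s < H.+1) x s) * c H +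
    \sum_(r <= n < H) (\sum_(r.+1 <= s < n.+1) x s) * (c n - c n.+1).
  clear hV cH hc; move: rH; elim: H => [|H IH] rH.
    by rewrite !big_geq// mul0r addr0.
  have [e|ne] := eqVneq r H.+1; first by rewrite -e !big_geq// mul0r addr0.
  have rH' : (r <= H)%N by lia.
  rewrite [LHS]big_nat_recr// IH// (big_nat_recr H.+1 r.+1 x)// (big_nat_recr H r)//=.
  by ring.
apply: le_trans (ler_normD _ _) _; apply: lerD.
  by rewrite normrM (ger0_norm cH) ler_wpM2r// hV// rH leqnn.
apply: le_trans (ler_norm_sum _ _ _) _.
rewrite big_nat [leRHS]big_nat; apply: ler_sum => n /andP[rn nH].
have h : c n.+1 <= c n by apply: hc; rewrite rn.
rewrite normrM [X in _ * X]ger0_norm ?subr_ge0//.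
by rewrite ler_wpM2r ?subr_ge0// hV// rn ltnW.
Qed.

Lemma sum_nat_flip (F : nat -> R) q H : (H <= q)%N ->
  \sum_(q - H <= s < q) F s = \sum_(1 <= t < H.+1) F (q - t)%N.
Proof.
elim: H => [|H IH] Hq; first by rewrite subn0 !big_geq.
rewrite big_ltn ?subnS; last by lia.
by rewrite prednK ?subn_gt0// IH ?(ltnW Hq)// [RHS]big_nat_recr//= subnS addrC.
Qed.

Lemma half_gt0 : (0 : R) < 1 / 2.
Proof. by rewrite divr_gt0. Qed.

Lemma le_half_of_lt (z : R) : z < 1 / 2 -> z <= 1 - 1 / 2.
Proof. by lra. Qed.

Lemma half_frac_lt (q s : nat) : (2 * s < q)%N -> s%:R / q%:R < 1 / 2 :> R.
Proof.
move=> sq; have q0 : (0 : R) < q%:R by rewrite ltr0n; case: q sq.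
rewrite ltr_pdivrMr// mulrAC ltr_pdivlMr// mul1r mulrC.
by rewrite -natrM ltr_nat.
Qed.

(** From [s = 2] on, a shift by at most [1 / q] leaves the point above half of [s / q]. At [s = 1]
    it could reach the pole, which is why all cotangent sums start at 2. *)
Lemma ctg_frac_sub_le (q s : nat) (w : R) : (2 <= s)%N -> (2 * s < q)%N -> 0 <= w <= q%:R^-1 ->
  `|ctg (s%:R / q%:R - w) - ctg (s%:R / q%:R)| <= 32 * q%:R * (s%:R ^+ 2)^-1.
Proof.
move=> s2 sq /andP[w0 wq]; have h2 := half_frac_lt sq.
have s2r : (2 : R) <= s%:R by rewrite ler_nat.
have q0 : (0 : R) < q%:R by rewrite ltr0n; case: q sq {wq h2}.
have i0 : (0 : R) < q%:R^-1 by rewrite invr_gt0.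
have -> : 32 * q%:R * (s%:R ^+ 2)^-1 = 4 * q%:R^-1 * (s%:R / q%:R / 2 * (1 / 2) * (s%:R / q%:R * (1 / 2)))^-1 :> R.
  by field; rewrite !gt_eqF// (lt_le_trans _ s2r).
have s1 : 2 * q%:R^-1 <= s%:R / q%:R :> R by rewrite ler_pM2r.
move: (q%:R^-1) (s%:R / q%:R) h2 s1 i0 wq => i x x2 s1 i0 wi; clear -w0 x2 s1 i0 wi.
apply: le_trans (@ctg_diff_le_box _ (x - w) x (x / 2) (1 / 2) x (1 / 2) _ _ _ _ _ _ _ _ _) _; try lra.
rewrite opprB addrC subrK ler_wpM2r ?ler_pM2l// invr_ge0 !mulr_ge0//; lra.
Qed.

Lemma ctg_frac_add_le (q s : nat) (w : R) : (0 < s)%N -> (2 * s < q)%N -> 0 <= w <= q%:R^-1 ->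
  `|ctg (s%:R / q%:R) - ctg (s%:R / q%:R + w)| <= 24 * q%:R * (s%:R ^+ 2)^-1.
Proof.
move=> s0 sq /andP[w0 wq].
have q0 : (0 : R) < q%:R by rewrite ltr0n; case: q sq {wq}.
have i0 : (0 : R) < q%:R^-1 by rewrite invr_gt0.
have sr : (0 : R) < s%:R by rewrite ltr0n.
have -> : 24 * q%:R * (s%:R ^+ 2)^-1 = 4 * q%:R^-1 * (s%:R / q%:R * (1 / 2) * (s%:R / q%:R * (1 / 3)))^-1 :> R.
  by field; rewrite !gt_eqF.
have x0 : (0 : R) < s%:R / q%:R by rewrite divr_gt0.
have h : s%:R / q%:R <= 1 / 2 - q%:R^-1 / 2 :> R.
  have h' : (2 * s + 1)%:R <= q%:R :> R by rewrite ler_nat addn1.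
  rewrite ler_pdivrMr// mulrBl -mulrA [_ / 2]mulrC -mulrA mulVf ?gt_eqF//.
  by move: h'; rewrite natrD natrM; clear; lra.
have q3 : q%:R^-1 <= 1 / 3 :> R.
  have -> : 1 / 3 = 3^-1 :> R by rewrite div1r.
  rewrite lef_pV2 ?posrE// ler_nat; apply: leq_trans sq.
  by rewrite ltnS leq_pmulr.
move: (q%:R^-1) (s%:R / q%:R) h x0 i0 wq q3 => i x h x0 i0 wi i3; clear -w0 h x0 i0 wi i3.
apply: le_trans (@ctg_diff_le_box _ x (x + w) x (1 / 2) x (1 / 3) _ _ _ _ _ _ _ _ _) _; try lra.
rewrite addrAC subrr add0r ler_wpM2r ?ler_pM2l// invr_ge0 !mulr_ge0//; lra.
Qed.

Lemma mid_ge (w : R) : w <= 1 / 4 -> 1 / 4 <= 1 / 2 - w.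
Proof. by lra. Qed.

Lemma norm_ctg_mid_le (x : R) : 1 / 4 <= x -> x <= 1 / 2 -> `|ctg x| <= 8.
Proof.
move=> x4 x2; apply: le_trans (norm_ctg_le _) _; first by apply/andP; split; lra.
rewrite -[leRHS]invrK lef_pV2 ?posrE ?invr_gt0// ?mulr_gt0//; try lra.
have -> : 8^-1 = 1 / 4 * (1 / 2) :> R by field.
by apply: ler_pM; lra.
Qed.

End CotangentSums.

(** * The sum of [e_s cot (pi (s / q - w))] for a sequence with controlled window sums *)

Section CotangentBound.
Variables (R : realType) (e : nat -> R) (kap : R) (Q : nat -> nat) (J q r : nat).
Hypothesis Q0 : Q 0%N = 1%N.
Hypothesis Qgt0 : forall i, (0 < Q i)%N.
Hypothesis Qle : forall i, (Q i <= Q i.+1)%N.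
Hypothesis J0 : (0 < J)%N.
Hypothesis qQ : (q <= Q J)%N.
Hypothesis q3 : (2 < q)%N.
Hypothesis e_le1 : forall s, `|e s| <= 1.
Hypothesis e_block : forall i s, (i < J)%N -> `|\sum_(t < Q i) (e (s + t)%N - kap)| <= 5.
Hypothesis r_gt0 : (0 < r)%N.
Hypothesis r_le : (r <= Q 1)%N.
Hypothesis e_small : forall s, (0 < s <= r)%N -> (s < q)%N ->
  `|e s| <= s%:R / r%:R /\ `|e (q - s)%N| <= s%:R / r%:R.

(** The cost of the windows of length [Q i] with [i >= 1]. Length [Q 0 = 1] is kept apart in
    [cf_bound]: its cost [ln (Q 1 / r)] depends on how long [e] stays small near the pole. *)
Definition cf_weight : R := \sum_(1 <= i < J) (ln ((Q i.+1)%:R / (Q i)%:R) + 2) / (Q i)%:R.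
Definition cf_bound : R := 1 + ln ((Q 1)%:R / r%:R) + cf_weight.

Let H := (q.-1)./2.
Let c (s : nat) : R := ctg (s%:R / q%:R).
(** Pairing [s] with [q - s]: the cotangent is odd under this reflection, so differences of [e]
    appear and the drift [kap] cancels. *)
Let x (s : nat) : R := e s - e (q - s)%N.
Let qr : (0 : R) < q%:R. Proof. by rewrite ltr0n; lia. Qed.
Let H2q : (2 * H < q)%N. Proof. by rewrite /H; lia. Qed.
Let HSq : (H < q)%N. Proof. by rewrite /H; lia. Qed.
Let HSqB : (H.+1 <= q - H)%N. Proof. by rewrite /H; lia. Qed.
Let H1 : (0 < H)%N. Proof. by rewrite /H; lia. Qed.

Let frac_gt0 s : (0 < s)%N -> (0 : R) < s%:R / q%:R.
Proof. by move=> s0; rewrite divr_gt0// ltr0n. Qed.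
Let frac_lt s : (s <= H)%N -> s%:R / q%:R < 1 / 2 :> R.
Proof. by move=> sH; apply: half_frac_lt; apply: leq_ltn_trans H2q; rewrite leq_mul2l. Qed.

Let c_ge0 s : (0 < s <= H)%N -> 0 <= c s.
Proof.
move=> /andP[s0 sH]; have := frac_gt0 s0; have := frac_lt sH; move=> h1 h0.
rewrite /c /ctg divr_ge0//; last by apply/ltW/sin_pi_gt0; apply/andP; split; lra.
have := @pi_gt0 R; move: (_ / _) h1 h0 => t h1 h0 p0.
by apply: cos_ge0_pihalf; apply/andP; split; nra.
Qed.

Let c_le s : (0 < s <= H)%N -> c s <= 2 * q%:R / s%:R.
Proof.
move=> /andP[s0 sH]; have h0 := frac_gt0 s0; have h1 := frac_lt sH.
have sr : (0 : R) < s%:R by rewrite ltr0n.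
apply: le_trans (ler_norm _) _.
apply: le_trans (norm_ctg_le_box h0 (half_gt0 R) (lexx _) (le_half_of_lt h1)) _.
by rewrite le_eqVlt; apply/orP; left; apply/eqP; field; rewrite !gt_eqF.
Qed.

Let c_diff_le n : (0 < n)%N -> (n < H)%N -> c n - c n.+1 <= 16 * q%:R / (n%:R * n.+1%:R).
Proof.
move=> n0 nH; have h0 := frac_gt0 n0; have h1 := frac_lt nH.
have h2 := frac_lt (ltnW nH).
have nr : (0 : R) < n%:R by rewrite ltr0n.
have sr : (0 : R) < n.+1%:R by rewrite ltr0n.
have s0 : (0 : R) < n.+1%:R / q%:R by rewrite divr_gt0.
have q0 := qr; apply: le_trans (ler_norm _) _.
have -> : 16 * q%:R / (n%:R * n.+1%:R) = 4 * q%:R^-1 * (n%:R / q%:R * (1 / 2) * (n.+1%:R / q%:R * (1 / 2)))^-1 :> R.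
  by field; rewrite !gt_eqF.
have xy : n%:R / q%:R <= n.+1%:R / q%:R :> R by rewrite ler_pM2r ?invr_gt0// ler_nat.
have half := half_gt0 R.
apply: le_trans (ctg_diff_le_box h0 half s0 half (lexx _) (le_half_of_lt h2) (lexx _) (le_half_of_lt h1) xy) _.
have step : n.+1%:R / q%:R - n%:R / q%:R = q%:R^-1 :> R by rewrite -mulrBl -natrB// subSnn mul1r.
by rewrite step.
Qed.

Let window_x n : (r <= n <= H)%N -> `|\sum_(r.+1 <= s < n.+1) x s| <= 10 * window_weight R Q J n.
Proof.
move=> /andP[rn nH].
have Hw s m : (m <= n)%N -> `|\sum_(t < m) (e (s + t)%N - kap)| <= 5 * window_weight R Q J n.
  move=> mn; apply: le_trans (window_sum_le (g := fun s => e s - kap) Q0 Qgt0 _ e_block s _) _ => //.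
    by apply: leq_trans qQ; lia.
  by rewrite ler_pM2l// window_weight_mono.
have -> : \sum_(r.+1 <= s < n.+1) x s = \sum_(t < n - r) (e (r.+1 + t)%N - kap) - \sum_(t < n - r) (e (q - n + t)%N - kap).
  rewrite -!(big_mkord xpredT (fun t => e (_ + t)%N - kap)) /x sumrB.
  rewrite !sumrB opprB addrA subrK; congr (_ - _).
    by rewrite -{1}[r.+1]add0n big_addn subSS; apply: eq_bigr => t _; rewrite addnC.
  rewrite -{1}[r.+1]add0n big_addn subSS big_nat_rev /= add0n.
  by rewrite big_nat [RHS]big_nat; apply: eq_bigr => t /andP[_ tn]; congr e; lia.
apply: le_trans (ler_normB _ _) _.
by have := Hw r.+1 (n - r)%N ltac:(lia); have := Hw (q - n)%N (n - r)%N ltac:(lia); lra.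
Qed.

Let Qr i : (0 : R) < (Q i)%:R. Proof. by rewrite ltr0n. Qed.

(** Abel summation beyond [r]: [c s] is at most [2 q / s] and its increments are at most
    [16 q / (n (n + 1))], which gives [2 + 16 = 18]. The factor 10 is two windows of at most 5 each,
    one near each pole. *)
Let tail_bound : (r <= H)%N -> `|\sum_(r.+1 <= s < H.+1) x s * c s| <= 180 * q%:R * cf_bound.
Proof.
move=> rH.
apply: le_trans (abel_sum (V := fun n => 10 * window_weight R Q J n) (c := c) rH window_x _ _) _.
- by apply: c_ge0; rewrite H1 leqnn.
- move=> n /andP[rn nH]; have n0 : (0 < n)%N by lia.
  apply: ctg_decr; first exact: frac_gt0.
    by rewrite ler_pM2r ?invr_gt0// ler_nat.
  by have := frac_lt nH; lra.
have Hr : (0 : R) < H%:R by rewrite ltr0n.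
have A1 : window_weight R Q J H * c H <= 2 * q%:R * \sum_(i < J) (Q i)%:R^-1.
  rewrite /window_weight mulr_suml mulr_sumr; apply: ler_sum => i _.
  have cH := c_le (s := H) ltac:(rewrite H1 leqnn//).
  have c0 := c_ge0 (s := H) ltac:(rewrite H1 leqnn//).
  apply: (@le_trans _ _ (1 * (H%:R / (Q i)%:R) * (2 * q%:R / H%:R))).
    apply: ler_pM => //.
    apply: ler_pM => //; first by case: leqP.
    by rewrite ler_pM2r ?invr_gt0// ler_nat geq_minl.
  by rewrite le_eqVlt; apply/orP; left; apply/eqP; field; rewrite !gt_eqF.
(* For windows of length 1 the harmonic sum starts at [r], so they contribute [ln (Q 1 / r)] instead
   of [ln (Q 1)]. *)
have A2 : \sum_(r <= n < H) window_weight R Q J n * (c n - c n.+1) <=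
   16 * q%:R * \sum_(i < J) (Q i)%:R^-1 * (ln ((Q i.+1)%:R / (if (i : nat) == 0%N then r else Q i)%:R) + 1).
  apply: (@le_trans _ _ (\sum_(r <= n < H) \sum_(i < J) 16 * q%:R * ((Q i)%:R^-1 *
     (((if (i : nat) == 0%N then r else Q i) <= n)%N%:R * ((minn n (Q i.+1))%:R / (n%:R * n.+1%:R)))))).
    rewrite big_nat [leRHS]big_nat; apply: ler_sum => n /andP[rn nH].
    have n0 : (0 < n)%N by lia.
    rewrite /window_weight mulr_suml; apply: ler_sum => i _.
    have nr : (0 : R) < n%:R by rewrite ltr0n.
    have sr : (0 : R) < n.+1%:R by rewrite ltr0n.
    apply: (@le_trans _ _ ((Q i <= n)%N%:R * ((minn n (Q i.+1))%:R / (Q i)%:R) * (16 * q%:R / (n%:R * n.+1%:R)))).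
      by rewrite ler_wpM2l ?c_diff_le// !mulr_ge0// invr_ge0.
    rewrite [leRHS](_ : _ = ((if (i : nat) == 0%N then r else Q i) <= n)%N%:R * ((minn n (Q i.+1))%:R / (Q i)%:R) * (16 * q%:R / (n%:R * n.+1%:R))); last first.
      by field; rewrite !gt_eqF.
    rewrite ler_wpM2r ?divr_ge0 ?mulr_ge0// ler_wpM2r ?divr_ge0//.
    by case: eqP => [->|]; rewrite ?rn ?ler_nat ?leq_b1.
  rewrite exchange_big /= mulr_sumr; apply: ler_sum => i _.
  rewrite -mulr_sumr -mulr_sumr; apply: ler_wpM2l; first by rewrite mulr_ge0.
  apply: ler_wpM2l; first by rewrite invr_ge0.
  apply: le_trans (weighted_harmonic_le _ H _ _).
  - rewrite -(big_mkord xpredT (fun n => (_ <= n)%N%:R * ((minn n _)%:R / (n%:R * n.+1%:R)))).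
    rewrite [leRHS](big_cat_nat _ (n := r))//= lerDr sumr_ge0//.
  - by case: (_ == _).
  - by case: (altP ((i : nat) =P 0%N)) => [->|].
have S1 : \sum_(i < J) (Q i)%:R^-1 = 1 + \sum_(1 <= i < J) (Q i)%:R^-1 :> R.
  by rewrite -(big_mkord xpredT (fun i => (Q i)%:R^-1)) big_ltn// Q0 invr1.
have S2 : \sum_(i < J) (Q i)%:R^-1 * (ln ((Q i.+1)%:R / (if (i : nat) == 0%N then r else Q i)%:R) + 1) =
   ln ((Q 1)%:R / r%:R) + 1 + \sum_(1 <= i < J) (Q i)%:R^-1 * (ln ((Q i.+1)%:R / (Q i)%:R) + 1) :> R.
  rewrite -(big_mkord xpredT (fun i => (Q i)%:R^-1 * (ln ((Q i.+1)%:R / (if (i : nat) == 0%N then r else Q i)%:R) + 1))).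
  rewrite big_ltn//= Q0 invr1 mul1r; congr (_ + _).
  rewrite big_nat [RHS]big_nat; apply: eq_bigr => i /andP[i1 _].
  by rewrite gtn_eqF.
have S3 : 0 <= ln ((Q 1)%:R / r%:R) :> R.
  by apply: ln_ge0; rewrite ler_pdivlMr ?ltr0n// mul1r ler_nat.
have S4 : 2 * q%:R * (1 + \sum_(1 <= i < J) (Q i)%:R^-1) + 16 * q%:R *
   (ln ((Q 1)%:R / r%:R) + 1 + \sum_(1 <= i < J) (Q i)%:R^-1 * (ln ((Q i.+1)%:R / (Q i)%:R) + 1)) <= 18 * q%:R * cf_bound :> R.
  rewrite /cf_bound /cf_weight.
  have : 2 * \sum_(1 <= i < J) (Q i)%:R^-1 + 16 * \sum_(1 <= i < J) (Q i)%:R^-1 * (ln ((Q i.+1)%:R / (Q i)%:R) + 1) <=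
     18 * \sum_(1 <= i < J) (ln ((Q i.+1)%:R / (Q i)%:R) + 2) / (Q i)%:R :> R.
    rewrite !mulr_sumr -big_split /=; apply: ler_sum => i _.
    have l0 : 0 <= ln ((Q i.+1)%:R / (Q i)%:R) :> R.
      by apply: ln_ge0; rewrite ler_pdivlMr// mul1r ler_nat.
    have : 0 <= (Q i)%:R^-1 :> R by rewrite invr_ge0.
    by move: l0; move: (ln _) => y y0; move: (_^-1) => z z0; have := mulr_ge0 y0 z0; lra.
  move: (\sum_(1 <= i < J) _) (\sum_(1 <= i < J) _ * _) (\sum_(1 <= i < J) _ / _) => a b d abd.
  move: (ln _) S3 => y y0.
  have -> : 2 * q%:R * (1 + a) + 16 * q%:R * (y + 1 + b) = q%:R * (18 + 16 * y + (2 * a + 16 * b)) by ring.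
  have -> : 18 * q%:R * (1 + y + d) = q%:R * (18 + 18 * y + 18 * d) by ring.
  by rewrite ler_pM2l//; lra.
rewrite -S1 -S2 in S4.
have -> : \sum_(r <= n < H) 10 * window_weight R Q J n * (c n - c n.+1) =
   10 * \sum_(r <= n < H) window_weight R Q J n * (c n - c n.+1).
  by rewrite mulr_sumr; apply: eq_bigr => n _; rewrite mulrA.
lra.
Qed.

(** Near the pole no cancellation is used: [|x s| <= 2 s / r] compensates [c s <= 2 q / s], and
    there are at most [r] terms of size [4 q / r]. *)
Let head_bound n : (n <= r)%N -> (n <= H)%N -> `|\sum_(1 <= s < n.+1) x s * c s| <= 4 * q%:R.
Proof.
move=> nr nH; have rr : (0 : R) < r%:R by rewrite ltr0n.
apply: (@le_trans _ _ (\sum_(1 <= s < n.+1) 4 * q%:R / r%:R)).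
  apply: le_trans (ler_norm_sum _ _ _) _.
  rewrite big_nat [leRHS]big_nat; apply: ler_sum => s /andP[s1 sn].
  have sr : (0 : R) < s%:R by rewrite ltr0n.
  have {}sn : (s <= n)%N by [].
  have sH : (0 < s <= H)%N by rewrite s1; exact: leq_trans sn nH.
  have sr' : (0 < s <= r)%N by rewrite s1; exact: leq_trans sn nr.
  have [h1 h2] := e_small sr' (leq_ltn_trans (leq_trans sn nH) HSq).
  rewrite normrM (ger0_norm (c_ge0 sH)).
  apply: (@le_trans _ _ (2 * s%:R / r%:R * (2 * q%:R / s%:R))).
    apply: (ler_pM (normr_ge0 _) (c_ge0 sH) _ (c_le sH)).
    by apply: le_trans (ler_normB _ _) _; rewrite -mulrA mulr_natl mulr2n; exact: lerD.
  by rewrite le_eqVlt; apply/orP; left; apply/eqP; field; rewrite !gt_eqF.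
have q0 := qr.
rewrite sumr_const_nat subSS subn0 -[leLHS]mulr_natr -mulrA [_^-1 * _]mulrC ler_piMr//.
by rewrite ler_pdivrMr// mul1r ler_nat.
Qed.

Let cf_bound_ge1 : 1 <= cf_bound.
Proof.
rewrite /cf_bound -addrA lerDl addr_ge0//.
  by apply: ln_ge0; rewrite ler_pdivlMr ?ltr0n// mul1r ler_nat.
rewrite /cf_weight sumr_ge0// => i _; rewrite mulr_ge0// ?invr_ge0// addr_ge0//.
by apply: ln_ge0; rewrite ler_pdivlMr// mul1r ler_nat.
Qed.

Let half_bound : `|\sum_(1 <= s < H.+1) x s * c s| <= 184 * q%:R * cf_bound.
Proof.
have B1 := cf_bound_ge1; have q0 := qr.
have B2 : q%:R <= q%:R * cf_bound by rewrite ler_peMr// ltW.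
have [Hr|rH] := leqP H r.
  apply: le_trans (head_bound Hr (leqnn _)) _.
  have : 0 <= q%:R * cf_bound by rewrite mulr_ge0//; lra.
  by rewrite -!mulrA; lra.
rewrite (big_cat_nat _ (n := r.+1))//=; last by rewrite ltnS ltnW.
apply: le_trans (ler_normD _ _) _.
have h1 := head_bound (leqnn r) (ltnW rH); have h2 := tail_bound (ltnW rH).
by apply: le_trans (lerD h1 h2) _; rewrite -!mulrA; lra.
Qed.

(** The constant is [300 = 184 + 2 + 64 + 48 + 2]: the paired sum at [w = 0], the term [s = 1] that
    the pairing has in excess, the effect of the shift on the left and on the right half, and the
    middle term. *)
Lemma cotangent_sum_le w : 0 <= w <= q%:R^-1 ->
  `|\sum_(2 <= s < q) e s * ctg (s%:R / q%:R - w)| <= 300 * q%:R * cf_bound.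
Proof.
move=> /andP[w0 w1]; have q0 := qr; have B1 := cf_bound_ge1.
have B2 : q%:R <= q%:R * cf_bound by rewrite ler_peMr// ltW.
pose E s := e s * ctg (s%:R / q%:R - w).
rewrite -/(\sum_(2 <= s < q) E s).
have Eq : \sum_(2 <= s < q) E s = (\sum_(1 <= s < H.+1) x s * c s - e 1%N * c 1%N
   + \sum_(2 <= s < H.+1) e s * (ctg (s%:R / q%:R - w) - c s)
   + \sum_(1 <= t < H.+1) e (q - t)%N * (c t - ctg (t%:R / q%:R + w)))
   + \sum_(H.+1 <= s < q - H) E s.
  rewrite (big_cat_nat _ (n := H.+1))//=.
  rewrite [X in _ + X](big_cat_nat _ (n := (q - H)%N))//=; last exact: leq_subr.
  rewrite sum_nat_flip; last exact: ltnW.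
  have -> : \sum_(1 <= t < H.+1) E (q - t)%N = - \sum_(1 <= t < H.+1) e (q - t)%N * ctg (t%:R / q%:R + w).
    rewrite -sumrN big_nat [RHS]big_nat; apply: eq_bigr => t /andP[t1 tH].
    have tq : (t <= q)%N by apply: leq_trans (ltnW HSq).
    rewrite /E natrB// (_ : _ / _ - w = 1 - (t%:R / q%:R + w)); last by field; rewrite gt_eqF.
    by rewrite ctg1B mulrN.
  have -> : \sum_(1 <= s < H.+1) x s * c s - e 1%N * c 1%N =
     \sum_(2 <= s < H.+1) e s * c s - \sum_(1 <= s < H.+1) e (q - s)%N * c s.
    have -> : \sum_(1 <= s < H.+1) x s * c s = \sum_(1 <= s < H.+1) e s * c s - \sum_(1 <= s < H.+1) e (q - s)%N * c s.
      by rewrite -sumrB; apply: eq_bigr => s _; rewrite /x mulrBl.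
    by rewrite (@big_ltn _ _ _ 1)// ?ltnS ?H1//; ring.
  have -> : \sum_(2 <= s < H.+1) e s * (ctg (s%:R / q%:R - w) - c s) = \sum_(2 <= s < H.+1) E s - \sum_(2 <= s < H.+1) e s * c s.
    by rewrite -sumrB; apply: eq_bigr => s _; rewrite /E mulrBr.
  have -> : \sum_(1 <= t < H.+1) e (q - t)%N * (c t - ctg (t%:R / q%:R + w)) =
     \sum_(1 <= s < H.+1) e (q - s)%N * c s - \sum_(1 <= t < H.+1) e (q - t)%N * ctg (t%:R / q%:R + w).
    by rewrite -sumrB; apply: eq_bigr => s _; rewrite mulrBr.
  by ring.
have b1 : `|e 1%N * c 1%N| <= 2 * q%:R.
  rewrite normrM -[leRHS]mul1r; apply: ler_pM => //.
  rewrite ger0_norm; last by apply: c_ge0; rewrite H1.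
  by apply: le_trans (c_le _) _; rewrite ?H1// divr1.
have b2 : `|\sum_(2 <= s < H.+1) e s * (ctg (s%:R / q%:R - w) - c s)| <= 64 * q%:R.
  apply: (@le_trans _ _ (\sum_(2 <= s < H.+1) 32 * q%:R * (s%:R ^+ 2)^-1)); last first.
    rewrite -mulr_sumr (_ : 64 * q%:R = 32 * q%:R * 2); last by ring.
    rewrite ler_wpM2l//.
    apply: le_trans (sum_inv_sqr_le R H).
    by rewrite [leRHS]big_ltn// ?ltnS ?H1// lerDr invr_ge0 exprn_ge0.
  apply: le_trans (ler_norm_sum _ _ _) _.
  rewrite big_nat [leRHS]big_nat; apply: ler_sum => s /andP[s2 sH].
  rewrite normrM -[leRHS]mul1r; apply: ler_pM => //.
  by apply: ctg_frac_sub_le; rewrite ?w0// (leq_ltn_trans _ H2q)// leq_mul2l.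
have b3 : `|\sum_(1 <= t < H.+1) e (q - t)%N * (c t - ctg (t%:R / q%:R + w))| <= 48 * q%:R.
  apply: (@le_trans _ _ (\sum_(1 <= s < H.+1) 24 * q%:R * (s%:R ^+ 2)^-1)); last first.
    rewrite -mulr_sumr (_ : 48 * q%:R = 24 * q%:R * 2); last by ring.
    by rewrite ler_wpM2l ?sum_inv_sqr_le.
  apply: le_trans (ler_norm_sum _ _ _) _.
  rewrite big_nat [leRHS]big_nat; apply: ler_sum => s /andP[s0 sH].
  rewrite normrM -[leRHS]mul1r; apply: ler_pM => //.
  by apply: ctg_frac_add_le; rewrite ?w0// (leq_ltn_trans _ H2q)// leq_mul2l.
have b4 : `|\sum_(H.+1 <= s < q - H) E s| <= 2 * q%:R.
  (* The middle range is empty for odd [q]; for even [q] it is the single index [q / 2]. *)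
  have [h|h] := leqP (q - H)%N H.+1; first by rewrite big_geq// normr0.
  have qE : (q - H = H.+2)%N by move: h; rewrite /H; move: (q3); clear; lia.
  rewrite qE big_nat1 /E normrM -[leRHS]mul1r; apply: ler_pM => //.
  have hq : (q = 2 * H.+1)%N by move: qE HSq; clear; lia.
  have hr : q%:R = 2 * H.+1%:R :> R by rewrite [in LHS]hq natrM.
  have Hr : (0 : R) < H.+1%:R by rewrite ltr0n.
  have -> : H.+1%:R / q%:R = 1 / 2 :> R by rewrite hr; field; rewrite gt_eqF.
  have q4 : q%:R^-1 <= 1 / 4 :> R.
    rewrite div1r lef_pV2 ?posrE// ler_nat hq -[4%N]/(2 * 2)%N leq_mul2l; exact: H1.
  have q8 : 8 <= 2 * q%:R :> R by rewrite -natrM ler_nat hq mulnA -[8%N]/(4 * 2)%N leq_mul2l; exact: H1.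
  by apply: le_trans q8; apply: norm_ctg_mid_le; [apply: mid_ge (le_trans w1 q4)|rewrite gerBl].
rewrite Eq.
have B3 := half_bound.
apply: le_trans (ler_normD _ _) _.
apply: le_trans (lerD (ler_normD _ _) (lexx _)) _.
apply: le_trans (lerD (lerD (ler_normD _ _) (lexx _)) (lexx _)) _.
apply: le_trans (lerD (lerD (lerD (ler_normB _ _) (lexx _)) (lexx _)) (lexx _)) _.
apply: le_trans (lerD (lerD (lerD (lerD B3 b1) b2) b3) b4) _.
by rewrite -!mulrA; lra.
Qed.

End CotangentBound.

(** * Integrability of [lsin] across its singularity at [0], and its primitive *)

Section IntegralLsin.
Variable R : realType.
Implicit Types x u v t : R.
Notation mu := (@lebesgue_measure R).

Lemma is_derive_xlnx x : 0 < x -> is_derive x 1 (fun t => t - t * ln t) (- ln x).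
Proof.
move=> x0.
have d := is_derive1_ln x0.
have d2 : is_derive x 1 (fun t => t * ln t) (x * x^-1 + ln x).
  by apply: is_derive_eq; rewrite /GRing.scale /= mulr1.
apply: is_derive_eq.
by rewrite mulfV ?gt_eqF//; ring.
Qed.

Lemma measurable_lsin : measurable_fun [set: R] (@lsin R).
Proof.
apply: measurableT_comp => //; apply: measurableT_comp => //.
apply: measurable_funM => //; apply: continuous_measurable_fun => x.
apply: (@continuous_comp _ _ _ (fun t => pi * t) (@sin R)); first exact: mulrl_continuous.
exact: continuous_sin.
Qed.

(** The interval is exhausted by the compact pieces [[x / (n + 2), x]], where the primitive
    [t - t ln t] applies; monotone convergence passes to the limit. *)
Lemma integral_Nln_le x : 0 < x <= 1 ->
  (\int[mu]_(t in `]0%R, x]) (- ln t)%R%:E <= (x - x * ln x)%R%:E)%E.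
Proof.
move=> /andP[x0 x1].
pose F (n : nat) : set R := `[x / n.+2%:R, x]%classic.
have -> : `]0, x]%classic = \bigcup_n F n.
  apply/seteqP; split => t /=; rewrite ?in_itv/=.
    move=> /andP[t0 tx].
    exists (Num.bound (x / t)) => //=; rewrite /F /= in_itv/= tx andbT.
    rewrite ler_pdivrMr// mulrC -ler_pdivrMr//.
    apply/ltW/(lt_trans (archi_boundP _)); first by rewrite divr_ge0// ltW.
    by rewrite ltr_nat.
  move=> [n _]; rewrite /F /= in_itv/= => /andP[h1 ->]; rewrite andbT.
  by apply: lt_le_trans h1; rewrite divr_gt0.
have key n : (\int[mu]_(t in F n) (- ln t)%R%:E <= (x - x * ln x)%R%:E)%E.
  rewrite /F; set e := x / n.+2%:R.
  have e0 : 0 < e by rewrite divr_gt0.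
  have ex : e < x by rewrite ltr_pdivrMr// ltr_pMr// ltr1n.
  have dG (z : R) : 0 < z -> is_derive z 1 (fun t => t - t * ln t) (- ln z) by exact: is_derive_xlnx.
  have dGc (z : R) : 0 < z -> {for z, continuous (fun t : R => t - t * ln t)}.
    by move=> z0; have d := dG z z0; apply: differentiable_continuous; apply/derivable1_diffP; apply: ex_derive.
  rewrite (@continuous_FTC2 _ (fun t => - ln t) (fun t => t - t * ln t))//.
  - rewrite -EFinB lee_fin lerBlDr lerDl subr_ge0.
    have l0 : ln e < 0 by rewrite ln_lt0// e0 (lt_le_trans ex).
    by rewrite ler_piMr ?(ltW e0)//; lra.
  - apply: derivable_within_continuous => z; rewrite in_itv /= => /andP[ez _].
    by have d := is_derive1_ln (lt_le_trans e0 ez); apply: ex_derive.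
  - split.
    + by move=> z; rewrite in_itv /= => /andP[ez _]; have d := dG z (lt_trans e0 ez); apply: ex_derive.
    + by apply: cvg_at_right_filter; exact: dGc.
    + by apply: cvg_at_left_filter; exact: dGc.
  - move=> z; rewrite in_itv /= => /andP[ez _]; have d := dG z (lt_trans e0 ez).
    by rewrite derive1E; apply: derive_val.
have cvgF : (\int[mu]_(t in F i) (- ln t)%R%:E)%E @[i --> \oo] --> (\int[mu]_(t in \bigcup_i F i) (- ln t)%R%:E)%E.
  apply: ge0_nondecreasing_set_cvg_integral.
  - move=> m n mn; apply/subsetPset => t; rewrite /F /= !in_itv /= => /andP[h ->].
    rewrite andbT; apply: le_trans h.
    by rewrite ler_pM2l// lef_pV2 ?posrE// ler_nat.
  - by move=> i; exact: measurable_itv.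
  - by move=> i; apply/measurable_EFinP; apply: measurable_funS (measurableT) _ _ => //; apply: measurableT_comp.
  - move=> i t; rewrite /F /= in_itv /= => /andP[_ h].
    by rewrite lee_fin oppr_ge0 ln_le0// (le_trans h).
rewrite -(cvg_lim _ cvgF)//; apply: lime_le; first by apply/cvg_ex; eexists; exact: cvgF.
by near=> n; exact: key.
Unshelve. all: by end_near.
Qed.

Lemma integrable_Nln x : 0 < x <= 1 -> mu.-integrable `[0, x] (EFin \o (fun t : R => - ln t)).
Proof.
move=> x01; have /andP[x0 x1] := x01.
have mf (D : set R) : measurable D -> measurable_fun D (EFin \o (fun t : R => - ln t)).
  by move=> mD; apply/measurable_EFinP; apply: measurable_funS (measurableT) _ _ => //; apply: measurableT_comp.
apply/integrableP; split; first exact: mf.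
rewrite (_ : (\int[mu]_(t in _) _)%E = (\int[mu]_(t in `[0%R, x]) (- ln t)%R%:E)%E); last first.
  apply: eq_integral => t; rewrite inE /= in_itv /= => /andP[t0 tx].
  by rewrite /= ger0_norm// oppr_ge0 ln_le0// (le_trans tx).
rewrite -integral_itv_obnd_cbnd; last exact: mf.
exact: le_lt_trans (integral_Nln_le x01) (ltry _).
Qed.

Lemma lsin_ge_ln t : 0 < t <= 1 / 2 -> ln t <= lsin t.
Proof.
move=> /andP[t0 t1].
have s := @sin_pi_ge _ t ltac:(apply/andP; split; lra).
rewrite lsinE; last by apply/andP; split; lra.
have : ln t <= ln (sin (pi * t)) by rewrite ler_ln ?posrE//; lra.
have : 0 <= ln 2 :> R by apply: ln_ge0; lra.
lra.
Qed.

Lemma ln2_le1 : ln 2 <= 1 :> R.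
Proof. by have := @le_ln1Dx R 1 ltac:(lra); rewrite (_ : 1 + 1 = 2) //; lra. Qed.

Lemma integrable_lsin v : 0 < v < 1 -> mu.-integrable `[0, v] (EFin \o @lsin R).
Proof.
move=> /andP[v0 v1].
have mD : measurable (`[0, v]%classic : set R) by exact: measurable_itv.
pose C := 1 + `|ln (1 - v)|.
apply: (@le_integrable _ _ _ mu _ mD _ (fun t => (C)%:E + (- ln t)%:E)%E).
- by apply/measurable_EFinP; apply: measurable_funS (measurableT) _ _ => //; exact: measurable_lsin.
- move=> t /=; rewrite in_itv /= => /andP[t0 tv].
  have lt0 : ln t <= 0 by apply: ln_le0; lra.
  have C1 : 1 <= C by rewrite lerDl.
  rewrite lee_fin [leRHS]ger0_norm; last lra.
  move: t0; rewrite le_eqVlt => /orP[/eqP <-|t0].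
    by rewrite /lsin mulr0 sin0 mulr0 normr0 !ln0//; rewrite normr0; lra.
  rewrite ler_norml; apply/andP; split; last first.
    by have := lsin_le_ln2 t; have := ln2_le1; lra.
  have s := @sin_pi_ge_xx _ t ltac:(apply/andP; split; lra).
  rewrite lsinE; last by apply/andP; split; lra.
  have : ln (t * (1 - v)) <= ln (sin (pi * t)).
    rewrite ler_ln ?posrE ?mulr_gt0//; try lra.
      by apply: le_trans s; rewrite ler_pM2l//; lra.
    by apply: lt_le_trans s; rewrite mulr_gt0//; lra.
  rewrite lnM ?posrE//; last lra.
  have : 0 <= ln 2 :> R by apply: ln_ge0; lra.
  have : - `|ln (1 - v)| <= ln (1 - v) by rewrite lerNnormlW.
  by rewrite /C; lra.
- apply: integrableD => //; last by apply: integrable_Nln; rewrite v0 ltW.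
  apply: (@continuous_compact_integrable _ (fun=> C)); first exact: segment_compact.
  by apply: continuous_subspaceT => y; exact: cst_continuous.
Qed.

Definition J u v : R := Rintegral mu `[u, v] (@lsin R).

Lemma integrable_lsin_itv u v : 0 <= u -> v < 1 -> mu.-integrable `[u, v] (EFin \o @lsin R).
Proof.
move=> u0 v1; have [uv|vu] := leP u v; last first.
  by rewrite set_itv_ge ?bnd_simp -?ltNge//; exact: integrable_set0.
apply: (@integrableS _ _ _ mu `[0, Num.max v (1 / 2)]%classic) => //.
- by move=> t /=; rewrite !in_itv /= => /andP[ut tv]; rewrite (le_trans u0 ut) le_max tv.
- by apply: integrable_lsin; rewrite lt_max gt_max v1; apply/andP; split; [apply/orP; right|]; lra.
Qed.

Lemma J_refl u : J u u = 0.
Proof. by rewrite /J set_itv1 Rintegral_set1. Qed.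

Lemma J_add u v w : 0 <= u -> u <= v -> v <= w -> w < 1 -> J u v + J v w = J u w.
Proof.
move=> u0 uv vw w1.
have h := @Rintegral_itvB R (@lsin R) (BLeft u) (BRight w) v (integrable_lsin_itv u0 w1).
rewrite -[J u w](subrK (J u v)) addrC; congr (_ + _).
rewrite [RHS]h ?bnd_simp// /J -Rintegral_itv_obnd_cbnd//.
apply: (@integrableS _ _ _ mu `[v, w]%classic) => //.
  by move=> t /=; rewrite !in_itv /= => /andP[/ltW -> ->].
by apply: integrable_lsin_itv => //; exact: le_trans uv.
Qed.

Lemma continuous_lsin x : 0 < x < 1 -> {for x, continuous (@lsin R)}.
Proof.
move=> x01; have s0 := sin_pi_gt0 x01.
apply: (@continuous_comp _ _ _ (fun t => `|2 * sin (pi * t)|) (@ln R)); last first.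
  by apply: continuous_ln; rewrite normr_gt0 mulf_neq0// gt_eqF.
apply: (@continuous_comp _ _ _ (fun t => 2 * sin (pi * t)) (@Num.norm R R)); last exact: norm_continuous.
apply: (@continuous_comp _ _ _ (fun t => sin (pi * t)) (fun t => 2 * t)); last exact: mulrl_continuous.
apply: (@continuous_comp _ _ _ (fun t => pi * t) (@sin R)); first exact: mulrl_continuous.
exact: continuous_sin.
Qed.

Lemma is_derive_J x : 0 < x < 1 -> is_derive x 1 (J 0) (lsin x).
Proof.
move=> /andP[x0 x1]; pose u := (x + 1) / 2.
have xu : x < u by rewrite /u; lra.
have u1 : u < 1 by rewrite /u; lra.
have [|| d e] := @continuous_FTC1_closed R (@lsin R) 0 x u xu (integrable_lsin_itv (lexx 0) u1).
- exact: x0.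
- by apply: continuous_lsin; rewrite x0.
by rewrite /J -e derive1E; apply: derivableP.
Qed.

Lemma J_ge0_small x : 0 < x <= 1 / 2 -> x * ln x - x <= J 0 x.
Proof.
move=> /andP[x0 x1].
apply: (@le_trans _ _ (Rintegral mu `[0, x] (fun t => - (- ln t)))).
  rewrite (_ : (fun t => - (- ln t)) = (fun t => -1 * (- ln t))); last by apply/funext => t; rewrite mulN1r.
  rewrite RintegralZl//; last by apply: integrable_Nln; apply/andP; split; lra.
  rewrite mulN1r lerNr opprB /Rintegral -lee_fin fineK.
    rewrite -integral_itv_obnd_cbnd; first by apply: integral_Nln_le; apply/andP; split; lra.
    by apply/measurable_EFinP; apply: measurable_funS (measurableT) _ _ => //; apply: measurableT_comp.
  by apply: integrable_fin_num => //; apply: integrable_Nln; apply/andP; split; lra.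
apply: le_Rintegral => //.
- rewrite (_ : EFin \o _ = (fun t => - (- ln t)%R%:E)%E); last by apply/funext => t.
  by apply: integrableN; apply: integrable_Nln; apply/andP; split; lra.
- by apply: integrable_lsin_itv => //; lra.
move=> t /=; rewrite in_itv /= => /andP[t0 tx]; rewrite opprK.
move: t0; rewrite le_eqVlt => /orP[/eqP <-|t0].
  by rewrite /lsin mulr0 sin0 mulr0 normr0.
by apply: lsin_ge_ln; apply/andP; split; lra.
Qed.

Lemma J_le0_small x : 0 <= x <= 1 / 8 -> J 0 x <= 0.
Proof.
move=> /andP[x0 x1].
rewrite -oppr_ge0 -mulN1r -RintegralZl//; last by apply: integrable_lsin_itv => //; lra.
apply: Rintegral_ge0 => t /=; rewrite in_itv /= => /andP[t0 tx].
rewrite mulN1r oppr_ge0 /lsin ln_le0//.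
have := norm_sin_le (pi * t).
have p0 := @pi_ge0 R.
rewrite (ger0_norm (mulr_ge0 p0 t0)) normrM (@ger0_norm _ 2)//.
have : pi * t <= 4 * (1 / 8) by apply: ler_pM => //; [have := pi_lt31416 R; lra|lra].
lra.
Qed.

End IntegralLsin.

(** * Quadratic bounds for the integral of [lsin] between a point and [5/6] *)

Section IntegralBounds.
Variable R : realType.
Implicit Types (G g : R -> R) (x y u v t : R).

(** [G - J 0] has derivative [g - lsin], hence is nondecreasing; no integral of [g] is formed. *)
Lemma J_le_antiderivative G g u v : 0 < u -> u <= v -> v < 1 ->
  (forall t, u <= t <= v -> is_derive t 1 G (g t)) ->
  (forall t, u <= t <= v -> lsin t <= g t) -> J u v <= G v - G u.
Proof.
move=> u0 uv v1 dG fg.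
rewrite -[J u v](addrK (J 0 u)) [J u v + _]addrC J_add//; last exact: ltW.
have : G u - J 0 u <= G v - J 0 v; last lra.
apply: (@derive_ge0_le _ (fun t => G t - J 0 t) (fun t => g t - lsin t)) => //.
  move=> t /andP[ut tv].
  have d1 := dG t ltac:(rewrite ut tv//).
  have d2 := @is_derive_J _ t ltac:(apply/andP; split; lra).
  exact: is_deriveB.
by move=> t h; rewrite subr_ge0 fg.
Qed.

Lemma J_ge_antiderivative G g u v : 0 < u -> u <= v -> v < 1 ->
  (forall t, u <= t <= v -> is_derive t 1 G (g t)) ->
  (forall t, u <= t <= v -> g t <= lsin t) -> G v - G u <= J u v.
Proof.
move=> u0 uv v1 dG fg.
rewrite -[J u v](addrK (J 0 u)) [J u v + _]addrC J_add//; last exact: ltW.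
have : J 0 u - G u <= J 0 v - G v; last lra.
apply: (@derive_ge0_le _ (fun t => J 0 t - G t) (fun t => lsin t - g t)) => //.
  move=> t /andP[ut tv].
  have d1 := dG t ltac:(rewrite ut tv//).
  have d2 := @is_derive_J _ t ltac:(apply/andP; split; lra).
  exact: is_deriveB.
by move=> t h; rewrite subr_ge0 fg.
Qed.

(** Version starting at the singular end [0]. Here [l] bounds [G] from below along points tending to
    [0], and the piece of the integral near [0] is dropped because [J_le0_small] makes it
    nonpositive. *)
Lemma J0_le_antiderivative G g v l : 0 < v -> v < 1 ->
  (forall t, 0 < t <= v -> is_derive t 1 G (g t)) ->
  (forall t, 0 < t <= v -> lsin t <= g t) ->
  (forall eta : R, 0 < eta -> exists2 e : R, 0 < e <= v & e <= 1 / 8 /\ l - eta <= G e) ->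
  J 0 v <= G v - l.
Proof.
move=> v0 v1 dG fg hl; apply/ler_addgt0Pr => eta eta0.
have [e /andP[e0 ev] [e8 Ge]] := hl _ eta0.
have h1 : J e v <= G v - G e.
  by apply: (J_le_antiderivative (g := g)) => // t /andP[et tv]; [apply: dG|apply: fg]; rewrite (lt_le_trans e0 et).
have h2 : J 0 e <= 0 by apply: J_le0_small; rewrite (ltW e0).
rewrite -(J_add (lexx 0) (ltW e0) ev v1); lra.
Qed.

Lemma J_le_cst M u v : 0 < u -> u <= v -> v < 1 ->
  (forall t, u <= t <= v -> lsin t <= M) -> J u v <= M * (v - u).
Proof.
move=> u0 uv v1 h; rewrite mulrBr.
apply: (@J_le_antiderivative (fun t => M * t) (fun=> M)) => // t _.
by apply: is_derive_eq; rewrite /GRing.scale /=; ring.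
Qed.

Lemma J_ge_cst M u v : 0 < u -> u <= v -> v < 1 ->
  (forall t, u <= t <= v -> M <= lsin t) -> M * (v - u) <= J u v.
Proof.
move=> u0 uv v1 h; rewrite mulrBr.
apply: (@J_ge_antiderivative (fun t => M * t) (fun=> M)) => // t _.
by apply: is_derive_eq; rewrite /GRing.scale /=; ring.
Qed.

Lemma J0_le_cst M v : 0 < v -> v < 1 ->
  (forall t, 0 < t <= v -> lsin t <= M) -> J 0 v <= M * v.
Proof.
move=> v0 v1 h; rewrite -[leRHS]subr0.
apply: (@J0_le_antiderivative (fun t => M * t) (fun=> M)) => // [t _|eta eta0].
  by apply: is_derive_eq; rewrite /GRing.scale /=; ring.
pose e := Num.min (Num.min v (1 / 8)) (eta / (`|M| + 1)).
have M0 : 0 < `|M| + 1 by rewrite ltr_wpDl.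
have e8 : 0 < 1 / 8 :> R by lra.
have e0 : 0 < e by rewrite !lt_min v0 e8 divr_gt0.
exists e; first by rewrite e0 /e !ge_min lexx.
split; first by rewrite /e !ge_min lexx orbT.
rewrite sub0r lerNl -mulNr; apply: (@le_trans _ _ (`|M| * e)).
  by rewrite ler_pM2r// -normrN ler_norm.
apply: (@le_trans _ _ ((`|M| + 1) * e)); first by rewrite ler_pM2r//; lra.
by rewrite mulrC -ler_pdivlMr// /e ge_min lexx orbT.
Qed.

Lemma ctg_ge0 x : 0 < x <= 1 / 2 -> 0 <= ctg x.
Proof.
move=> /andP[x0 x1]; rewrite /ctg divr_ge0//; last by apply/ltW/sin_pi_gt0; apply/andP; split; lra.
have := @pi_gt0 R => p0.
apply: cos_ge0_pihalf; rewrite (_ : pi / 2 = pi * (1 / 2)); last by ring.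
by rewrite ler_pM2l// x1 andbT (@le_trans _ _ 0)// ?oppr_le0 mulr_ge0//; lra.
Qed.

Lemma lsin_incr x y : 0 < x -> x <= y -> y <= 1 / 2 -> lsin x <= lsin y.
Proof.
move=> x0 xy y1.
have := @lsin_tangent _ y x ltac:(apply/andP; split; lra) ltac:(apply/andP; split; lra).
have c0 := @ctg_ge0 y ltac:(apply/andP; split; lra).
have : 0 <= pi * ctg y * (y - x) by rewrite mulr_ge0 ?subr_ge0// mulr_ge0 ?pi_ge0.
lra.
Qed.

Lemma lsin_decr x y : 1 / 2 <= x -> x <= y -> y < 1 -> lsin y <= lsin x.
Proof. by move=> x0 xy y1; rewrite -(lsin1B x) -(lsin1B y); apply: lsin_incr; lra. Qed.

Lemma lsin_five_sixths : lsin (5 / 6 : R) = 0.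
Proof.
rewrite -lsin1B (_ : 1 - 5 / 6 = 1 / 6); last by field.
rewrite /lsin (_ : pi * (1 / 6) = pi / 6); last by field.
by rewrite sin_pi6 (_ : 2 * (1 / 2) = 1) ?normr1 ?ln1//; field.
Qed.

(** The value is [- pi * sqrt 3], about [- 5.44]. The bound 5 gives curvature [5 / 2] to the right
    of [5/6], more than ten times [kappa]. *)
Lemma pi_ctg_five_sixths : pi * ctg (5 / 6 : R) <= - 5.
Proof.
rewrite (_ : 5 / 6 = 1 - 1 / 6); last by field.
rewrite ctg1B /ctg (_ : pi * (1 / 6) = pi / 6); last by field.
rewrite sin_pi6 mulrN lerNl opprK.
have p0 := pi_gt3 R; have p1 := pi_lt4 R.
have h := @cos_ge_taylor2 _ (pi / 6) ltac:(lra).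
have u0 : 0 <= pi / 6 :> R by lra.
have p2 : pi / 6 <= 11 / 20 :> R by apply: (@le_trans _ _ (((3 * 100 * 100 + 14 * 100 + 16) / (100 * 100)) / 6)); [rewrite ler_pM2r ?invr_gt0//; exact/ltW/pi_lt31416|clear; lra].
have sq := ler_pM u0 u0 p2 p2; rewrite -expr2 in sq.
have c : 17 / 20 - 1 / 600 <= cos (pi / 6 : R) by apply: le_trans h; move: (_ ^+ 2) sq; clear => z; lra.
have c0 : 0 <= 17 / 20 - 1 / 600 :> R by clear; lra.
have := ler_pM (ler0n R 3) c0 (ltW p0) c.
move: (cos _) => z; rewrite mulrA; move: (pi * z); clear => w; lra.
Qed.

Lemma J_right_le x : 5 / 6 <= x -> x < 1 -> J (5 / 6) x <= - (5 / 2) * (x - 5 / 6) ^+ 2.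
Proof.
move=> x0 x1.
rewrite (_ : - (5 / 2) * _ = - (5 / 2) * (x - 5 / 6) ^+ 2 - (- (5 / 2) * (5 / 6 - 5 / 6) ^+ 2)); last by ring.
apply: (@J_le_antiderivative (fun t => - (5 / 2) * (t - 5 / 6) ^+ 2) (fun t => - 5 * (t - 5 / 6))) => //; try lra.
  by move=> t _; apply: is_derive_eq; rewrite /GRing.scale /=; field.
move=> t /andP[t0 t1].
have := @lsin_tangent _ (5 / 6) t ltac:(apply/andP; split; lra) ltac:(apply/andP; split; lra).
rewrite lsin_five_sixths subr0 => h; apply: le_trans h _.
by apply: ler_wpM2r; [lra|exact: pi_ctg_five_sixths].
Qed.

Lemma ln1D_le u : 0 <= u -> ln (1 + u) <= u - u ^+ 2 / 2 + u ^+ 3 / 3.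
Proof.
move=> u0; rewrite -subr_ge0.
have := @derive_ge0_le _ (fun u => u - u ^+ 2 / 2 + u ^+ 3 / 3 - ln (1 + u)) (fun u => 1 - u + u ^+ 2 - (1 + u)^-1) 0 u u0.
rewrite addr0 ln1 !expr0n /= !mul0r !addr0 !subr0; apply.
  move=> t /andP[t0 _].
  have d := @is_derive1_ln R (1 + t) ltac:(lra).
  have d2 : is_derive t 1 (fun t => 1 + t) (0 + 1) by exact: is_deriveD.
  have d3 := @is_derive1_comp R (@ln R) (fun t => 1 + t) t _ _ d d2.
  apply: is_derive_eq; rewrite /GRing.scale /=; field; lra.
move=> t /andP[t0 _].
rewrite (_ : _ - _ = t ^+ 3 / (1 + t)); last by field; lra.
by rewrite divr_ge0 ?exprn_ge0//; lra.
Qed.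

Lemma ln1B_le v : 0 <= v < 1 -> ln (1 - v) <= - v - v ^+ 2 / 2.
Proof.
move=> /andP[v0 v1]; rewrite -subr_ge0.
have := @derive_ge0_le _ (fun v => - v - v ^+ 2 / 2 - ln (1 - v)) (fun v => - 1 - v + (1 - v)^-1) 0 v v0.
have -> : - 0 - 0 ^+ 2 / 2 - ln (1 - 0) = 0 :> R by rewrite expr0n /= mul0r !oppr0 !addr0 ln1 oppr0 addr0.
apply.
  move=> t /andP[t0 t1].
  have d := @is_derive1_ln R (1 - t) ltac:(lra).
  have d2 : is_derive t 1 (fun t => 1 - t) (0 - 1) by exact: is_deriveB.
  have d3 := @is_derive1_comp R (@ln R) (fun t => 1 - t) t _ _ d d2.
  apply: is_derive_eq; rewrite /GRing.scale /=; field; lra.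
move=> t /andP[t0 t1].
rewrite (_ : _ + _ = t ^+ 2 / (1 - t)); last by field; lra.
by rewrite divr_ge0 ?exprn_ge0//; lra.
Qed.

(** With [y = pi t], [sin y <= y (1 - v)] by Taylor and [ln (1 - v) <= - v - v^2 / 2]. Expanding
    [v + v^2 / 2] leaves a nonnegative term in [y^8], which is discarded. *)
Lemma lsin_le_series t : 0 < t <= 1 / 6 ->
  lsin t <= ln (2 * pi) + ln t - pi ^+ 2 * t ^+ 2 / 6 - pi ^+ 4 * t ^+ 4 / (2 * 90) + pi ^+ 6 * t ^+ 6 / (8 * 90).
Proof.
move=> /andP[t0 t1].
have p0 := pi_gt3 R; have p1 := pi_lt4 R.
set y := pi * t; have y0 : 0 < y by rewrite mulr_gt0//; lra.
have y1 : y <= 1.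
  by have := @ler_pM R pi 4 t (1 / 6) ltac:(lra) ltac:(lra) ltac:(lra) t1; rewrite -/y; lra.
have yy1 : y ^+ 2 <= 1 by rewrite expr_le1// ltW.
have yy0 : 0 <= y ^+ 2 by rewrite exprn_ge0 ?ltW.
pose v := y ^+ 2 / 6 - y ^+ 4 / (2 * 60).
have y4 : y ^+ 4 = y ^+ 2 * y ^+ 2 by rewrite -exprD.
have y4le : y ^+ 4 <= y ^+ 2 by rewrite y4 ler_piMr.
have y4ge : 0 <= y ^+ 4 by rewrite exprn_ge0 ?ltW.
have v01 : 0 <= v < 1 by rewrite /v; apply/andP; split; lra.
have s0 : 0 < sin y by rewrite /y; apply: sin_pi_gt0; apply/andP; split; lra.
have sy : sin y <= y * (1 - v).
  have h := @sin_le_taylor5 R y (ltW y0); apply: le_trans h _.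
  by rewrite /v le_eqVlt; apply/orP; left; apply/eqP; field.
rewrite lsinE; last by apply/andP; split; lra.
have : ln (sin y) <= ln (y * (1 - v)) by rewrite ler_ln ?posrE ?mulr_gt0//; case/andP: v01; lra.
rewrite lnM ?posrE//; last by case/andP: v01; lra.
rewrite {2}/y lnM ?posrE//; last lra.
have := ln1B_le v01.
rewrite (@lnM _ 2 pi) ?posrE//; last lra.
have : y ^+ 2 / 6 + y ^+ 4 / (2 * 90) - y ^+ 6 / (8 * 90) <= v + v ^+ 2 / 2.
  rewrite -subr_ge0 /v (_ : _ - _ = (y ^+ 2) ^+ 4 / (80 * 90 * 4)); last by field.
  by apply: mulr_ge0; [exact: exprn_ge0|rewrite invr_ge0 -!natrM ler0n].
by rewrite -!exprMn -/y; lra.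
Qed.

(** This is [0.232603]. It sits between the required [0.2326] and [36 / 25] times the integral of
    [lsin] over [[0, 5/6]], about [0.232607], which is the largest constant that [J_left_ge] could
    have. *)
Definition kappa : R := (23 * 100 + 26) / (100 * 100) + 3 / (100 * 100 * 100).

Lemma xlnx_small (eta : R) : 0 < eta ->
  (* The witness is [1 / K^2] with [K = 2 / eta + 8]: by [ln K <= K], [e |ln e|] is at most
     [2 / K]. *)
  exists2 e : R, 0 < e <= 1 / 64 & e <= eta /\ - eta <= e * ln e.
Proof.
move=> eta0; pose K := 2 / eta + 8.
have K8 : 8 <= K by rewrite lerDr divr_ge0// ltW.
have Ke : 2 / eta <= K by rewrite lerDl.
have K0 : 0 < K by lra.
move: K K8 Ke K0 => K K8 Ke K0.
have iK : K^-1 <= 1 / 8 by rewrite div1r lef_pV2 ?posrE.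
have iK0 : 0 < K^-1 by rewrite invr_gt0.
have eK : 2 * K^-1 <= eta by rewrite ler_pdivrMr// mulrC -ler_pdivrMr.
have lK : ln K <= K by apply/ltW/ln_sublinear.
have eE : (K ^+ 2)^-1 = K^-1 * K^-1 by rewrite expr2 invfM.
have eiK : K^-1 * K^-1 <= K^-1 * (1 / 8) by apply: ler_wpM2l; [exact: ltW|].
exists ((K ^+ 2)^-1); rewrite eE; first by rewrite mulr_gt0//=; lra.
split; first lra.
have -> : ln (K^-1 * K^-1) = - (2 * ln K) by rewrite -eE lnV ?posrE ?exprn_gt0// lnXn// mulr_natl.
have : K^-1 * (K^-1 * ln K) <= K^-1.
  by rewrite ler_piMr ?(ltW iK0)// mulrC ler_pdivrMr// mul1r.
lra.
Qed.

(** Here [y] stands for [pi / 6], known to lie in [[0.52358, 0.5236]], and the left side is the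
    series of [lsin_le_series] integrated over [[0, 1/6]]. The margin is only of order [10^(-6)],
    hence the careful rounding. *)
Lemma sixth_numeric y : 52 / 100 + 3 / (10 * 100) + 58 / (10 * 100 * 100) <= y <= (52 * 100 + 36) / (100 * 100) ->
  (ln (1 + (2 * y - 1)) - 1 - y ^+ 2 / 18 - y ^+ 4 / (9 * 100) + y ^+ 6 / (72 * 70)) / 6 <= - kappa * (25 / 36).
Proof.
move=> /andP[y0 y1].
have h0 : 0 <= 52 / 100 + 3 / (10 * 100) + 58 / (10 * 100 * 100) :> R.
  by rewrite !addr_ge0 ?divr_ge0 ?mulr_ge0 ?ler0n.
have z0 : (100 + 37) / (5 * 100) <= y ^+ 2.
  have c : 52 / 100 + 3 / (10 * 100) <= 52 / 100 + 3 / (10 * 100) + 58 / (10 * 100 * 100) :> R by rewrite lerDl divr_ge0 ?mulr_ge0 ?ler0n.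
  by have := ler_pM h0 h0 y0 y0; rewrite -expr2; apply: le_trans; clear; lra.
have z1 : y ^+ 2 <= 11 / 40.
  have y2 := le_trans h0 y0.
  by have := ler_pM y2 y2 y1 y1; rewrite -expr2; move/le_trans; apply; clear; lra.
have l1 : ln (1 + (2 * y - 1)) <= ln (1 + 59 / (50 * 25)).
  rewrite ler_ln ?posrE; [lra| |by clear; lra].
  by apply: lt_le_trans (_ : 0 < 2 * (52 / 100 + 3 / (10 * 100))) _; [clear; lra|lra].
have l2 := @ln1D_le (59 / (50 * 25)) ltac:(rewrite divr_ge0//).
have -> : y ^+ 6 = y ^+ 2 * y ^+ 2 * y ^+ 2 by rewrite -!exprD.
have -> : y ^+ 4 = y ^+ 2 * y ^+ 2 by rewrite -exprD.
clear y0 y1; move: l1 l2 z0 z1; move: (ln _) (ln _) (y ^+ 2) => p r z l1 l2 z0 z1.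
have i0 : 0 <= (100 + 37) / (5 * 100) :> R by rewrite -natrD -natrM divr_ge0 ?ler0n.
have z2 : 0 <= z by apply: le_trans z0.
have zz0 := ler_pM i0 i0 z0 z0.
have zz1 := ler_pM z2 z2 z1 z1.
have zzz1 := ler_pM (mulr_ge0 z2 z2) z2 zz1 z1.
have {}l1 := le_trans l1 l2; clear l2 i0 z2 z1 zz1; rewrite /kappa.
have q1 : z * z * z / (72 * 70) <= 5 / (100 * 100 * 100) - 87 / (100 * 100 * 100 * 100).
  rewrite ler_pdivrMr; last by rewrite mulr_gt0.
  by apply: le_trans zzz1 _; clear; lra.
have q2 : (8 * 100 + 34) / (10 * 100 * 100 * 100) <= z * z / (9 * 100).
  by rewrite ler_pdivlMr//; apply: le_trans zz0; clear; lra.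
move: (z * z * z / _) (z * z / (9 * 100)) q1 q2; clear zzz1 zz0 => u v q1 q2.
rewrite ler_pdivrMr//.
lra.
Qed.

Lemma J_sixth : J 0 (1 / 6) <= - kappa * (25 / 36).
Proof.
have p0 := pi_gt3 R; have p1 := pi_lt4 R.
pose c2 : R := pi ^+ 2; pose c4 : R := pi ^+ 4; pose c6 : R := pi ^+ 6.
pose G t := ln (2 * pi) * t - (t - t * ln t) - c2 / 18 * t ^+ 3 - c4 / (9 * 100) * t ^+ 5 + c6 / (72 * 70) * t ^+ 7.
have J_G : J 0 (1 / 6) <= G (1 / 6) - 0.
  apply: (@J0_le_antiderivative G (fun t => ln (2 * pi) + ln t - c2 * t ^+ 2 / 6 - c4 * t ^+ 4 / (2 * 90) + c6 * t ^+ 6 / (8 * 90))).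
  - lra.
  - lra.
  - move=> t /andP[t0 _]; have d := is_derive_xlnx t0.
    by apply: is_derive_eq; rewrite /GRing.scale /=; field.
  - by move=> t; exact: lsin_le_series.
  move=> eta eta0.
  have [e /andP[e0 e64] [ee el]] := @xlnx_small (eta / 4) ltac:(lra).
  exists e; first by rewrite e0 /=; lra.
  split; first lra.
  have pw n : 0 <= e ^+ n <= 1 by rewrite exprn_ge0 ?exprn_ile1 ?(ltW e0)//; lra.
  have p2 : 0 <= ln (2 * pi) :> R by apply: ln_ge0; lra.
  have pi0 : 0 <= pi :> R by lra.
  have pi4 : pi <= 4 :> R by lra.
  have cb n : 0 <= (pi ^+ n : R) <= 4 ^+ n by rewrite exprn_ge0//= lerXn2r// nnegrE.
  have tb (c : R) n : 0 <= c <= 1 -> c * e ^+ n.+1 <= e.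
    move=> /andP[c0 c1]; have /andP[q0 q1] := pw n.
    rewrite exprS mulrCA ler_piMr ?(ltW e0)//.
    by rewrite -[leRHS]mul1r; apply: ler_pM.
  have b2 : c2 / 18 * e ^+ 3 <= e by apply: tb; have := cb 2%N; rewrite -/c2; move: (c2) => z; lra.
  have b4 : c4 / (9 * 100) * e ^+ 5 <= e by apply: tb; have := cb 4%N; rewrite -/c4; move: (c4) => z; lra.
  have b6 : 0 <= c6 / (72 * 70) * e ^+ 7.
    by apply: mulr_ge0; [have := cb 6%N; rewrite -/c6; move: (c6) => z; lra|case/andP: (pw 7%N)].
  have b0 : 0 <= ln (2 * pi) * e by rewrite mulr_ge0// ltW.
  rewrite /G; move: (_ * e ^+ 3) (_ * e ^+ 5) (_ * e ^+ 7) (ln _ * e) (e * ln e) b2 b4 b6 b0 el.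
  by clear -ee; move=> ? ? ? ? ? ? ? ? ? ?; lra.
apply: le_trans J_G _; rewrite subr0 /G.
set y : R := pi / 6.
(* This cancels [ln (2 pi)] and leaves a logarithm near 1, in the shape that [ln1D_le] accepts. *)
have l6 : ln (1 / 6) = ln (1 + (2 * y - 1)) - ln (2 * pi) :> R.
  by rewrite -ln_div ?posrE; [congr ln; rewrite /y; field; rewrite gt_eqF//|rewrite /y|]; lra.
have -> : ln (2 * pi) * (1 / 6) - (1 / 6 - 1 / 6 * ln (1 / 6)) - c2 / 18 * (1 / 6) ^+ 3 - c4 / (9 * 100) * (1 / 6) ^+ 5 +
   c6 / (72 * 70) * (1 / 6) ^+ 7 = (ln (1 + (2 * y - 1)) - 1 - y ^+ 2 / 18 - y ^+ 4 / (9 * 100) + y ^+ 6 / (72 * 70)) / 6.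
  by rewrite l6 /c2 /c4 /c6 /y; field.
clear l6 G p0 p1; have := pi_gt31415 R; have := pi_lt31416 R.
by rewrite /y => h1 h2; apply: sixth_numeric; apply/andP; split; rewrite ?ler_pdivlMr ?ler_pdivrMr//; lra.
Qed.

Lemma kappa_gt0 : 0 < kappa.
Proof. by rewrite /kappa; lra. Qed.

(** The product formula degenerates at [w = 0], so it is applied with half a step, [w = 1 / (2 n)].
    Concavity removes the shift again at no cost, because the tangent slopes at [s / n] sum to zero
    by reflection. *)
Lemma sum_lsin_frac_ge n : (0 < n)%N -> ln n%:R - 1 <= \sum_(1 <= s < n) lsin (s%:R / n%:R) :> R.
Proof.
move=> n0; have nr : (0 : R) < n%:R by rewrite ltr0n.
have n1 : (1 : R) <= n%:R by rewrite ler1n.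
pose w : R := (2 * n%:R)^-1.
have iw : n%:R^-1 = 2 * w by rewrite /w; field; rewrite gt_eqF.
have w0 : 0 < w by rewrite invr_gt0 mulr_gt0.
have w1 : w <= 1 / 2 by rewrite /w div1r lef_pV2 ?posrE ?mulr_gt0//; lra.
have p0 := pi_gt3 R; have p1 := pi_lt4 R.
have nw : n%:R * w = 1 / 2 by rewrite /w; field; rewrite gt_eqF.
have sw : sin (pi * (n%:R * w)) = 1.
  by rewrite nw (_ : pi * (1 / 2) = pi / 2) ?sin_pihalf//; field.
have fw : lsin (n%:R * w) = ln 2 by rewrite /lsin sw mulr1 ger0_norm.
have := @sum_lsin _ n w n0; rewrite sw oner_neq0 fw => /(_ isT).
rewrite -(big_mkord xpredT (fun s => lsin (s%:R / n%:R - w))) big_ltn// mul0r sub0r lsinN.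
have lw : lsin w <= 2 * ln 2 - ln n%:R.
  have sn : sin (pi * w) != 0 by rewrite gt_eqF// sin_pi_gt0//; apply/andP; split; lra.
  apply: le_trans (lsin_le_ln sn) _; rewrite (gtr0_norm w0).
  have -> : 2 * pi * w = pi / n%:R by rewrite /w; field; rewrite gt_eqF.
  rewrite ln_div ?posrE//; last lra.
  have : ln pi <= ln (2 ^+ 2) :> R by rewrite ler_ln ?posrE ?exprn_gt0//; lra.
  by rewrite lnXn// mulr2n; lra.
have h : \sum_(1 <= s < n) lsin (s%:R / n%:R - w) <= \sum_(1 <= s < n) lsin (s%:R / n%:R).
  have c0 : \sum_(1 <= s < n) ctg (s%:R / n%:R) = 0 :> R.
    have := @sum_nat_flip R (fun s => ctg (s%:R / n%:R)) n n.-1 (leq_pred n).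
    rewrite prednK// (_ : n - n.-1 = 1)%N; last by lia.
    have -> : \sum_(1 <= t < n) ctg ((n - t)%:R / n%:R) = - \sum_(1 <= t < n) ctg (t%:R / n%:R) :> R.
      rewrite -sumrN big_nat [RHS]big_nat; apply: eq_bigr => t /andP[_ tn].
      by rewrite natrB ?(ltnW tn)// -ctg1B; congr ctg; field; rewrite gt_eqF.
    by move: (\sum_(_ <= _ < _) _) => z; lra.
  have -> : \sum_(1 <= s < n) lsin (s%:R / n%:R) = \sum_(1 <= s < n) (lsin (s%:R / n%:R) + pi * ctg (s%:R / n%:R) * (- w)).
    by rewrite big_split /= -mulr_suml -mulr_sumr c0 mulr0 mul0r addr0.
  rewrite big_nat [leRHS]big_nat; apply: ler_sum => s /andP[s0 sn].
  have sr : (1 : R) <= s%:R by rewrite ler1n.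
  have s1 : n%:R^-1 <= s%:R / n%:R :> R by rewrite -[leLHS]mul1r ler_pM2r ?invr_gt0.
  have s2 : s%:R / n%:R < 1 :> R by rewrite ltr_pdivrMr// mul1r ltr_nat.
  have := @lsin_tangent _ (s%:R / n%:R) (s%:R / n%:R - w) ltac:(apply/andP; split; lra) ltac:(apply/andP; split; lra).
  by rewrite addrAC subrr add0r; lra.
have := ln2_le1 R; have : 0 <= ln 2 :> R by apply: ln_ge0; lra.
by move=> l0 l1 e; clear -h lw l0 l1 e; lra.
Qed.

Lemma J_sum n a b : (a <= b)%N -> (b < n)%N ->
  J (a%:R / n%:R) (b%:R / n%:R) = \sum_(a <= s < b) J (s%:R / n%:R) (s.+1%:R / n%:R) :> R.
Proof.
move=> ab; elim: b ab => [|b IH] ab bn.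
  by move: ab; rewrite leqn0 => /eqP ->; rewrite big_geq// J_refl.
have nr : (0 : R) < n%:R by rewrite ltr0n; lia.
have [e|ne] := eqVneq a b.+1; first by rewrite e big_geq// J_refl.
have ab' : (a <= b)%N by lia.
rewrite big_nat_recr//= -IH// ?(ltnW bn)// J_add//.
- by rewrite ler_pM2r ?invr_gt0// ler_nat.
- by rewrite ler_pM2r ?invr_gt0// ler_nat.
- by rewrite ltr_pdivrMr// mul1r ltr_nat.
Qed.

Lemma J_incr_ge n a b : (0 < a)%N -> (a <= b)%N -> (2 * b <= n)%N ->
  \sum_(a <= s < b) lsin (s%:R / n%:R) <= n%:R * J (a%:R / n%:R) (b%:R / n%:R) :> R.
Proof.
move=> a0 ab bn; have nr : (0 : R) < n%:R by rewrite ltr0n; lia.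
rewrite J_sum//; last by lia.
rewrite mulr_sumr big_nat [leRHS]big_nat; apply: ler_sum => s /andP[s1 sb].
have s0 : 0 < s%:R / n%:R :> R by rewrite divr_gt0// ltr0n; lia.
have s2 : s.+1%:R / n%:R <= 1 / 2 :> R.
  rewrite ler_pdivrMr//; have : (2 * s.+1)%:R <= n%:R :> R by rewrite ler_nat; lia.
  by rewrite natrM; lra.
have ss : s%:R / n%:R <= s.+1%:R / n%:R :> R by rewrite ler_pM2r ?invr_gt0// ler_nat.
have := @J_ge_cst (lsin (s%:R / n%:R)) _ _ s0 ss ltac:(lra) _.
rewrite (_ : s.+1%:R / n%:R - s%:R / n%:R = n%:R^-1); last by rewrite -natr1; field; rewrite gt_eqF.
rewrite [n%:R * _]mulrC -ler_pdivrMr//; apply => t /andP[st ts].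
by apply: lsin_incr => //; lra.
Qed.

Lemma J_decr_ge n a b : (0 < a)%N -> (n <= 2 * a)%N -> (a <= b)%N -> (b < n)%N ->
  \sum_(a <= s < b) lsin (s.+1%:R / n%:R) <= n%:R * J (a%:R / n%:R) (b%:R / n%:R) :> R.
Proof.
move=> a0 an ab bn; have nr : (0 : R) < n%:R by rewrite ltr0n; lia.
rewrite J_sum// mulr_sumr big_nat [leRHS]big_nat; apply: ler_sum => s /andP[s1 sb].
have s2 : 1 / 2 <= s%:R / n%:R :> R.
  rewrite ler_pdivlMr//; have : n%:R <= (2 * s)%:R :> R by rewrite ler_nat; lia.
  by rewrite natrM; lra.
have ss : s%:R / n%:R <= s.+1%:R / n%:R :> R by rewrite ler_pM2r ?invr_gt0// ler_nat.
have s3 : s.+1%:R / n%:R < 1 :> R by rewrite ltr_pdivrMr// mul1r ltr_nat; lia.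
have := @J_ge_cst (lsin (s.+1%:R / n%:R)) (s%:R / n%:R) _ ltac:(lra) ss s3 _.
rewrite (_ : s.+1%:R / n%:R - s%:R / n%:R = n%:R^-1); last by rewrite -natr1; field; rewrite gt_eqF.
rewrite [n%:R * _]mulrC -ler_pdivrMr//; apply => t /andP[st ts].
by apply: lsin_decr => //; lra.
Qed.

(* Reflection: [5/6, 1] carries the mass of [0, 1/6], and lsin has mean 0 by the product formula. *)
Lemma J_five_sixths : - J 0 (1 / 6) <= J 0 (5 / 6) :> R.
Proof.
(* Riemann sums with [6 m] cells, which put nodes at [1/6], [1/2] and [5/6]. The loss is
   logarithmic, against a left factor [6 m]. *)
have key m : (0 < m)%N -> - (ln (6 * m)%:R + 4) <= (6 * m)%:R * (J 0 (5 / 6) + J 0 (1 / 6)) :> R.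
  move=> m0; set n := (6 * m)%N.
  have N1 : (m.-1 <= n)%N by rewrite /n; lia.
  have N2 : (n - m.-1 = (5 * m).+1)%N by rewrite /n; lia.
  have N3 (t : nat) : (t < m)%N -> (t <= n)%N by rewrite /n; lia.
  have N4 : ((5 * m).+1 <= n)%N by rewrite /n; lia.
  have N5 : ((3 * m).+1 <= (5 * m).+1)%N by lia.
  have N6 : (1 <= 3 * m)%N by lia.
  have N7 : (0 < n)%N by rewrite /n; lia.
  have nr : (6 : R) <= n%:R by rewrite ler_nat /n; lia.
  have n0 : (0 : R) < n%:R by lra.
  have mr : (0 : R) < m%:R by rewrite ltr0n.
  have nE : n%:R = 6 * m%:R :> R by rewrite natrM.
  have i0 : 0 < n%:R^-1 :> R by rewrite invr_gt0.
  have i6 : n%:R^-1 <= 1 / 6 :> R by rewrite div1r lef_pV2 ?posrE.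
  have i1 : 1%:R / n%:R = n%:R^-1 :> R by rewrite div1r.
  have e3 : (3 * m)%:R / n%:R = 1 / 2 :> R by rewrite nE natrM; field; rewrite gt_eqF.
  have e5 : (5 * m)%:R / n%:R = 5 / 6 :> R by rewrite nE natrM; field; rewrite gt_eqF.
  have e1 : m%:R / n%:R = 1 / 6 :> R by rewrite nE; field; rewrite gt_eqF.
  have N8 : (2 * (3 * m) = n)%N by rewrite mulnA.
  have N9 : (3 * m <= 5 * m)%N by rewrite leq_mul2r orbT.
  have N10 : (2 * m <= n)%N by rewrite leq_mul2r orbT.
  have h1 := @J_incr_ge n 1 (3 * m) isT N6 ltac:(by rewrite N8).
  have h2 := @J_decr_ge n (3 * m) (5 * m) N6 ltac:(by rewrite N8) N9 N4.
  have h3 := @J_incr_ge n 1 m isT m0 N10.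
  rewrite i1 e3 in h1; rewrite e3 e5 in h2; rewrite i1 e1 in h3.
  have a1 := @J_add R 0 n%:R^-1 (1 / 2) (lexx 0) ltac:(exact: ltW) ltac:(clear -i6; lra) ltac:(clear; lra).
  have a2 := @J_add R 0 (1 / 2) (5 / 6) (lexx 0) ltac:(clear; lra) ltac:(clear; lra) ltac:(clear; lra).
  have a3 := @J_add R 0 n%:R^-1 (1 / 6) (lexx 0) ltac:(exact: ltW) i6 ltac:(clear; lra).
  have sm := @J_ge0_small R n%:R^-1 ltac:(rewrite i0 /=; clear -i6; lra).
  rewrite lnV ?posrE// in sm.
  have flip : \sum_(1 <= s < m) lsin (s%:R / n%:R) = \sum_((5 * m).+1 <= s < n) lsin (s%:R / n%:R) :> R.
    have := @sum_nat_flip R (fun s => lsin (s%:R / n%:R)) n m.-1 N1.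
    rewrite prednK// N2.
    move=> ->; rewrite big_nat [RHS]big_nat; apply: eq_bigr => t /andP[t1 tm].
    have tn := N3 _ tm.
    by rewrite natrB// -lsin1B; congr lsin; field; rewrite gt_eqF.
  have shift : \sum_(3 * m <= s < 5 * m) lsin (s.+1%:R / n%:R) = \sum_((3 * m).+1 <= s < (5 * m).+1) lsin (s%:R / n%:R) :> R.
    by rewrite big_add1.
  have l2 : lsin ((3 * m)%:R / n%:R) = ln 2 :> R.
    by rewrite e3 /lsin (_ : pi * (1 / 2) = pi / 2) ?sin_pihalf ?mulr1 ?ger0_norm//; field.
  have total : \sum_(1 <= s < n) lsin (s%:R / n%:R) = \sum_(1 <= s < 3 * m) lsin (s%:R / n%:R) + ln 2 +
     \sum_((3 * m).+1 <= s < (5 * m).+1) lsin (s%:R / n%:R) + \sum_((5 * m).+1 <= s < n) lsin (s%:R / n%:R) :> R.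
    rewrite (big_cat_nat _ (n := (5 * m).+1))//=.
    rewrite (big_cat_nat _ (n := (3 * m).+1))//=.
    by rewrite big_nat_recr ?l2.
  have tot := @sum_lsin_frac_ge n N7.
  have l21 := ln2_le1 R.
  have sm2 : - ln n%:R - 1 <= n%:R * J 0 n%:R^-1 :> R.
    rewrite -ler_pdivrMl//; apply: le_trans sm; rewrite le_eqVlt; apply/orP; left; apply/eqP.
    by ring.
  rewrite -a2 -a1 -a3 !mulrDr.
  rewrite shift in h2; rewrite flip in h3.
  rewrite total in tot; move: tot h1 h2 h3 sm2 l21; clear.
  by move: (\sum_(_ <= _ < 3 * m) _) (\sum_(_ <= _ < (5 * m).+1) _) (\sum_(_ <= _ < n) _) (n%:R * _) (n%:R * _) (n%:R * _) (n%:R * _) (ln n%:R) (ln 2) => *; lra.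
rewrite -subr_ge0 opprK leNgt; apply/negP => neg.
set x := J 0 (5 / 6) + _ in neg key.
pose k := (Num.bound (1 / - x)).+1.
have k1 : (1 : R) <= k%:R by rewrite ler1n.
have kx : 1 < k%:R * (- x).
  rewrite -ltr_pdivrMr; last lra.
  apply: lt_trans (archi_boundP _) _; last by rewrite ltr_nat.
  by rewrite divr_ge0//; lra.
(* The cell number becomes the square [(6 k)^2], so its logarithm is at most [12 k] while the
   negative side grows like [k^2]. *)
have := key (6 * k * k)%N ltac:(rewrite /k; lia).
have -> : (6 * (6 * k * k))%:R = (6 * k%:R) ^+ 2 :> R by rewrite !natrM; ring.
rewrite lnXn; last lra.
have : ln (6 * k%:R) < 6 * k%:R :> R by apply: ln_sublinear; lra.
have : k%:R * 1 <= k%:R * (k%:R * (- x)) by apply: ler_wpM2l; lra.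
clear -k1; move: (k%:R) k1 => z z1; move: (ln (6 * z)) => y h1 h2.
have -> : (6 * z) ^+ 2 * x = - (36 * (z * (z * - x))) by ring.
move: (z * (z * - x)) h1 => u h1.
by rewrite mulr2n; lra.
Qed.

(* lsin exceeds the chord of slope -2 kappa through (5/6, 0) either on all of [x, 5/6]
   or on no point of (0, x]; the second case uses the value of the integral over [0, 5/6]. *)
Lemma J_left_ge x : 0 <= x <= 5 / 6 -> kappa * (5 / 6 - x) ^+ 2 <= J x (5 / 6).
Proof.
move=> /andP[x0 x1]; have k0 := kappa_gt0.
have J56 : kappa * (25 / 36) <= J 0 (5 / 6).
  by have := J_five_sixths; have := J_sixth; lra.
move: x0; rewrite le_eqVlt => /orP[/eqP <-|x0].
  by apply: le_trans J56; rewrite ler_pM2l// subr0; lra.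
move: x1; rewrite le_eqVlt => /orP[/eqP ->|x1].
  by rewrite J_refl subrr expr0n mulr0.
have f0 := lsin_five_sixths.
have tg t y : 0 < t -> t < 1 -> 0 < y -> y < 1 -> lsin y - lsin t <= pi * ctg t * (y - t).
  by move=> *; apply: lsin_tangent; apply/andP; split.
have dG (t : R) : is_derive t 1 (fun t => - kappa * (5 / 6 - t) ^+ 2) (2 * kappa * (5 / 6 - t)).
  by apply: is_derive_eq; rewrite /GRing.scale /=; ring.
have [h|h] := leP (2 * kappa * (5 / 6 - x)) (lsin x).
  have -> : kappa * (5 / 6 - x) ^+ 2 = (- kappa * (5 / 6 - 5 / 6) ^+ 2) - (- kappa * (5 / 6 - x) ^+ 2) by ring.
  apply: (@J_ge_antiderivative (fun t => - kappa * (5 / 6 - t) ^+ 2) (fun t => 2 * kappa * (5 / 6 - t))) => //; [lra|lra|].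
  move=> t /andP[xt]; rewrite le_eqVlt => /orP[/eqP ->|t56]; first by rewrite f0 subrr mulr0.
  (* If [lsin] dipped below the chord at [t], the tangent at [t] would have slope above [- 2 kappa]
     in order to clear [5/6], and would then force [lsin x] below the chord too. *)
  rewrite leNgt; apply/negP => lt.
  have t1 := tg t x ltac:(lra) ltac:(lra) x0 ltac:(lra).
  have t2 := tg t (5 / 6) ltac:(lra) ltac:(lra) ltac:(lra) ltac:(lra).
  rewrite f0 in t2; move: (pi * ctg t) (lsin t) t1 t2 lt => c y t1 t2 lt.
  have c1 : 0 < (c + 2 * kappa) * (5 / 6 - t) by lra.
  have c2 : 0 < c + 2 * kappa by move: c1; rewrite pmulr_lgt0//; lra.
  have : 0 <= (c + 2 * kappa) * (t - x) by rewrite mulr_ge0//; lra.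
  by lra.
have Jx : J 0 x <= (- kappa * (5 / 6 - x) ^+ 2) - (- kappa * (25 / 36)).
  apply: (@J0_le_antiderivative (fun t => - kappa * (5 / 6 - t) ^+ 2) (fun t => 2 * kappa * (5 / 6 - t))) => //; [lra| |].
    move=> t /andP[t0 tx].
    have t1 := tg x t x0 ltac:(lra) t0 ltac:(lra).
    have t2 := tg x (5 / 6) x0 ltac:(lra) ltac:(lra) ltac:(lra).
    rewrite f0 in t2; move: (pi * ctg x) (lsin x) (lsin t) h t1 t2 => c y z h t1 t2.
    have c1 : 0 < (c + 2 * kappa) * (5 / 6 - x) by lra.
    have c2 : 0 < c + 2 * kappa by move: c1; rewrite pmulr_lgt0//; lra.
    have : 0 <= (c + 2 * kappa) * (x - t) by rewrite mulr_ge0//; lra.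
    by lra.
  move=> eta eta0; exists (Num.min x (1 / 8)).
    have e8 : 0 < 1 / 8 :> R by lra.
    by rewrite lt_min x0 e8 ge_min lexx.
  split; first by rewrite ge_min lexx orbT.
  set e := Num.min _ _.
  have e0 : 0 <= e by rewrite le_min (ltW x0)/=; lra.
  have e1 : e <= 1 / 8 by rewrite ge_min lexx orbT.
  have e2 : (5 / 6 - e) ^+ 2 <= 25 / 36.
    have := @ler_pM R (5 / 6 - e) (5 / 6) (5 / 6 - e) (5 / 6) ltac:(lra) ltac:(lra) ltac:(lra) ltac:(lra).
    by rewrite -expr2; move: (_ ^+ 2) => q; lra.
  have : kappa * (5 / 6 - e) ^+ 2 <= kappa * (25 / 36) by rewrite ler_pM2l.
  by move: (_ ^+ 2) => q; lra.
have := J_add (lexx 0) (ltW x0) (ltW x1) (_ : 5 / 6 < 1); move=> /(_ ltac:(clear; lra)).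
by move: J56 Jx; move: (_ ^+ 2) (J x _) (J 0 x) (J 0 _) => *; lra.
Qed.

End IntegralBounds.

(** * From sums over blocks to the integral, for one digit *)

Section LevelSums.
Variable R : realType.
Implicit Types x y : R.
Local Notation J := (@J R).

Lemma ler_pM3 (x1 x2 x3 y1 y2 y3 : R) : 0 <= x1 -> 0 <= x2 -> 0 <= x3 ->
  x1 <= y1 -> x2 <= y2 -> x3 <= y3 -> x1 * x2 * x3 <= y1 * y2 * y3.
Proof. by move=> *; do !apply: ler_pM => //; rewrite mulr_ge0. Qed.

Lemma lsin_lipschitz x y m d : 0 < m -> 0 < d -> m <= x -> x <= 1 - d -> m <= y -> y <= 1 - d ->
  `|lsin x - lsin y| <= 4 * `|x - y| / (m * d).
Proof.
move=> m0 d0 mx xd my yd.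
have cx := norm_ctg_le_box m0 d0 mx xd; have cy := norm_ctg_le_box m0 d0 my yd.
have p0 := pi_gt3 R; have p1 := pi_lt4 R.
have bound (z t : R) : `|ctg z| <= (m * d)^-1 -> pi * ctg z * t <= 4 * `|t| / (m * d).
  move=> cz; apply: le_trans (ler_norm _) _; rewrite normrM (normrM pi) [`|pi|]ger0_norm; last lra.
  rewrite -[leRHS]mulrA [`|t| * _]mulrC [leRHS]mulrA; apply: ler_wpM2r => //.
  by apply: ler_pM => //; lra.
have h1 := @lsin_tangent R x y ltac:(apply/andP; split; lra) ltac:(apply/andP; split; lra).
have h2 := @lsin_tangent R y x ltac:(apply/andP; split; lra) ltac:(apply/andP; split; lra).
have b1 := bound _ (y - x) cx; have b2 := bound _ (x - y) cy.
rewrite distrC in b1.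
by rewrite ler_norml; apply/andP; split; lra.
Qed.

Lemma sum_invS_le (m n : nat) : (0 < n)%N -> \sum_(m <= b < n) b.+1%:R^-1 <= 1 + ln n%:R :> R.
Proof.
move=> n0; apply: (@le_trans _ _ (\sum_(0 <= b < n) b.+1%:R^-1)).
  have [mn|nm] := leqP m n; last by rewrite big_geq ?sumr_ge0// ltnW.
  by rewrite [leRHS](big_cat_nat _ (n := m))//= lerDr sumr_ge0.
elim: n n0 => // -[|n] IH _; first by rewrite big_nat1 invr1 ln1; lra.
rewrite big_nat_recr//=.
have h := @invS_le_ln R n.+1 isT.
apply: le_trans (lerD (IH isT) h) _; lra.
Qed.

Lemma ln_mul_pi_le (c : R) : 0 < c -> ln (c * pi) <= 4 * c.
Proof.
move=> c0; have cp : 0 < c * pi by rewrite mulr_gt0// pi_gt0.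
apply: le_trans (ltW (ln_sublinear cp)) _.
by rewrite mulrC ler_pM2r// ltW// pi_lt4.
Qed.

Lemma lsin_le_near0 (i y : R) : 0 < i -> 0 < y < 1 -> y <= 4 * i -> lsin y <= 32 + ln i.
Proof.
move=> i0 y01 yi; have /andP[y0 _] := y01.
apply: le_trans (lsin_le_ln (lt0r_neq0 (sin_pi_gt0 y01))) _; rewrite (gtr0_norm y0).
have p0 := pi_gt0 R.
have -> : 32 = 4 * 8 :> R by rewrite -natrM.
apply: le_trans (lerD (ln_mul_pi_le (ltr0n R 8)) (lexx _)).
rewrite -lnM ?posrE ?mulr_gt0// ler_ln ?posrE ?mulr_gt0//.
rewrite -mulrA [8 * _]mulrC -[pi * 8 * i]mulrA -[2 * _]mulrC -[pi * y * 2]mulrA ler_pM2l//.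
by move: yi; clear; lra.
Qed.

(** The constant is [18 * 300], the two distances to the ends, taken out of the logarithm by
    [ln z < z]. *)
Lemma lsin_ge_near0 (i y : R) : 0 < i -> i / 18 <= y -> y <= 1 - 1 / 300 -> ln i - 54 * 100 <= lsin y.
Proof.
move=> i0 yi y1; have v0 : 0 < i / 18 by rewrite divr_gt0.
have y0 := lt_le_trans v0 yi.
have y01 : 0 < y < 1 by rewrite y0; move: y1; clear; lra.
have d0 : (0 : R) < 1 / 300 by exact: divr_gt0 ltr01 (ltr0n _ 300).
have d1 : 1 / 300 <= 1 - y by rewrite lerBrDr -lerBrDl.
have low : i / (54 * 100) <= sin (pi * y).
  apply: le_trans (sin_pi_ge_xx (x := y) _); last by rewrite !ltW; case/andP: y01.
  have -> : i / (54 * 100) = i / 18 * (1 / 300) by field.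
  exact: ler_pM (ltW v0) (ltW d0) yi d1.
rewrite lsinE// -[leLHS]add0r; apply: lerD; first by apply: ln_ge0; rewrite ler1n.
have c0 : (0 : R) < 54 * 100 by rewrite -natrM ltr0n.
apply: (@le_trans _ _ (ln (i / (54 * 100)))).
  by rewrite ln_div ?posrE// lerD2l lerN2; exact/ltW/ln_sublinear.
rewrite ler_ln ?posrE//; first exact: divr_gt0.
exact: sin_pi_gt0.
Qed.

Lemma first_cell_le (a y : R) : 2 <= a -> y <= 4 * a^-1 -> a^-1 / 18 <= y -> y <= 1 - 1 / 300 ->
  `|a * J 0 a^-1 - lsin y| <= 54 * 100 + 8.
Proof.
move=> a2 y4 y18 y1.
have a0 : 0 < a by exact: lt_le_trans a2.
have i0 : 0 < a^-1 by rewrite invr_gt0.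
have i2 : a^-1 <= 1 / 2 by rewrite div1r lef_pV2 ?posrE.
have y0 : 0 < y by apply: lt_le_trans y18; rewrite divr_gt0.
have y01 : 0 < y < 1 by rewrite y0; move: y1; clear; lra.
have lo : ln a^-1 - 1 <= a * J 0 a^-1.
  have := @J_ge0_small R a^-1 ltac:(by rewrite i0 i2).
  by rewrite -(ler_pM2l a0) mulrBr mulrA mulfV ?gt_eqF// mul1r.
have hi : a * J 0 a^-1 <= ln (2 * pi) + ln a^-1.
  have p0 := pi_gt0 R.
  rewrite mulrC -ler_pdivlMr// -lnM ?posrE ?mulr_gt0//.
  have i1 : a^-1 < 1 by apply: le_lt_trans i2 _; clear; lra.
  apply: J0_le_cst => // t /andP[t0 ta].
  have t01 : 0 < t < 1 by rewrite t0 (le_lt_trans ta).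
  apply: le_trans (lsin_le_ln (lt0r_neq0 (sin_pi_gt0 t01))) _; rewrite (gtr0_norm t0).
  by rewrite ler_ln ?posrE ?mulr_gt0// ler_pM2l ?mulr_gt0.
have := lsin_le_near0 i0 y01 y4; have := lsin_ge_near0 i0 y18 y1.
have := ln_mul_pi_le (ltr0n R 2); move: hi lo.
move: (ln (2 * pi)) (ln a^-1) (a * J 0 a^-1) (lsin y) => u v w z; clear.
by rewrite ler_norml => ? ? ? ? ?; apply/andP; split; lra.
Qed.

Lemma lsin_cell_close (i u v y t : R) : 0 < i -> i <= u -> v = u + i -> v <= 99 / 100 ->
  `|y - v| <= 3 * i -> v / 18 <= y -> y <= 1 - 1 / 300 -> u <= t <= v ->
  `|lsin t - lsin y| <= 4 * (4 * i) / (v / 18 * (1 / 300)).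
Proof.
move=> i0 iu vE v99; rewrite ler_norml => /andP[yv1 yv2] vy y1 /andP[ut tv].
have v0 : 0 < v / 18 by lra.
have d0 : (0 : R) < 1 / 300 by exact: divr_gt0 ltr01 (ltr0n _ 300).
apply: le_trans (lsin_lipschitz v0 d0 _ _ vy y1) _; [lra|lra|].
apply: ler_wpM2r; first by rewrite invr_ge0; exact/ltW/mulr_gt0.
apply: ler_wpM2l; first exact: ler0n.
by rewrite ler_norml; apply/andP; split; lra.
Qed.

Lemma inner_cell_le (a : R) (b : nat) y : 0 < a -> (0 < b)%N -> b.+1%:R <= 99 / 100 * a ->
  `|y - b.+1%:R / a| <= 3 / a -> b.+1%:R / a / 18 <= y -> y <= 1 - 1 / 300 ->
  `|a * J (b%:R / a) (b.+1%:R / a) - lsin y| <= 16 * (54 * 100) / b.+1%:R.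
Proof.
move=> a0 b0 ba yb y0 y1; have i0 : 0 < a^-1 by rewrite invr_gt0.
have br : (1 : R) <= b%:R by rewrite ler1n.
have iu : a^-1 <= b%:R / a by rewrite ler_peMl// ltW.
have vE : b.+1%:R / a = b%:R / a + a^-1 by rewrite -natr1 mulrDl mul1r.
have v99 : b.+1%:R / a <= 99 / 100 by rewrite ler_pdivrMr.
have close t := lsin_cell_close (t := t) i0 iu vE v99 yb y0 y1.
have eE : 4 * (4 * a^-1) / (b.+1%:R / a / 18 * (1 / 300)) = 16 * (54 * 100) / b.+1%:R.
  by field; rewrite gt_eqF// gt_eqF// ltr0n.
have u0 : 0 < b%:R / a by exact: lt_le_trans iu.
have uv : b%:R / a <= b.+1%:R / a by rewrite vE lerDl ltW.
have v1 : b.+1%:R / a < 1 by apply: le_lt_trans v99 _; clear; lra.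
have len : b.+1%:R / a - b%:R / a = a^-1 by rewrite vE addrAC subrr add0r.
set e := 16 * _ / _ in eE *.
have u1 := @J_le_cst R (lsin y + e) _ _ u0 uv v1.
have u2 := @J_ge_cst R (lsin y - e) _ _ u0 uv v1.
rewrite len ler_pdivlMr// [J _ _ * _]mulrC in u1; rewrite len ler_pdivrMr// [J _ _ * _]mulrC in u2.
by rewrite ler_distl u1 ?u2// => t /close; rewrite eE ler_distl => /andP[].
Qed.

(** Replaces a value of [lsin] near the right end of a cell by the mean over the cell. The slope at
    distance [(b + 1) / a] from [0] is of order [a / (b + 1)] and the cell has width [1 / a]. In the
    cell [b = 0] both quantities are [- ln a] up to a constant. *)
Lemma cell_le (a b : nat) y : (2 <= a)%N -> b.+1%:R <= 99 / 100 * a%:R :> R ->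
  `|y - b.+1%:R / a%:R| <= 3 / a%:R -> b.+1%:R / (18 * a%:R) <= y -> y <= 1 - 1 / 300 ->
  `|a%:R * J (b%:R / a%:R) (b.+1%:R / a%:R) - lsin y| <= 100 * 100 * 10 / b.+1%:R.
Proof.
move=> a2 ba yb y0 y1.
have ar : (2 : R) <= a%:R by rewrite ler_nat.
have a0 : (0 : R) < a%:R by exact: lt_le_trans ar.
have y0' : b.+1%:R / a%:R / 18 <= y by rewrite -mulrA -invfM [_ * 18]mulrC.

case: b => [|b] in ba yb y0' {y0} *.
  rewrite mul0r div1r in yb y0' *; apply: le_trans (first_cell_le ar _ y0' y1) _.
    by move: yb; rewrite ler_norml => /andP[_]; move: (a%:R^-1) => i; clear; lra.
  by rewrite divr1; clear; lra.
apply: le_trans (inner_cell_le a0 (ltn0Sn b) ba yb y0' y1) _.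
by rewrite ler_pM2r ?invr_gt0//; clear; lra.
Qed.

(** Rounding [5 a / 6] down to [s] costs only [O(1 / a)]: the integrand vanishes at [5/6], so it is
    [O(1 / a)] on an interval of length at most [1 / a]. *)
Lemma J_to_five_sixths_le (a s : nat) : (0 < s)%N -> s%:R <= 5 / 6 * a%:R :> R -> 5 / 6 * a%:R < s.+1%:R :> R ->
  a%:R * J (s%:R / a%:R) (5 / 6) <= 30 / a%:R :> R.
Proof.
move=> s0 sa sa1; have sr : (1 : R) <= s%:R by rewrite ler1n.
have a0 : (0 : R) < a%:R by lra.
have x0 : 0 < s%:R / a%:R :> R by rewrite divr_gt0//; lra.
have x1 : s%:R / a%:R <= 5 / 6 :> R by rewrite ler_pdivrMr.
have i0 : 0 < a%:R^-1 :> R by rewrite invr_gt0.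
have x2 : 5 / 6 - a%:R^-1 <= s%:R / a%:R :> R.
  rewrite lerBlDr -[X in _ + X]mul1r -mulrDl ler_pdivlMr// natr1; exact: ltW.
have c : `|ctg (5 / 6 : R)| <= (5 / 6 * (1 / 6))^-1 by apply: norm_ctg_le_box; lra.
have cE : (5 / 6 * (1 / 6))^-1 = 36 / 5 :> R by field.
have p0 := pi_gt3 R; have p1 := pi_lt4 R.
have z01 : 0 < (5 / 6 : R) < 1 by clear; apply/andP; split; lra.
have ft (t : R) : s%:R / a%:R <= t <= 5 / 6 -> lsin t <= 30 / a%:R.
  move=> /andP[t0 t1]; have t01 : 0 < t < 1.
    by rewrite (lt_le_trans x0 t0) (le_lt_trans t1)//; case/andP: z01.
  have := lsin_tangent z01 t01.
  rewrite lsin_five_sixths subr0 => h; apply: le_trans h _.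
  apply: le_trans (ler_norm _) _; rewrite normrM (normrM pi) [`|pi|]gtr0_norm; last lra.
  apply: (@le_trans _ _ (4 * (36 / 5) * a%:R^-1)); last by rewrite ler_pM2r//; lra.
  have c1 : pi * `|ctg (5 / 6)| <= 4 * (36 / 5) :> R.
    by rewrite -cE; exact: ler_pM (pi_ge0 R) (normr_ge0 _) (ltW p1) c.
  apply: ler_pM => //; first by rewrite mulr_ge0//; lra.
  by rewrite ler_norml; apply/andP; split; lra.
have := J_le_cst x0 x1 ltac:(lra) ft => h.
apply: (@le_trans _ _ (a%:R * (30 / a%:R * (5 / 6 - s%:R / a%:R)))); first by rewrite ler_pM2l.
have -> : a%:R * (30 / a%:R * (5 / 6 - s%:R / a%:R)) = 30 * (5 / 6 - s%:R / a%:R) :> R.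
  by field; rewrite gt_eqF.
by apply: ler_wpM2l => //; lra.
Qed.

Definition mainterm (a b s : nat) : R := a%:R * oint (b%:R / a%:R) (s%:R / a%:R) (@lsin R).

Lemma mainterm_le (a b s : nat) : (0 < a)%N -> (b <= s)%N -> mainterm a b s = a%:R * J (b%:R / a%:R) (s%:R / a%:R).
Proof. by move=> a0 bs; rewrite /mainterm /oint ler_pM2r ?invr_gt0 ?ltr0n// ler_nat bs. Qed.

Lemma mainterm_gt (a b s : nat) : (0 < a)%N -> (s < b)%N -> mainterm a b s = - (a%:R * J (s%:R / a%:R) (b%:R / a%:R)).
Proof. by move=> a0 sb; rewrite /mainterm /oint ler_pM2r ?invr_gt0 ?ltr0n// ler_nat leqNgt sb /= mulrN. Qed.

Lemma kappa_lt1 : kappa R < 1.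
Proof. by rewrite /kappa; clear; lra. Qed.

Lemma kappa_le : kappa R <= 1 / 4.
Proof. by rewrite /kappa; clear; lra. Qed.

Lemma frac99_lt1 : 99 / 100 < 1 :> R.
Proof. by lra. Qed.

Lemma low_of_high (a b : R) : 0 < a -> 99 / 100 * a < b -> 1 / 100 * a < b.
Proof. by lra. Qed.

Lemma le10_of_bounds (a s : R) : s <= 5 / 6 * a -> 99 / 100 * a < s + 1 -> a <= 10.
Proof. by lra. Qed.

Lemma dist_five_sixths_le (a b s : R) : b <= a -> 5 / 6 * a < s + 1 -> b - s <= 1 / 6 * a + 1.
Proof. by lra. Qed.

Lemma le_twice_of_five_sixths (a s i : R) : 0 < a -> 5 / 6 * a < s -> s <= i -> a <= 2 * i.
Proof. by lra. Qed.

Lemma half_le_ln2 : 1 / 2 <= ln 2 :> R.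
Proof.
have := @le_ln1Dx R (- (1 / 2)) ltac:(lra).
have -> : 1 + - (1 / 2) = 2^-1 :> R by field.
by rewrite lnV ?posrE//; lra.
Qed.

Lemma mainterm_ge_aux (k ky2 ky ki y2 y i d j1 j2 : R) :
  j1 <= 30 * i -> j2 <= - (5 / 2) * y2 -> k <= ky2 + 2 * ky + ki -> ky2 <= y2 -> ky <= y -> ki <= i ->
  i <= d -> 0 <= d -> y <= d -> 0 <= y2 -> k - 40 * d <= - j1 - j2.
Proof. by move=> *; lra. Qed.

Lemma digit_sum_lower_aux (k h s1 s2 t e1 e2 d j1 j2 y2 Cd : R) :
  h <= 2 * Cd -> s1 - (j1 + j2) <= h + e1 -> s2 <= t -> t <= Cd + e2 -> j1 <= 30 * d ->
  j2 <= - (5 / 2) * y2 -> k <= 5 / 2 * y2 + 10 * d -> 0 <= Cd -> 0 <= d ->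
  k - (100 * Cd + 100 * d) - (e1 + e2) <= - (s1 + s2).
Proof. by move=> *; lra. Qed.

(** For digits above [0.99 a] the integral is available only up to [0.99]. The curvature [5 / 2] on
    the truncated range [y >= 0.13] still beats [kappa] on the full range [del <= 0.19] once
    [a > 50]; for smaller [a] the linear term suffices. *)
Lemma kappa_sqr_le (a del y : R) : 2 <= a -> 0 <= del -> 0 <= y -> del <= 1 / 6 + a^-1 ->
  99 / 100 - a^-1 - 5 / 6 <= y -> a * (kappa R * (del * del)) <= 5 / 2 * (a * y ^+ 2) + 10 * del.
Proof.
move=> a2 d0 y0 del1 y1; have k0 := kappa_gt0 R; have k1 := kappa_le.
have a0 : 0 < a by lra.
have yy : 0 <= y ^+ 2 by rewrite exprn_ge0.
have [a50|a50] := leP a 50.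
  have i2 : a^-1 <= 1 / 2 :> R by rewrite div1r lef_pV2 ?posrE.
  have d23 : del <= 2 / 3 by lra.
  apply: (@le_trans _ _ (10 * del)); last by rewrite lerDr mulr_ge0// mulr_ge0// ltW.
  rewrite !mulrA; apply: ler_wpM2r => //.
  apply: (@le_trans _ _ (50 * (1 / 4) * (2 / 3))); last lra.
  by apply: ler_pM3 => //; exact: ltW.
have i50 : a^-1 <= 1 / 50 :> R by rewrite div1r lef_pV2 ?posrE// ltW.
apply: (@le_trans _ _ (5 / 2 * (a * y ^+ 2))); last by rewrite lerDl mulr_ge0.
rewrite [5 / 2 * _]mulrCA ler_pM2l//.
have d19 : del <= 19 / 100 by lra.
have y13 : 13 / 100 <= y by lra.
have dd := ler_pM d0 d0 d19 d19.
have n13 : 0 <= 13 / 100 :> R by exact: divr_ge0 (ler0n R 13) (ler0n R 100).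
have yy2 : 13 / 100 * (13 / 100) <= y ^+ 2 by rewrite expr2; exact: (ler_pM n13 n13 y13 y13).
apply: (@le_trans _ _ (1 / 4 * (19 / 100 * (19 / 100)))); last by lra.
by apply: ler_pM => //; rewrite ?(ltW k0) ?mulr_ge0.
Qed.

Section Digit.
Variables (a s : nat).
Hypothesis a_gt0 : (0 < a)%N.
Hypothesis s_le : s%:R <= 5 / 6 * a%:R :> R.
Hypothesis s_gt : 5 / 6 * a%:R < s.+1%:R :> R.

Let ar : (0 : R) < a%:R. Proof. by rewrite ltr0n. Qed.
Let ar1 : (1 : R) <= a%:R. Proof. by rewrite ler1n. Qed.

Let s_gt0 : (1 < a)%N -> (0 < s)%N.
Proof.
move=> a2; rewrite lt0n; apply/eqP => s0; move: s_gt; rewrite s0.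
have : (2 : R) <= a%:R by rewrite ler_nat.
lra.
Qed.

Let s_nat : (6 * s <= 5 * a)%N /\ (5 * a < 6 * s.+1)%N.
Proof.
split; first by rewrite -(ler_nat R) !natrM; have := s_le; lra.
by rewrite -(ltr_nat R) !natrM; have := s_gt; lra.
Qed.

(** [J_left_ge] and [J_right_le] are centred at [5/6], not at [s / a]. Moving the centre costs
    [O(1 / a)], which is charged to [|b - s| / a] since [|b - s| >= 1] unless [b = s]. *)
Lemma mainterm_ge (b : nat) : b%:R <= 99 / 100 * a%:R :> R ->
  kappa R * (b%:R - s%:R) ^+ 2 / a%:R - 40 * (`|b%:R - s%:R| / a%:R) <= mainterm a b s.
Proof.
move=> ba; have a0 := ar; have k0 := kappa_gt0 R.
have k1 := ltW kappa_lt1.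
have i0 : 0 < a%:R^-1 :> R by rewrite invr_gt0.
have [e|ne] := eqVneq b s.
  by rewrite e mainterm_le// J_refl !subrr normr0 expr0n /= !(mulr0, mul0r) subr0.
have a2 : (1 < a)%N.
  rewrite ltn_neqAle a_gt0 andbT eq_sym; apply/eqP => a1; move: ne ba s_le; rewrite a1 => ne ba sl.
  have b0 : (b < 1)%N by rewrite -(ltr_nat R); lra.
  have s0 : (s < 1)%N by rewrite -(ltr_nat R); lra.
  by move: ne; rewrite ltnS leqn0 in b0; rewrite ltnS leqn0 in s0; rewrite (eqP b0) (eqP s0).
have s0 := s_gt0 a2.
have J56 := J_to_five_sixths_le s0 s_le s_gt.
have sx : s%:R / a%:R <= 5 / 6 :> R by rewrite ler_pdivrMr.
have sx0 : 0 <= s%:R / a%:R :> R by rewrite divr_ge0.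
have bx0 : 0 <= b%:R / a%:R :> R by rewrite divr_ge0.
have bx1 : b%:R / a%:R <= 99 / 100 :> R by rewrite ler_pdivrMr.
have kk x y : 0 <= x -> x <= y -> kappa R * x ^+ 2 <= kappa R * y ^+ 2.
  by move=> x0 xy; rewrite ler_pM2l// lerXn2r// nnegrE// (le_trans x0).
have [bs|sb] := leqP b s.
  have bs' : (b < s)%N by rewrite ltn_neqAle ne.
  have bsr : b%:R + 1 <= s%:R :> R by rewrite natr1 ler_nat.
  rewrite mainterm_le// ler0_norm; last lra.
  have x1 : b%:R / a%:R <= s%:R / a%:R :> R by rewrite ler_pM2r// ler_nat.
  rewrite (_ : J (b%:R / a%:R) (s%:R / a%:R) = J (b%:R / a%:R) (5 / 6) - J (s%:R / a%:R) (5 / 6)); last first.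
    by rewrite -(@J_add R (b%:R / a%:R) (s%:R / a%:R) (5 / 6))//; [rewrite addrK|lra].
  have low := @J_left_ge R (b%:R / a%:R) ltac:(rewrite bx0 /=; lra).
  have := kk (s%:R / a%:R - b%:R / a%:R) (5 / 6 - b%:R / a%:R) ltac:(by rewrite subr_ge0) ltac:(by rewrite lerD2r).
  move=> kk'; have {kk' low} : a%:R * (kappa R * (s%:R / a%:R - b%:R / a%:R) ^+ 2) <= a%:R * J (b%:R / a%:R) (5 / 6).
    by rewrite ler_pM2l//; lra.
  rewrite (_ : a%:R * (kappa R * _) = kappa R * (b%:R - s%:R) ^+ 2 / a%:R); last by field; rewrite gt_eqF.
  have : 30 / a%:R <= 30 * ((s%:R - b%:R) / a%:R) :> R by apply: ler_wpM2l => //; rewrite -[leLHS]mul1r ler_pM2r//; lra.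
  have : 0 <= (s%:R - b%:R) / a%:R :> R by rewrite divr_ge0// subr_ge0 ler_nat.
  rewrite opprB mulrBr => l1 l2 l3.
  by clear k0 k1 i0 a0 sx sx0 bx0 bx1 kk x1 bsr; lra.
have sbr : s%:R + 1 <= b%:R :> R by rewrite natr1 ler_nat.
have b56 : 5 / 6 <= b%:R / a%:R :> R by rewrite ler_pdivlMr//; have := s_gt; rewrite -natr1; lra.
rewrite mainterm_gt// ger0_norm; last lra.
rewrite -(@J_add R (s%:R / a%:R) (5 / 6) (b%:R / a%:R))//; last lra.
have up := @J_right_le R (b%:R / a%:R) b56 ltac:(lra).
set y := b%:R / a%:R - 5 / 6 in up.
have y0 : 0 <= y by rewrite /y; lra.
have yi : b%:R / a%:R - s%:R / a%:R <= y + a%:R^-1.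
  rewrite /y; have : 5 / 6 <= s.+1%:R / a%:R :> R by rewrite ler_pdivlMr//; exact: ltW.
  by rewrite -natr1 mulrDl mul1r; lra.
have ydel : y <= (b%:R - s%:R) / a%:R by rewrite /y mulrBl; lra.
have key : kappa R * (b%:R - s%:R) ^+ 2 / a%:R <= a%:R * (kappa R * (y + a%:R^-1) ^+ 2).
  have -> : kappa R * (b%:R - s%:R) ^+ 2 / a%:R = a%:R * (kappa R * (b%:R / a%:R - s%:R / a%:R) ^+ 2) by field; rewrite gt_eqF.
  rewrite ler_pM2l//; apply: kk => //; rewrite subr_ge0 ler_pM2r// ler_nat; exact: ltnW.
have exp : a%:R * (kappa R * (y + a%:R^-1) ^+ 2) = kappa R * (a%:R * y ^+ 2) + 2 * (kappa R * y) + kappa R * a%:R^-1.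
  by field; rewrite gt_eqF.
have up2 : a%:R * J (5 / 6) (b%:R / a%:R) <= a%:R * (- (5 / 2) * y ^+ 2) by rewrite ler_pM2l.
have k2 : kappa R * (a%:R * y ^+ 2) <= 1 * (a%:R * y ^+ 2) by rewrite ler_wpM2r// mulr_ge0 ?exprn_ge0// ltW.
have k3 : kappa R * y <= 1 * y by rewrite ler_wpM2r.
have k4 : kappa R * a%:R^-1 <= 1 * a%:R^-1 by rewrite ler_wpM2r// ltW.
have k5 : a%:R^-1 <= (b%:R - s%:R) / a%:R :> R by rewrite -[leLHS]mul1r ler_pM2r// lerBrDl.
have k6 : 0 <= a%:R * y ^+ 2 by rewrite mulr_ge0 ?exprn_ge0// ltW.
rewrite mulrDr opprD; move: J56 key; rewrite exp.
rewrite mulrCA in up2 => J1 K1.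
apply: (@mainterm_ge_aux _ (kappa R * (a%:R * y ^+ 2)) (kappa R * y) (kappa R / a%:R) (a%:R * y ^+ 2) y a%:R^-1) => //.
- by rewrite -[leRHS]mul1r.
- by rewrite -[leRHS]mul1r.
- by rewrite -[leRHS]mul1r.
- by apply: le_trans k5; exact: ltW.
Qed.

(** [Blk b] will be the sum over the [b]-th block, [C / (b + 1)] its distance from the integral over
    a cell, [E] the cotangent error. Beyond [0.99 a] only an upper bound is assumed: those blocks
    enter [digit_sum] with a minus sign, so it yields the lower bound needed for (i). *)
Variables (Blk : nat -> R) (C E : R).
Hypothesis C_ge1 : 1 <= C.
Hypothesis Blk_near : forall b : nat, b.+1%:R <= 99 / 100 * a%:R :> R ->
  `|Blk b - a%:R * J (b%:R / a%:R) (b.+1%:R / a%:R)| <= C / b.+1%:R + E.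
Hypothesis Blk_le : forall b : nat, (b.+1 <= a)%N -> 99 / 100 * a%:R < b.+1%:R :> R ->
  Blk b <= C / a%:R + E.

Definition digit_sum (b : nat) : R := \sum_(0 <= i < s) Blk i - \sum_(0 <= i < b) Blk i.

Lemma digit_sum_le (b : nat) : (b <= s)%N -> digit_sum b = \sum_(b <= i < s) Blk i.
Proof. by move=> bs; rewrite /digit_sum (big_cat_nat _ (n := b))//= addrAC subrr add0r. Qed.

Lemma digit_sum_ge (b : nat) : (s <= b)%N -> digit_sum b = - \sum_(s <= i < b) Blk i.
Proof. by move=> sb; rewrite /digit_sum [X in _ - X](big_cat_nat _ (n := s))//= opprD addrA subrr add0r. Qed.

Lemma sum_cells_near m n : (m <= n)%N -> (0 < n)%N -> n%:R <= 99 / 100 * a%:R :> R ->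
  `|\sum_(m <= i < n) Blk i - a%:R * J (m%:R / a%:R) (n%:R / a%:R)|
    <= C * \sum_(m <= i < n) i.+1%:R^-1 + (n%:R - m%:R) * E.
Proof.
move=> mn n0 na; have na' : (n < a)%N by rewrite -(ltr_nat R); have := ar; lra.
rewrite J_sum// mulr_sumr -sumrB mulr_sumr.
have -> : (n%:R - m%:R) * E = \sum_(m <= i < n) E.
  by rewrite sumr_const_nat -[RHS]mulr_natr natrB// mulrC.
rewrite -big_split /=; apply: le_trans (ler_norm_sum _ _ _) _.
apply: ler_sum_nat => i /andP[_ iN].
by apply: Blk_near; apply: le_trans na; rewrite ler_nat.
Qed.

Definition low_log (b : nat) : R := if b%:R <= 1 / 100 * a%:R :> R then ln a%:R else 0.

Lemma low_log_ge0 b : 0 <= low_log b.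
Proof. by rewrite /low_log; case: ifP => // _; apply: ln_ge0. Qed.

(** The cell errors form a harmonic sum between [b] and [s]. It is [O(|b - s| / a)] if both ends are
    of order [a], and [O(ln a)] if [b] is small; this is the origin of the indicator in (ii). *)
Lemma digit_sum_near b : b%:R <= 99 / 100 * a%:R :> R ->
  `|digit_sum b - mainterm a b s| <= 100 * C * (`|b%:R - s%:R| / a%:R + low_log b) + `|b%:R - s%:R| * E.
Proof.
move=> ba; have a0 := ar; have i0 : 0 < a%:R^-1 :> R by rewrite invr_gt0.
have C1 := C_ge1.
have [bs|sb] := leqP b s.
  have [e|ne] := eqVneq b s.
    rewrite e digit_sum_le// big_geq// mainterm_le// J_refl mulr0 !subrr normr0 !mul0r addr0 add0r.
    by rewrite mulr_ge0 ?low_log_ge0 ?mulr_ge0// (le_trans ler01 C1).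
  have bs' : (b < s)%N by rewrite ltn_neqAle ne.
  have s0 : (0 < s)%N by exact: leq_ltn_trans bs'.
  have a2 : 2 <= a%:R :> R.
    rewrite ler_nat ltnNge; apply/negP => a1.
    have e1 : a%:R = 1 :> R by rewrite (_ : a = 1)%N//; apply/eqP; rewrite eqn_leq a1 a_gt0.
    have : (1 : R) <= s%:R by rewrite ler1n.
    by move: s_le; rewrite e1; lra.
  have sa : s%:R <= 99 / 100 * a%:R :> R by move: s_le; lra.
  rewrite digit_sum_le// mainterm_le//; apply: le_trans (sum_cells_near bs s0 sa) _.
  have sbr : 0 <= s%:R - b%:R :> R by rewrite subr_ge0 ler_nat.
  rewrite distrC (ger0_norm sbr) lerD2r.
  rewrite -mulrA [100 * (C * _)]mulrCA ler_pM2l; last lra.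
  have d0 : 0 <= (s%:R - b%:R) / a%:R :> R by rewrite divr_ge0// ltW.
  rewrite /low_log; case: ifPn => [_|]; last first.
    rewrite -ltNge addr0 => bl.
    have -> : 100 * ((s%:R - b%:R) / a%:R) = \sum_(b <= i < s) (100 / a%:R) :> R.
      by rewrite sumr_const_nat -[RHS]mulr_natr natrB//; ring.
    apply: ler_sum_nat => i /andP[bi _].
    have ir : (0 : R) < i.+1%:R by rewrite ltr0n.
    rewrite ler_pdivlMr// mulrC ler_pdivrMr//.
    have bi' : b%:R <= i.+1%:R :> R by rewrite ler_nat ltnW.
    by clear ba d0 sbr sa C1 i0 a0 a2; lra.
  apply: (@le_trans _ _ (1 + ln s%:R)); first exact: sum_invS_le.
  have : ln s%:R <= ln a%:R :> R by rewrite ler_ln ?posrE ?ltr0n// (le_trans s_le)//; lra.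
  have : ln 2 <= ln a%:R :> R by rewrite ler_ln ?posrE.
  have := half_le_ln2.
  by move=> l1 l2 l3; clear ba a0 i0 a2 sa sbr; lra.
have sb' := ltnW sb; have b0 : (0 < b)%N by exact: leq_ltn_trans sb.
rewrite digit_sum_ge// mainterm_gt// opprK addrC -opprB normrN distrC.
rewrite -normrN opprB.
have := sum_cells_near sb' b0 ba; rewrite distrC => h; apply: le_trans h _.
have sbr : 0 <= b%:R - s%:R :> R by rewrite subr_ge0 ler_nat.
rewrite (ger0_norm sbr) lerD2r -mulrA [100 * (C * _)]mulrCA ler_pM2l; last lra.
apply: (@le_trans _ _ (100 * ((b%:R - s%:R) / a%:R))); last by rewrite ler_pM2l// lerDl low_log_ge0.
have -> : 100 * ((b%:R - s%:R) / a%:R) = \sum_(s <= i < b) (100 / a%:R) :> R.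
  by rewrite sumr_const_nat -[RHS]mulr_natr natrB//; ring.
apply: ler_sum_nat => i /andP[bi _].
have ir : (0 : R) < i.+1%:R by rewrite ltr0n.
rewrite ler_pdivlMr// mulrC ler_pdivrMr//.
have si : s.+1%:R <= i.+1%:R :> R by rewrite ler_nat.
by have sg := s_gt; lra.
Qed.

Lemma digit_sum_lower b : (b <= a)%N ->
  kappa R * (b%:R - s%:R) ^+ 2 / a%:R - 100 * (C + 1) * (`|b%:R - s%:R| / a%:R + low_log b) - `|b%:R - s%:R| * E
    <= digit_sum b.
Proof.
move=> ba; have a0 := ar; have i0 : 0 < a%:R^-1 :> R by rewrite invr_gt0.
have C1 := C_ge1; have C0 := le_trans ler01 C1; have C0' := lt_le_trans ltr01 C1.
have l0 := low_log_ge0 b.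
have d0 : 0 <= `|b%:R - s%:R| / a%:R :> R by rewrite divr_ge0// ltW.
have [b99|b99] := leP (b%:R) (99 / 100 * a%:R : R).
  have := digit_sum_near b99; have := mainterm_ge b99; rewrite ler_norml => h1 /andP[h2 _].
  have e1 := mulr_ge0 C0 d0; have e2 := mulr_ge0 C0 l0.
  by clear ba i0 b99 C1 C0 C0'; lra.
have [n1 n2] := s_nat.
have b99n : (99 * a < 100 * b)%N by rewrite -(ltr_nat R) !natrM; lra.
(* Blocks of index below [b1] have two-sided estimates; the rest are bounded above only. *)
pose b1 := ((99 * a) %/ 100)%N.
have b1b : (b1 <= b)%N by rewrite /b1; move: b99n; clear -a; lia.
have sb1 : (s <= b1)%N by rewrite /b1; move: n1; clear -a; lia.
have b1a : (100 * b1 <= 99 * a)%N by rewrite /b1; clear -a; lia.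
have b1a2 : (99 * a < 100 * b1.+1)%N by rewrite /b1; clear -a; lia.
have sb : (s <= b)%N by exact: leq_trans b1b.
have sbr : s%:R <= b%:R :> R by rewrite ler_nat.
have b1r : b1%:R <= 99 / 100 * a%:R :> R.
  by have : (100 * b1)%:R <= (99 * a)%:R :> R; [rewrite ler_nat|rewrite !natrM; lra].
have b1r2 : 99 / 100 * a%:R < b1%:R + 1 :> R.
  by have : (99 * a)%:R < (100 * b1.+1)%:R :> R; [rewrite ltr_nat|rewrite !natrM -natr1; lra].
pose del : R := (b%:R - s%:R) / a%:R.
rewrite ger0_norm ?subr_ge0// -/del in d0 *.
have dela : b%:R - s%:R = del * a%:R by rewrite /del mulfVK ?gt_eqF.
have low0 : low_log b = 0 by rewrite /low_log ifN// -ltNge; exact: low_of_high b99.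
rewrite low0 addr0 digit_sum_ge//.
have sg : 5 / 6 * a%:R < s%:R + 1 :> R by rewrite natr1; exact: s_gt.
have sl := s_le.
have top : \sum_(b1 <= i < b) Blk i <= (b%:R - b1%:R) * (C / a%:R + E).
  have -> : (b%:R - b1%:R) * (C / a%:R + E) = \sum_(b1 <= i < b) (C / a%:R + E).
    by rewrite sumr_const_nat -[RHS]mulr_natr natrB// mulrC.
  apply: ler_sum_nat => i /andP[bi ib]; apply: Blk_le.
    exact: leq_trans ba.
  by apply: lt_le_trans b1r2 _; rewrite natr1 ler_nat ltnS.
have CE : 0 <= C / a%:R by exact: divr_ge0 C0 (ltW a0).
have top2 : (b%:R - b1%:R) * (C / a%:R + E) <= C * del + (b%:R - b1%:R) * E.
  rewrite mulrDr lerD2r mulrC -mulrA ler_pM2l//.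
  by rewrite /del mulrC ler_pM2r// lerB// ler_nat.
(* The range between [5/6] and [0.99] contains no block only for [a <= 10], where the quadratic term
   is at most linear. *)
have [e|ne] := eqVneq b1 s.
  have a6 : a%:R <= 10 :> R by apply: le10_of_bounds sl _; rewrite -e.
  have del1 : del <= 1.
    rewrite /del ler_pdivrMr// mul1r; apply: (@le_trans _ _ b%:R); last by rewrite ler_nat.
    by rewrite gerBl.
  have q : kappa R * (b%:R - s%:R) ^+ 2 / a%:R <= 10 * del.
    rewrite dela (_ : kappa R * (del * a%:R) ^+ 2 / a%:R = (kappa R * del * a%:R) * del); last by field; rewrite gt_eqF.
    apply: ler_wpM2r => //; apply: (@le_trans _ _ (1 * 1 * 10)); last by rewrite !mul1r.
    have k0 := kappa_gt0 R; have k1 := ltW kappa_lt1.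
    by apply: ler_pM3 => //; exact: ltW.
  rewrite -e; rewrite e in top2 top.
  have Cd := mulr_ge0 C0 d0.
  rewrite e; clear C0' C0 ba sb1 b1b sbr b1r b1r2 sg sl i0 a0 C1 l0 b99 low0 CE a6 del1 dela; lra.
have sb1' : (s < b1)%N by rewrite ltn_neqAle eq_sym ne.
have a2 : (1 < a)%N by move: sb1' b1a; clear -a; lia.
have s0 := s_gt0 a2.
have J56 := J_to_five_sixths_le s0 s_le s_gt.
have b10 : (0 < b1)%N by exact: leq_ltn_trans sb1'.
rewrite (big_cat_nat _ (n := b1))//=.
have := sum_cells_near sb1 b10 b1r; rewrite ler_norml => /andP[_].
have harm : C * \sum_(s <= i < b1) i.+1%:R^-1 <= 2 * C * del.
  rewrite [2 * C]mulrC -mulrA ler_pM2l//.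
  apply: (@le_trans _ _ (\sum_(s <= i < b1) (2 / a%:R))).
    apply: ler_sum_nat => i /andP[bi _].
    have ir : (0 : R) < i.+1%:R by rewrite ltr0n.
    rewrite ler_pdivlMr// mulrC ler_pdivrMr//.
    by apply: le_twice_of_five_sixths a0 s_gt _; rewrite ler_nat.
  rewrite sumr_const_nat -[leLHS]mulr_natr natrB// -mulrA ler_pM2l// /del mulrC ler_pM2r//.
  by rewrite lerB// ler_nat.
pose y : R := b1%:R / a%:R - 5 / 6.
have b1s : s%:R + 1 <= b1%:R :> R by rewrite natr1 ler_nat.
have y0 : 0 <= y by rewrite /y subr_ge0 ler_pdivlMr//; exact: le_trans (ltW sg) b1s.
have b1x : b1%:R / a%:R <= 99 / 100 :> R by rewrite ler_pdivrMr.
have sx : s%:R / a%:R <= 5 / 6 :> R by rewrite ler_pdivrMr.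
have b1x0 : 5 / 6 <= b1%:R / a%:R :> R by rewrite -subr_ge0.
have b1x1 := le_lt_trans b1x frac99_lt1.
have up := J_right_le b1x0 b1x1.
have Jsplit := J_add (divr_ge0 (ler0n R s) (ltW a0)) sx b1x0 b1x1.
have up2 : a%:R * J (5 / 6) (b1%:R / a%:R) <= - (5 / 2) * (a%:R * y ^+ 2).
  by rewrite (mulrCA (- (5 / 2))) ler_pM2l.
have ia : a%:R^-1 <= del.
  rewrite /del -[leLHS]mul1r ler_pM2r//.
  have b1b' : b1%:R <= b%:R :> R by rewrite ler_nat.
  by rewrite lerBrDl; apply: le_trans b1s b1b'.
have main : kappa R * (b%:R - s%:R) ^+ 2 / a%:R <= 5 / 2 * (a%:R * y ^+ 2) + 10 * del.
  have k0 := kappa_gt0 R; have k1 := kappa_le; have ar1' := ar1.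
  have del1 : del <= 1 / 6 + a%:R^-1.
    rewrite /del ler_pdivrMr// mulrDl mulVf ?gt_eqF//.
    by apply: dist_five_sixths_le sg; rewrite ler_nat.
  have y1 : 99 / 100 - a%:R^-1 - 5 / 6 <= y.
    rewrite /y lerD2r lerBlDr -[X in _ + X]mul1r -mulrDl ler_pdivlMr//; exact: ltW.
  rewrite dela (_ : kappa R * (del * a%:R) ^+ 2 / a%:R = a%:R * (kappa R * (del * del))); last by field; rewrite gt_eqF.
  by apply: kappa_sqr_le; rewrite // ler_nat.
rewrite -Jsplit mulrDr.
have Cd := mulr_ge0 C0 d0.
have i30 : 30 / a%:R <= 30 * del by rewrite ler_pM2l.
have -> : (b%:R - s%:R) * E = (b1%:R - s%:R) * E + (b%:R - b1%:R) * E by ring.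
move=> sc; rewrite (_ : 100 * (C + 1) * del = 100 * (C * del) + 100 * del); last by ring.
rewrite -mulrA in harm.
exact: (digit_sum_lower_aux harm sc top top2 (le_trans J56 i30) up2 main Cd d0).
Qed.

End Digit.

End LevelSums.

(** * Estimates for one block of [q] perturbed points *)

Section Blocks.
Variable R : realType.
Implicit Types x y : R.
Local Notation J := (@J R).

Lemma norm_sin_mul_le (n : nat) x : `|sin (n%:R * x)| <= n%:R * `|sin x|.
Proof.
elim: n => [|n IH]; first by rewrite !mul0r sin0 normr0.
rewrite -natr1 !mulrDl !mul1r sinD; apply: le_trans (ler_normD _ _) _.
by apply: lerD; rewrite normrM ?[`|cos _| * _]mulrC; apply: le_trans (ler_wpM2l _ (cos_max _)) _; rewrite ?mulr1.
Qed.

Lemma lsin_mul_le (n : nat) x : 0 < x < 1 -> sin (pi * (n%:R * x)) != 0 ->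
  lsin (n%:R * x) <= ln n%:R + lsin x.
Proof.
move=> x01 s0; have sx := sin_pi_gt0 x01.
have n0 : (0 < n)%N by rewrite lt0n; apply: contraNneq s0 => ->; rewrite mul0r mulr0 sin0.
have k0 : 0 < `|2 * sin (pi * (n%:R * x))| by rewrite normr_gt0 mulf_neq0.
have k1 : 0 < `|2 * sin (pi * x)| by rewrite normr_gt0 mulf_neq0// gt_eqF.
have k2 : (0 : R) < n%:R by rewrite ltr0n.
rewrite /lsin -lnM ?posrE// ler_ln ?posrE ?mulr_gt0// !(normrM 2) [leRHS]mulrCA ler_pM2l ?normr_gt0//.
rewrite (mulrCA pi); exact: norm_sin_mul_le.
Qed.

Lemma norm_ctg_sub_box x y m d : 0 < m -> 0 < d -> m <= x -> x <= 1 - d -> m <= y -> y <= 1 - d ->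
  `|ctg x - ctg y| <= 4 * `|x - y| / (m * d) ^+ 2.
Proof.
move=> m0 d0; wlog xy : x y / x <= y.
  move=> H mx xd my yd; have [xy|yx] := leP x y; first exact: H.
  by rewrite distrC [`|x - y|]distrC; apply: H => //; exact: ltW.
move=> mx xd my yd.
have x0 : 0 < x by exact: lt_le_trans mx.
have y1 : y < 1 by lra.
have p4 := pi_lt4 R; have p0 := pi_gt0 R.
rewrite ger0_norm; last by rewrite subr_ge0; exact: ctg_decr.
rewrite distrC ger0_norm ?subr_ge0//; apply: le_trans (ctg_diff_le x0 xy y1) _.
have md : 0 < m * d by rewrite mulr_gt0.
have bx : m * d <= x * (1 - x) by apply: ler_pM; try lra; exact: ltW.
have by' : m * d <= y * (1 - y) by apply: ler_pM; try lra; exact: ltW.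
apply: ler_pM.
- by rewrite mulr_ge0 ?subr_ge0// ltW.
- by rewrite invr_ge0 mulr_ge0// (le_trans (ltW md)).
- by apply: ler_wpM2r; [rewrite subr_ge0|exact: ltW].
have X0 := lt_le_trans md bx; have Y0 := lt_le_trans md by'.
rewrite expr2 lef_pV2 ?posrE ?(mulr_gt0 X0) ?(mulr_gt0 md)//.
by apply: ler_pM => //; exact: ltW.
Qed.

(** For [u = s - 1] and [v = q - s] the sum [u + v] is constant, and [1 / (u v)^2 <= 2 (1 / u^2 + 1
    / v^2) / (u + v)^2] splits the two poles. *)
Lemma sum_inv_sqr_sym_le (q : nat) : (2 <= q)%N ->
  \sum_(2 <= s < q) (((s%:R - 1) * (q%:R - s%:R)) ^+ 2)^-1 <= 32 / q%:R ^+ 2 :> R.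
Proof.
case: q => [|[|q]]// _.
have q1 : (0 : R) < q.+1%:R by rewrite ltr0n.
have qE : q.+2%:R = q.+1%:R + 1 :> R by rewrite natr1.
have qge : (1 : R) <= q.+1%:R by rewrite ler1n.
pose F (t : nat) : R := (t%:R ^+ 2)^-1.
have F1 : \sum_(2 <= s < q.+2) F s.-1 <= 2.
  rewrite big_add1 /=; exact: (@sum_inv_sqr_le R q).
have F2 : \sum_(2 <= s < q.+2) F (q.+2 - s)%N = \sum_(2 <= s < q.+2) F s.-1.
  rewrite big_nat_rev /=; apply: eq_big_nat => s /andP[s2 sq]; congr F; lia.
apply: (@le_trans _ _ (\sum_(2 <= s < q.+2) (2 / q.+1%:R ^+ 2 * (F s.-1 + F (q.+2 - s)%N)))).
  apply: ler_sum_nat => s /andP[s2 sq].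
  have e1 : s%:R - 1 = s.-1%:R :> R by rewrite -[in LHS](prednK (ltnW s2)) -natr1 addrK.
  have e2 : q.+2%:R - s%:R = (q.+2 - s)%:R :> R by rewrite natrB// ltnW.
  have e3 : q.+1%:R = s.-1%:R + (q.+2 - s)%:R :> R by rewrite -natrD; congr _%:R; lia.
  have p1 : (0 : R) < s.-1%:R by rewrite ltr0n; lia.
  have p2 : (0 : R) < (q.+2 - s)%:R by rewrite ltr0n; lia.
  rewrite e1 e2 e3 /F; move: (s.-1%:R : R) ((q.+2 - s)%:R : R) p1 p2; clear => u v u0 v0.
  have uv : 0 < u + v by rewrite addr_gt0.
  have -> : 2 / (u + v) ^+ 2 * ((u ^+ 2)^-1 + (v ^+ 2)^-1) = ((u * v) ^+ 2)^-1 * (2 * (u ^+ 2 + v ^+ 2) / (u + v) ^+ 2).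
    by field; rewrite !gt_eqF.
  rewrite -[leLHS]mulr1 ler_pM2l ?invr_gt0 ?exprn_gt0 ?mulr_gt0//.
  rewrite ler_pdivlMr ?exprn_gt0// mul1r -subr_ge0.
  have -> : 2 * (u ^+ 2 + v ^+ 2) - (u + v) ^+ 2 = (u - v) ^+ 2 by ring.
  exact: sqr_ge0.
rewrite -mulr_sumr big_split /= F2.
apply: (@le_trans _ _ (2 / q.+1%:R ^+ 2 * 4)).
  by apply: ler_wpM2l; [rewrite divr_ge0// exprn_ge0// ltW|lra].
rewrite qE; move: (q.+1%:R : R) q1 qge; clear => u u0 u1.
rewrite ler_pdivlMr ?exprn_gt0 ?addr_gt0//.
have -> : 2 / u ^+ 2 * 4 * (u + 1) ^+ 2 = 8 * ((u + 1) / u) ^+ 2 by field; rewrite gt_eqF.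
have h : (u + 1) / u <= 2 by rewrite ler_pdivrMr//; lra.
have h0 : 0 <= (u + 1) / u by rewrite divr_ge0//; lra.
have := ler_pM h0 h0 h h; rewrite expr2; lra.
Qed.

(* The slack [p] keeps both arguments between [(s - 1) / (2 q)] and [1 - (q - s) / (2 q)]. *)
Lemma lsin_perturb_le (q s w t p : R) : 1 < s -> s < q -> `|t| <= p ->
  (s - 1) / 2 <= s - w - p -> s - w + p <= (q + s) / 2 ->
  lsin ((s - w) / q) - lsin ((s - w - t) / q) <=
    pi * p / q * (t / p * ctg ((s - w) / q)) + 4 * 4 * 16 * (p ^+ 2 * q ^+ 2) * (((s - 1) * (q - s)) ^+ 2)^-1.
Proof.
move=> s1 sq tp lo hi; have q0 : 0 < q by apply: lt_trans sq; apply: lt_trans s1.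
have p0 : 0 <= p by apply: le_trans tp.
have s0 : 0 < s - 1 by rewrite subr_gt0.
have qs0 : 0 < q - s by rewrite subr_gt0.
pose m : R := (s - 1) / 2 / q; pose d : R := (q - s) / 2 / q.
have m0 : 0 < m by rewrite divr_gt0// divr_gt0.
have d0 : 0 < d by rewrite divr_gt0// divr_gt0.
have dE : 1 - d = (q + s) / 2 / q by rewrite /d; field; rewrite gt_eqF.
have mx r : `|r| <= p -> m <= (s - w - r) / q.
  move=> rp; rewrite ler_pM2r ?invr_gt0//; apply: le_trans lo _.
  by rewrite lerD2l lerN2 (le_trans (ler_norm _) rp).
have dx r : `|r| <= p -> (s - w - r) / q <= 1 - d.
  move=> rp; rewrite dE ler_pM2r ?invr_gt0//; apply: le_trans hi.
  by rewrite lerD2l (le_trans _ rp)// -normrN ler_norm.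
have n0 : `|0 : R| <= p by rewrite normr0.
have mx0 := mx _ n0; have dx0 := dx _ n0; rewrite subr0 in mx0 dx0.
have in01 z : m <= z -> z <= 1 - d -> 0 < z < 1.
  by move=> mz zd; rewrite (lt_le_trans m0 mz) (le_lt_trans zd)// gtrBl.
apply: le_trans (lsin_tangent (in01 _ (mx _ tp) (dx _ tp)) (in01 _ mx0 dx0)) _.
have cb := norm_ctg_sub_box m0 d0 (mx _ tp) (dx _ tp) mx0 dx0.
have tq : t = t / p * p.
  have [pz|pn] := eqVneq p 0; last by rewrite mulfVK.
  by move: tp; rewrite pz normr_le0 mulr0 => /eqP.
set x := (s - w) / q in mx0 dx0 cb *; set y := (s - w - t) / q in cb *.
have xy : x - y = t / q by rewrite /x /y -mulrBl opprB addrC subrK.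
have -> : pi * ctg y * (x - y) = pi * p / q * (t / p * ctg x) + pi * (t / q) * (ctg y - ctg x).
  by rewrite xy [in LHS]tq [in X in _ + X]tq; ring.
rewrite lerD2l; apply: le_trans (ler_norm _) _; rewrite normrM (normrM pi) (gtr0_norm (pi_gt0 R)).
have nxy : `|t / q| <= p / q by rewrite normrM [`|q^-1|]gtr0_norm ?invr_gt0// ler_pM2r ?invr_gt0.
have md : 0 < m * d by rewrite mulr_gt0.
have num : 4 * (p / q) * (4 * (p / q) / (m * d) ^+ 2) = 4 * 4 * 16 * (p ^+ 2 * q ^+ 2) * (((s - 1) * (q - s)) ^+ 2)^-1.
  by rewrite /m /d; field; rewrite !gt_eqF.
rewrite -num; apply: ler_pM (mulr_ge0 (pi_ge0 R) (normr_ge0 _)) (normr_ge0 _) _ _.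
  exact: ler_pM (pi_ge0 R) (normr_ge0 _) (ltW (pi_lt4 R)) nxy.
apply: le_trans cb _; rewrite distrC xy ler_wpM2r ?invr_ge0 ?sqr_ge0//.
by rewrite ler_wpM2l// ler0n.
Qed.

(** The residue 1 falls outside [lsin_perturb_le]: its distance to the zero, in units of [1 / q], is
    only known to be at least [1 / 200]. *)
Lemma lsin_first_term_le (q w t p : R) : 2 <= q -> 0 <= w -> `|t| <= p -> p <= 1 / 2 ->
  1 / 200 <= 1 - w - t -> 1 / 200 <= 1 - w ->
  `|lsin ((1 - w - t) / q) - lsin ((1 - w) / q)| <= 100 * 32 * p.
Proof.
move=> q2 w0 tp p2 lo hi; have q0 : 0 < q by apply: lt_le_trans q2.
have c0 : (0 : R) < 1 / 200 by exact: divr_gt0 ltr01 (ltr0n _ 200).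
have m0 : 0 < 1 / 200 / q by exact: divr_gt0 c0 q0.
have d0 : (0 : R) < 1 / 4 by exact: divr_gt0 ltr01 (ltr0n _ 4).
have hq : 2 * (1 - 1 / 4) <= (1 - 1 / 4) * q by rewrite mulrC ler_wpM2l// subr_ge0; lra.
have t2 : - t <= p by apply: le_trans tp; rewrite -normrN ler_norm.
have x0 : 1 / 200 / q <= (1 - w - t) / q by rewrite ler_pM2r ?invr_gt0.
have y0 : 1 / 200 / q <= (1 - w) / q by rewrite ler_pM2r ?invr_gt0.
have x1 : (1 - w - t) / q <= 1 - 1 / 4 by rewrite ler_pdivrMr//; clear -hq t2 p2 w0; lra.
have y1 : (1 - w) / q <= 1 - 1 / 4 by rewrite ler_pdivrMr//; clear -hq w0; lra.
apply: le_trans (lsin_lipschitz m0 d0 x0 x1 y0 y1) _.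
rewrite -mulrBl addrAC subrr add0r normrM normrN [`|q^-1|]gtr0_norm ?invr_gt0//.
rewrite (_ : 4 * _ / _ = 100 * 32 * `|t|); last by field; rewrite gt_eqF.
by apply: ler_wpM2l tp; exact: mulr_ge0 (ler0n _ 100) (ler0n _ 32).
Qed.

Lemma two_pi_mul_le (v c : R) : 0 <= v -> v <= c -> 2 * pi * v <= 2 * 4 * c.
Proof.
move=> v0 vc; rewrite -!mulrA ler_pM2l//.
exact: ler_pM (pi_ge0 R) v0 (ltW (pi_lt4 R)) vc.
Qed.

Lemma le_one_sub (w : R) : 1 / 100 <= 1 - w -> w <= 1 - 1 / 300.
Proof. by lra. Qed.

Lemma curv_const_le : 4 * 4 * 16 * 32 <= 100 * 82 :> R.
Proof. by lra. Qed.

Lemma sub_sub_le (x y u v w : R) : x - y <= u -> u <= v + w -> x - v - w <= y.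
Proof. by lra. Qed.

Lemma swap_first_term_le (f x y t l c u : R) : f + x + t = u -> u <= l + x -> l + y <= c -> f + y + t <= c.
Proof. by lra. Qed.

Lemma block_near_aux1 (i j : R) : 0 < i -> j <= i ->
  100 * 100 * 10 * i + 100 * 32 * j + 100 * 82 * j <= 100 * 100 * 12 * i.
Proof. by move=> *; lra. Qed.

Lemma block_near_aux2 (l f g t t' z c1 c2 c3 c4 K : R) : 0 <= c3 -> `|f - g| <= c2 -> t' <= t + z ->
  t - z - c3 <= t' -> `|K - (l + g + t)| <= c1 -> c1 + c2 + c3 <= c4 -> `|l + f + t' - K| <= c4 + z.
Proof.
rewrite !ler_norml => ? /andP[? ?] ? ? /andP[? ?] ?.
by apply/andP; split; lra.
Qed.

Section Block.
(** In units of [1 / q], [p] is the displacement from one block to the next, [B] and [G] are the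
    gaps left in [[0, 1]] by the [a] steps, and [U] is the displacement due to higher digits. The
    bounds on [U] keep the first block at least [p / 6] from [0] and the last at least [G / 6] from
    [1 - B]; [e1_le] reserves the gap [B] for the residue 1. *)
Variables (q a : nat) (p G B U Z : R) (e : nat -> R).
Hypothesis q_gt0 : (0 < q)%N.
Hypothesis a_gt0 : (0 < a)%N.
Hypothesis p_gt0 : 0 < p.
Hypothesis G_bounds : 0 < G <= p.
Hypothesis B_bounds : 0 <= B <= p.
Hypothesis U_bounds : - (5 / 6) * p <= U <= 5 / 6 * G.
Hypothesis total : a%:R * p + B + G = 1.
Hypothesis e0 : e 0%N = 0.
Hypothesis e_le1 : forall s, `|e s| <= 1.
Hypothesis e1_le : (1 < q)%N -> e 1%N * p <= B.
Hypothesis cot : forall w, 0 <= w <= q%:R^-1 ->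
  `|\sum_(2 <= s < q) e s * ctg (s%:R / q%:R - w)| <= Z * q%:R.

(** The successor is there because the integers of a block are [q (1 + e s)] above [b q] and the
    part left of it. *)
Definition block_shift (b : nat) : R := b.+1%:R * p + U.
Definition block (b : nat) : R :=
  \sum_(0 <= s < q) lsin ((s%:R - block_shift b - e s * p) / q%:R).

Let qr : (0 : R) < q%:R. Proof. by rewrite ltr0n. Qed.
Let ar : (0 : R) < a%:R. Proof. by rewrite ltr0n. Qed.
Let iq : (0 : R) < q%:R^-1. Proof. by rewrite invr_gt0 ltr0n. Qed.

Let ap_le1 : a%:R * p <= 1.
Proof. by have := total; have := B_bounds; have := G_bounds => /andP[? ?] /andP[? ?]; lra. Qed.

Let ap_ge : 1 <= (a%:R + 2) * p.
Proof. by have := total; have := B_bounds; have := G_bounds => /andP[? ?] /andP[? ?]; lra. Qed.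

Let p_le : p <= a%:R^-1.
Proof. by rewrite -[leRHS]mul1r ler_pdivlMr// mulrC. Qed.

Let p_le1 : p <= 1.
Proof.
apply: le_trans ap_le1; rewrite -[leLHS]mul1r ler_pM2r//.
by rewrite ler1n.
Qed.

Let Z_ge0 : 0 <= Z.
Proof.
have := @cot 0; rewrite lexx invr_ge0 ler0n => /(_ isT) /(le_trans (normr_ge0 _)).
by rewrite pmulr_lge0.
Qed.

Lemma block_shift_ge b : p / 6 <= block_shift b.
Proof.
have b1 : (1 : R) <= b.+1%:R by rewrite ler1n.
have h : 1 * p <= b.+1%:R * p by rewrite ler_wpM2r// ltW.
by rewrite /block_shift; move: U_bounds => /andP[? _]; lra.
Qed.

Lemma block_shift_le b : (b.+1 <= a)%N -> G / 6 <= 1 - block_shift b - B.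
Proof.
move=> ba; have b1 : b.+1%:R <= a%:R :> R by rewrite ler_nat.
have h : b.+1%:R * p <= a%:R * p by rewrite ler_wpM2r// ltW.
by rewrite /block_shift; move: U_bounds total => /andP[_ ?] ?; lra.
Qed.

Lemma block_shift_le_low b : b.+1%:R <= 99 / 100 * a%:R :> R ->
  1 / 200 <= 1 - block_shift b - B /\ 1 / 100 <= 1 - block_shift b.
Proof.
move=> ba; have h : b.+1%:R * p <= 99 / 100 * a%:R * p by rewrite ler_wpM2r// ltW.
have a2 : 2 <= a%:R :> R.
  rewrite ler_nat ltnNge; apply/negP => a1.
  have : a%:R <= 1 :> R by rewrite -[leRHS]/(1%:R) ler_nat.
  by have : (1 : R) <= b.+1%:R; [rewrite ler1n|lra].
have h2 : 2 * p <= a%:R * p by rewrite ler_wpM2r// ltW.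
rewrite /block_shift; have := total; have := B_bounds; have := G_bounds; have := U_bounds.
by move=> /andP[? ?] /andP[? ?] /andP[? ?] ?; split; lra.
Qed.

(** As [B] and [G] are at most [p], [p] differs from [1 / a] by at most [2 p / a]. Moreover
    [p >= 1 / (3 a)], and with the fraction [1 / 6] that [U] leaves this gives 18. *)
Lemma block_shift_near b : b.+1%:R <= a%:R :> R ->
  `|block_shift b - b.+1%:R / a%:R| <= 3 / a%:R /\ b.+1%:R / (18 * a%:R) <= block_shift b.
Proof.
move=> ba; have n1 : (1 : R) <= b.+1%:R by rewrite ler1n.
have a1 : (1 : R) <= a%:R by rewrite ler1n.
have U2 : `|U| <= p.
  have := U_bounds; have := G_bounds => /andP[? ?] /andP[? ?].
  by rewrite ler_norml; apply/andP; split; have := p_gt0; lra.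
have pa := p_le; have ip : 0 < a%:R^-1 :> R by rewrite invr_gt0.
have gap : 0 <= 1 - a%:R * p <= 2 * p.
  by have := total; have := B_bounds; have := G_bounds => /andP[? ?] /andP[? ?] ?; apply/andP; split; lra.
split.
  have -> : block_shift b - b.+1%:R / a%:R = U - b.+1%:R / a%:R * (1 - a%:R * p).
    by rewrite /block_shift; field; rewrite gt_eqF.
  have x1 : 0 <= (b.+1%:R / a%:R : R) <= 1 by rewrite divr_ge0//= ler_pdivrMr// mul1r.
  move: gap x1 => /andP[g0 g1] /andP[x0 x1].
  have m1 : b.+1%:R / a%:R * (1 - a%:R * p) <= 1 * (2 * p) by apply: ler_pM.
  have m0 : 0 <= b.+1%:R / a%:R * (1 - a%:R * p) by apply: mulr_ge0.
  move: U2; rewrite !ler_norml => /andP[u1 u2]; rewrite mul1r in m1.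
  by apply/andP; split; lra.
have : b.+1%:R * p / 6 <= block_shift b.
  have h : 1 * p <= b.+1%:R * p by rewrite ler_wpM2r// ltW.
  by rewrite /block_shift; move: U_bounds => /andP[? _]; lra.
apply: le_trans; have h3 : a%:R^-1 / 3 <= p.
  rewrite ler_pdivrMr// -[leLHS]mul1r ler_pdivrMr//.
  apply: le_trans ap_ge _; rewrite mulrDl.
  have : 1 * p <= a%:R * p by rewrite ler_wpM2r// ltW.
  lra.
rewrite (_ : b.+1%:R / (18 * a%:R) = b.+1%:R * (a%:R^-1 / 3) / 6); last by field; rewrite gt_eqF.
by rewrite ler_pM2r// ler_wpM2l.
Qed.

Lemma sin_block_shift_neq0 b : (b.+1 <= a)%N -> sin (pi * block_shift b) != 0.
Proof.
move=> ba; rewrite gt_eqF// sin_pi_gt0//.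
have := block_shift_ge b; have := block_shift_le ba; have := p_gt0.
by move: G_bounds B_bounds => /andP[? ?] /andP[? ?] ? ? ?; apply/andP; split; lra.
Qed.

Lemma sum_lsin_block b : (b.+1 <= a)%N ->
  \sum_(0 <= s < q) lsin ((s%:R - block_shift b) / q%:R) = lsin (block_shift b).
Proof.
move=> ba; have s0 := sin_block_shift_neq0 ba.
have E : q%:R * (block_shift b / q%:R) = block_shift b by rewrite mulrC mulfVK// gt_eqF.
rewrite big_mkord -[in RHS]E -sum_lsin// ?E//.
by apply: eq_bigr => s _; rewrite mulrBl.
Qed.

Lemma cot_block b : (b.+1 <= a)%N ->
  `|\sum_(2 <= s < q) e s * ctg ((s%:R - block_shift b) / q%:R)| <= Z * q%:R.
Proof.
move=> ba; have := @cot (block_shift b / q%:R).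
under eq_bigr do rewrite -mulrBl; apply.
rewrite divr_ge0 ?ler0n ?(le_trans _ (block_shift_ge b)) ?divr_ge0 ?(ltW p_gt0)//=.
rewrite -[leRHS]mul1r ler_pM2r//; have := block_shift_le ba.
by move: G_bounds B_bounds => /andP[? ?] /andP[? ?]; lra.
Qed.

Lemma block_cut b : \sum_(0 <= s < q) lsin ((s%:R - block_shift b) / q%:R) =
  lsin (- block_shift b / q%:R) + (if (1 < q)%N then lsin ((1 - block_shift b) / q%:R) else 0)
  + \sum_(2 <= s < q) lsin ((s%:R - block_shift b) / q%:R).
Proof.
rewrite big_ltn// sub0r; case: ltnP => [q1|q1]; last by rewrite (big_geq q1) (big_geq (leqW q1)) !addr0.
by rewrite big_ltn// addrA.
Qed.

Lemma block_cut_perturbed b : block b =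
  lsin (- block_shift b / q%:R) + (if (1 < q)%N then lsin ((1 - block_shift b - e 1%N * p) / q%:R) else 0)
  + \sum_(2 <= s < q) lsin ((s%:R - block_shift b - e s * p) / q%:R).
Proof.
rewrite /block big_ltn// sub0r e0 mul0r subr0; case: ltnP => [q1|q1]; last by rewrite (big_geq q1) (big_geq (leqW q1)) !addr0.
by rewrite big_ltn// addrA.
Qed.

Lemma norm_ep_le s : `|e s * p| <= p.
Proof. by rewrite normrM (gtr0_norm p_gt0) -[leRHS]mul1r ler_wpM2r// ltW. Qed.

Lemma point_bounds b s : (b.+1 <= a)%N -> (2 <= s)%N -> (s < q)%N ->
  0 < (s%:R - block_shift b) / q%:R < 1 /\ 0 < (s%:R - block_shift b - e s * p) / q%:R < 1.
Proof.
move=> ba s2 sq.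
have s2r : (2 : R) <= s%:R by rewrite ler_nat.
have sqr : s%:R + 1 <= q%:R :> R by rewrite natr1 ler_nat.
have w0 := block_shift_ge b; have w1 := block_shift_le ba.
have p1 := p_le1.
have := norm_ep_le s; rewrite ler_norml => /andP[ep1 ep2].
have p0 := p_gt0; have := G_bounds; have := B_bounds => /andP[? ?] /andP[? ?].
rewrite !divr_gt0//=; [|lra|lra].
by rewrite !ltr_pdivrMr// !mul1r; split; lra.
Qed.

Lemma first_point_bounds b : (b.+1 <= a)%N -> (1 < q)%N ->
  0 < (1 - block_shift b) / q%:R < 1 /\ 0 < (1 - block_shift b - e 1%N * p) / q%:R < 1.
Proof.
move=> ba q1; have q2 : (2 : R) <= q%:R by rewrite ler_nat.
have w0 := block_shift_ge b; have w1 := block_shift_le ba.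
have p1 := p_le1; have e1 := e1_le q1.
have := norm_ep_le 1; rewrite ler_norml => /andP[ep1 ep2].
have p0 := p_gt0; have := G_bounds; have := B_bounds => /andP[? ?] /andP[? ?].
rewrite !divr_gt0//=; [|lra|lra].
by rewrite !ltr_pdivrMr// !mul1r; split; lra.
Qed.

Lemma first_order_le b : (b.+1 <= a)%N ->
  `|pi * p / q%:R * (\sum_(2 <= s < q) e s * ctg ((s%:R - block_shift b) / q%:R))| <= 4 * Z / a%:R.
Proof.
move=> ba; have p0 := p_gt0; rewrite normrM.
have pp : 0 <= pi * p / q%:R := divr_ge0 (mulr_ge0 (pi_ge0 R) (ltW p0)) (ltW qr).
rewrite (ger0_norm pp); apply: le_trans (ler_wpM2l pp (cot_block ba)) _.
rewrite (_ : pi * p / q%:R * (Z * q%:R) = pi * (Z * p)); last by field; rewrite gt_eqF.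
rewrite -mulrA; apply: ler_pM (pi_ge0 R) (mulr_ge0 Z_ge0 (ltW p0)) (ltW (pi_lt4 R)) _.
by rewrite ler_wpM2l.
Qed.

(* Concavity of [log sin]: the first-order term is a cotangent sum. *)
Lemma tail_le b : (b.+1 <= a)%N ->
  \sum_(2 <= s < q) lsin ((s%:R - block_shift b - e s * p) / q%:R) <=
  \sum_(2 <= s < q) lsin ((s%:R - block_shift b) / q%:R) + 4 * Z / a%:R.
Proof.
move=> ba; rewrite -lerBlDl -sumrB.
apply: (@le_trans _ _ (\sum_(2 <= s < q) (- (pi * p / q%:R) * (e s * ctg ((s%:R - block_shift b) / q%:R))))).
  apply: ler_sum_nat => s /andP[s2 sq]; have [x01 y01] := point_bounds ba s2 sq.
  apply: le_trans (lsin_tangent x01 y01) _; rewrite le_eqVlt; apply/orP; left; apply/eqP.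
  by field; rewrite gt_eqF.
rewrite -mulr_sumr mulNr; apply: le_trans (ler_norm _) _; rewrite normrN.
exact: first_order_le.
Qed.

(** For [a >= 100] the point is so close to the zero that the logarithm is nonpositive; for
    [a < 100] it is at most 16, which is at most [1600 / a]. *)
Lemma log_top_le b v : (b.+1 <= a)%N -> 99 / 100 * a%:R < b.+1%:R :> R ->
  0 < v -> v <= 1 - block_shift b + p -> ln (2 * pi * v) <= 100 * 16 / a%:R.
Proof.
move=> ba b99 v0 v1; have p0 := p_gt0.
have pv : 0 < 2 * pi * v := mulr_gt0 (mulr_gt0 (ltr0n R 2) (pi_gt0 R)) v0.
have [a100|a100] := leP 100 (a%:R : R).
  apply: (@le_trans _ _ 0); last exact: divr_ge0 (mulr_ge0 (ler0n R 100) (ler0n R 16)) (ltW ar).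
  rewrite ln_le0//.
  have h : 99 / 100 * a%:R * p <= b.+1%:R * p by rewrite ler_wpM2r// ltW.
  have v2 : v <= 1 - (99 / 100 * (a%:R * p) - 11 / 6 * p).
    by move: v1; rewrite /block_shift; move: U_bounds => /andP[? _]; lra.
  have p100 : p <= 1 / 100.
    by apply: le_trans p_le _; rewrite div1r lef_pV2 ?posrE.
  have apg := ap_ge; rewrite mulrDl in apg.
  have v3 : v <= 1 / 20 by lra.
  apply: le_trans (two_pi_mul_le (ltW v0) v3) _; clear v3 apg p100 v2 h pv v1 b99 a100 v0; lra.
have p1 := p_le1.
have v2 : v <= 2 by have := block_shift_ge b; lra.
have : ln (2 * pi * v) <= 2 * 4 * 2.
  exact: le_trans (ltW (ln_sublinear pv)) (two_pi_mul_le (ltW v0) v2).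
move=> /le_trans; apply; rewrite ler_pdivlMr// mulrC.
have -> : 2 * 4 * 2 = 16 :> R by rewrite -!natrM.
by rewrite ler_pM2r ?ltr0n// ltW.
Qed.

(** Near the top the residue 1 approaches the zero and has no two-sided control, so its term is
    exchanged: the unperturbed one cancels against the product formula through
    [|sin (q x)| <= q |sin x|], and the perturbed one, with the freed [ln q], is bounded by
    [log_top_le]. *)
Lemma block_le b : (b.+1 <= a)%N -> 99 / 100 * a%:R < b.+1%:R :> R ->
  block b <= 100 * 16 / a%:R + 4 * Z / a%:R.
Proof.
move=> ba b99; rewrite block_cut_perturbed.
have t := tail_le ba; have p0 := p_gt0.
have w0 := block_shift_ge b; have w1 := block_shift_le ba.
have := G_bounds; have := B_bounds => /andP[B0 _] /andP[G0 _].
have W1 : 0 < 1 - block_shift b by lra.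
apply: le_trans (lerD (lexx _) t) _; rewrite addrA lerD2r.
have cut := block_cut b; rewrite sum_lsin_block// in cut.
have key : lsin (- block_shift b / q%:R) + (if (1 < q)%N then lsin ((1 - block_shift b) / q%:R) else 0)
  + \sum_(2 <= s < q) lsin ((s%:R - block_shift b) / q%:R) = lsin (block_shift b) by [].
have s0 := sin_block_shift_neq0 ba.
case: ltnP key => q1 key; last first.
  rewrite key -lsin1B; apply: le_trans (lsin_le_ln _) _; first by rewrite sin_pi1B.
  by rewrite gtr0_norm//; apply: (@log_top_le b) => //; lra.
set x := (1 - block_shift b) / q%:R in key *.
set y := (1 - block_shift b - e 1%N * p) / q%:R.
have [x01 y01] := first_point_bounds ba q1; rewrite -/x -/y in x01 y01.
have qx : q%:R * x = 1 - block_shift b by rewrite mulrC mulfVK// gt_eqF.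
have qy : q%:R * y = 1 - block_shift b - e 1%N * p by rewrite mulrC mulfVK// gt_eqF.
have lx : lsin (block_shift b) <= ln q%:R + lsin x.
  rewrite -lsin1B -qx; apply: lsin_mul_le => //.
  by rewrite qx sin_pi1B.
have ly : ln q%:R + lsin y <= 100 * 16 / a%:R.
  have sy : sin (pi * y) != 0 by rewrite gt_eqF// sin_pi_gt0.
  apply: le_trans (lerD (lexx _) (lsin_le_ln sy)) _.
  move: y01 => /andP[y0 _].
  have pp := pi_gt0 R; have p2 : 0 < 2 * pi * y by rewrite mulr_gt0// mulr_gt0.
  rewrite (gtr0_norm y0) -lnM ?posrE//.
  have -> : q%:R * (2 * pi * y) = 2 * pi * (q%:R * y) by ring.
  apply: (@log_top_le b) => //; first exact: mulr_gt0.
  rewrite qy lerD2l; apply: le_trans (norm_ep_le 1); rewrite -normrN; exact: ler_norm.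
exact: swap_first_term_le key lx ly.
Qed.

(** The reverse of [tail_le] pays for curvature: a multiple of [p^2 q^2] times the sum in
    [sum_inv_sqr_sym_le], hence [O(p^2)], which is below [O(1 / a)]. *)
Lemma tail_ge b : b.+1%:R <= 99 / 100 * a%:R :> R ->
  \sum_(2 <= s < q) lsin ((s%:R - block_shift b) / q%:R) - 4 * Z / a%:R - 100 * 82 / a%:R <=
  \sum_(2 <= s < q) lsin ((s%:R - block_shift b - e s * p) / q%:R).
Proof.
move=> b99; have p0 := p_gt0; have a0 := ar.
have ba : (b.+1 <= a)%N by rewrite -(ler_nat R); lra.
have a2 : 2 <= a%:R :> R.
  rewrite ler_nat ltnNge; apply/negP => a1.
  have : a%:R <= 1 :> R by rewrite -[leRHS]/(1%:R) ler_nat.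
  by have : (1 : R) <= b.+1%:R; [rewrite ler1n|lra].
have p12 : p <= 1 / 2.
  by apply: le_trans p_le _; rewrite div1r lef_pV2 ?posrE.
have w0 := block_shift_ge b; have := block_shift_le ba.
have := G_bounds; have := B_bounds => /andP[B0 _] /andP[G0 _] w1.
pose F s : R := (((s%:R - 1) * (q%:R - s%:R)) ^+ 2)^-1.
pose c s := ctg ((s%:R - block_shift b) / q%:R).
have [q1|q2] := leqP q 1.
  have z1 : 0 <= 4 * Z / a%:R := divr_ge0 (mulr_ge0 (ler0n R 4) Z_ge0) (ltW ar).
  have z2 : 0 <= 100 * 82 / a%:R :> R := divr_ge0 (mulr_ge0 (ler0n R 100) (ler0n R 82)) (ltW ar).
  by rewrite (big_geq (leqW q1)) (big_geq (leqW q1)) sub0r subr_le0; apply: le_trans z2; rewrite oppr_le0.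
have term s : (2 <= s < q)%N -> lsin ((s%:R - block_shift b) / q%:R) - lsin ((s%:R - block_shift b - e s * p) / q%:R)
    <= pi * p / q%:R * (e s * c s) + 4 * 4 * 16 * (p ^+ 2 * q%:R ^+ 2) * F s.
  move=> /andP[s2 sq].
  have s2r : (2 : R) <= s%:R by rewrite ler_nat.
  have sqr : s%:R + 1 <= q%:R :> R by rewrite natr1 ler_nat.
  rewrite -[X in X * c s](mulfK (lt0r_neq0 p0)).
  apply: lsin_perturb_le; first by rewrite ltr1n.
  - by rewrite ltr_nat.
  - exact: norm_ep_le.
  - lra.
  - lra.
have tot : \sum_(2 <= s < q) lsin ((s%:R - block_shift b) / q%:R)
  - \sum_(2 <= s < q) lsin ((s%:R - block_shift b - e s * p) / q%:R)
    <= pi * p / q%:R * (\sum_(2 <= s < q) e s * c s) + 4 * 4 * 16 * (p ^+ 2 * q%:R ^+ 2) * \sum_(2 <= s < q) F s.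
  rewrite -sumrB !mulr_sumr -big_split /=; exact: ler_sum_nat.
have c1 := le_trans (ler_norm _) (first_order_le ba).
have num : 0 <= 4 * 4 * 16 :> R by rewrite -!natrM ler0n.
have c2 : 4 * 4 * 16 * (p ^+ 2 * q%:R ^+ 2) * \sum_(2 <= s < q) F s <= 100 * 82 / a%:R.
  apply: le_trans (ler_wpM2l (mulr_ge0 num (mulr_ge0 (sqr_ge0 _) (sqr_ge0 _))) (sum_inv_sqr_sym_le q2)) _.
  rewrite (_ : 4 * 4 * 16 * _ * _ = 4 * 4 * 16 * 32 * (p * p)); last by field; rewrite gt_eqF.
  apply: ler_pM (mulr_ge0 num (ler0n R 32)) (mulr_ge0 (ltW p0) (ltW p0)) curv_const_le _.
  by apply: le_trans p_le; rewrite -[leRHS]mulr1 ler_wpM2l// ltW.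
exact: sub_sub_le tot (lerD c1 c2).
Qed.

Lemma block_near b : b.+1%:R <= 99 / 100 * a%:R :> R ->
  `|block b - a%:R * J (b%:R / a%:R) (b.+1%:R / a%:R)| <= 100 * 100 * 12 / b.+1%:R + 4 * Z / a%:R.
Proof.
move=> b99; have p0 := p_gt0; have a0 := ar.
have ba : (b.+1 <= a)%N by rewrite -(ler_nat R); lra.
have bar : b.+1%:R <= a%:R :> R by rewrite ler_nat.
have a2 : (2 <= a)%N.
  rewrite ltnNge; apply/negP => a1.
  have : a%:R <= 1 :> R by rewrite -[leRHS]/(1%:R) ler_nat.
  by have : (1 : R) <= b.+1%:R; [rewrite ler1n|lra].
have [lowB low] := block_shift_le_low b99; have [nearW geW] := block_shift_near bar.
have cell := cell_le a2 b99 nearW geW (le_one_sub low).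
have ib : 0 < b.+1%:R^-1 :> R by rewrite invr_gt0 ltr0n.
have iab : a%:R^-1 <= b.+1%:R^-1 :> R by rewrite lef_pV2 ?posrE.
have up := tail_le ba; have dn := tail_ge b99.
have cut := block_cut b; rewrite sum_lsin_block// in cut.
have cutp := block_cut_perturbed b.
have first_term : `|(if (1 < q)%N then lsin ((1 - block_shift b - e 1%N * p) / q%:R) else 0) -
    (if (1 < q)%N then lsin ((1 - block_shift b) / q%:R) else 0)| <= 100 * 32 / a%:R.
  case: ifP => q1; last first.
    rewrite subrr normr0; exact: divr_ge0 (mulr_ge0 (ler0n R 100) (ler0n R 32)) (ltW ar).
  have p12 : p <= 1 / 2.
    by apply: le_trans p_le _; rewrite div1r lef_pV2 ?posrE// ler_nat.
  have w0 : 0 <= block_shift b by apply: le_trans (block_shift_ge b); exact: divr_ge0 (ltW p0) (ler0n R 6).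
  have q2 : (2 : R) <= q%:R by rewrite ler_nat.
  have lo : 1 / 200 <= 1 - block_shift b - e 1%N * p.
    by apply: le_trans lowB _; rewrite lerD2l lerN2 e1_le.
  have hi : 1 / 200 <= 1 - block_shift b by apply: le_trans lowB _; rewrite gerBl; case/andP: B_bounds.
  apply: le_trans (lsin_first_term_le q2 w0 (norm_ep_le 1) p12 lo hi) _.
  by apply: ler_wpM2l p_le; exact: mulr_ge0 (ler0n R 100) (ler0n R 32).
have h : 100 * 100 * 10 / b.+1%:R + 100 * 32 / a%:R + 100 * 82 / a%:R <= 100 * 100 * 12 / b.+1%:R :> R.
  exact: block_near_aux1.
rewrite cut in cell; rewrite cutp; apply: (block_near_aux2 _ first_term up dn cell h).
exact: divr_ge0 (mulr_ge0 (ler0n R 100) (ler0n R 82)) (ltW ar).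
Qed.

(** Every point stays at least [G / (6 q)] away from the integers. The bound is crude but
    independent of the digits; it serves the finitely many levels counted in [O_alpha(1)]. *)
Lemma block_abs_le b : (b.+1 <= a)%N ->
  `|block b| <= q%:R * (2 + `|ln ((G / (6 * q%:R)) ^+ 2)|).
Proof.
move=> ba; set c := G / (6 * q%:R); have p0 := p_gt0.
have := G_bounds => /andP[G0 Gp]; have := B_bounds => /andP[B0 _].
have c0 : 0 < c by rewrite /c divr_gt0// mulr_gt0.
have cE : c = G / 6 / q%:R by rewrite /c invfM mulrA.
have w0 := block_shift_ge b; have w1 := block_shift_le ba; have p1 := p_le1.
have bound x : c <= x -> x <= 1 - c -> `|lsin x| <= 2 + `|ln (c ^+ 2)|.
  move=> cx xc; have x01 : 0 < x < 1 by apply/andP; split; lra.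
  have up := lsin_le_ln2 x; have l2 := ln2_le1 R.
  have l20 : 0 <= ln 2 :> R by apply: ln_ge0; rewrite ler1n.
  have lo : ln (c ^+ 2) <= lsin x.
    have xx : x * (1 - x) <= sin (pi * x) by apply: sin_pi_ge_xx; apply/andP; split; lra.
    rewrite lsinE// -[leLHS]add0r lerD// ler_ln ?posrE ?exprn_gt0 ?sin_pi_gt0//.
    apply: le_trans xx; rewrite expr2; apply: ler_pM; try exact: ltW; lra.
  have n0 := ler_norm (- ln (c ^+ 2)); rewrite normrN in n0.
  by rewrite ler_norml; apply/andP; split; lra.
have -> : q%:R * (2 + `|ln (c ^+ 2)|) = \sum_(0 <= s < q) (2 + `|ln (c ^+ 2)|).
  by rewrite sumr_const_nat subn0 -[RHS]mulr_natr mulrC.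
apply: le_trans (ler_norm_sum _ _ _) _; apply: ler_sum_nat => s /andP[_ sq].
have q1 : (1 : R) <= q%:R by rewrite ler1n.
have oneE : 1 - c = (q%:R - G / 6) / q%:R by rewrite cE; field; rewrite gt_eqF.
have sqr : s%:R + 1 <= q%:R :> R by rewrite natr1 ler_nat.
case: s sq sqr => [|s] sq sqr.
  rewrite e0 mul0r subr0 sub0r mulNr lsinN; apply: bound.
    by rewrite cE ler_pM2r//; lra.
  by rewrite oneE ler_pM2r//; lra.
have := norm_ep_le s.+1; rewrite ler_norml => /andP[ep1 ep2].
case: s sq sqr ep1 ep2 => [|s] sq sqr ep1 ep2.
  have e1 := e1_le sq.
  by apply: bound; rewrite ?oneE ?cE ler_pM2r//; lra.
have s2 : (2 : R) <= s.+2%:R by rewrite ler_nat.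
by apply: bound; rewrite ?oneE ?cE ler_pM2r//; lra.
Qed.

End Block.
End Blocks.

(** * Continuants and the reversed continued fraction *)

Section Continuants.
Implicit Types (a : nat -> nat) (i j k x y : nat).

(** The seeds [(1, 0)] and [(0, 1)] give the denominators and numerators of the convergents of
    [[0; a 0, a 1, ...]]. *)
Fixpoint continuant a x y k : nat * nat :=
  if k is k'.+1 then
    let: (u, v) := continuant a x y k' in (a k' * u + v, u)%N
  else (x, y).

Lemma continuantS a x y k : continuant a x y k.+1 =
  (a k * (continuant a x y k).1 + (continuant a x y k).2, (continuant a x y k).1)%N.
Proof. by rewrite /=; case: (continuant a x y k). Qed.

Section Positive.
Variable a : nat -> nat.
Hypothesis a_gt0 : forall k, (0 < a k)%N.
Local Notation q k := (continuant a 1 0 k).1.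
Local Notation q' k := (continuant a 1 0 k).2.

Lemma continuant_gt0 k : (0 < q k)%N.
Proof.
elim: k => // k IH; rewrite continuantS /=.
by rewrite addn_gt0 muln_gt0 a_gt0 IH.
Qed.

Lemma continuant_snd_le k : (q' k <= q k)%N.
Proof.
case: k => // k; rewrite continuantS /=.
by apply: leq_trans (leq_addr _ _); rewrite leq_pmull.
Qed.

Lemma continuant_leS k : (q k <= q k.+1)%N.
Proof. by have := continuant_snd_le k.+1; rewrite continuantS. Qed.

Lemma continuant_double k : (2 * q k <= q k.+2)%N.
Proof.
have -> : q k.+2 = (a k.+1 * q k.+1 + q k)%N.
  by rewrite (continuantS _ _ _ k.+1) (continuantS _ _ _ k).
rewrite mul2n -addnn leq_add2r.
by apply: leq_trans (continuant_leS k) _; rewrite leq_pmull.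
Qed.

Lemma continuant_ratio k : (q k.+1 <= (a k).+1 * q k)%N.
Proof. by rewrite continuantS /= mulSn addnC leq_add// continuant_snd_le. Qed.

Lemma continuant_ge_mul k : (a k * q k <= q k.+1)%N.
Proof. by rewrite continuantS leq_addr. Qed.

End Positive.

(** For [i >= j] truncated subtraction returns [a 0], so all digits stay positive. *)
Definition rev_digit a j i := a (j - i.+1)%N.

Section Reverse.
Variables (a : nat -> nat) (j : nat).
Hypothesis a_gt0 : forall k, (0 < a k)%N.
Local Notation q k := (continuant a 1 0 k).1.
Local Notation q' k := (continuant a 1 0 k).2.
Local Notation Q i := (continuant (rev_digit a j) 1 0 i).1.
Local Notation Q' i := (continuant (rev_digit a j) 1 0 i).2.
Local Notation P i := (continuant (rev_digit a j) 0 1 i).1.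
Local Notation P' i := (continuant (rev_digit a j) 0 1 i).2.

(** Euler's splitting of the continuant of length [j] at position [j - i]. At [i = j] it becomes the
    palindromic symmetry [rev_continuant_full]. *)
Lemma rev_continuant_split i : (i <= j)%N -> (Q i * q (j - i) + Q' i * q' (j - i) = q j)%N.
Proof.
elim: i => [|i IH] ij; first by rewrite subn0 mul1n mul0n addn0.
rewrite -(IH (ltnW ij)) !continuantS /=.
have -> : (j - i = (j - i.+1).+1)%N by lia.
rewrite !continuantS /= /rev_digit; nia.
Qed.

(** The reversed fraction converges to [q' j / q j]. The first identity is the exact error of its
    convergent [P i / Q i], with numerator [q' (j - i)]: the [v] of [saw_block]. *)
Lemma rev_continuant_det i : (i <= j)%N ->
  [/\ Posz (Q i) * Posz (q' j) - Posz (P i) * Posz (q j) = (-1) ^+ i * Posz (q' (j - i)) :> int,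
      Posz (Q' i) * Posz (q' j) - Posz (P' i) * Posz (q j) = - (-1) ^+ i * Posz (q (j - i)) :> int &
      Posz (P i) * Posz (Q' i) - Posz (P' i) * Posz (Q i) = - (-1) ^+ i :> int].
Proof.
elim: i => [_|i IH ij]; first by rewrite subn0 /= expr0; split; ring.
have [h1 h2 h3] := IH (ltnW ij).
rewrite !continuantS /= !PoszD !PoszM exprS /rev_digit.
have e : (j - i = (j - i.+1).+1)%N by lia.
rewrite e !continuantS /= !PoszD !PoszM in h1 h2.
set u := (a _)%:Z in h2 *.
split.
- transitivity (u * (Posz (Q i) * Posz (q' j) - Posz (P i) * Posz (q j)) + (Posz (Q' i) * Posz (q' j) - Posz (P' i) * Posz (q j))); first by ring.
  by rewrite h1 h2; ring.
- by rewrite h1; ring.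
- transitivity (- (Posz (P i) * Posz (Q' i) - Posz (P' i) * Posz (Q i))); first by ring.
  by rewrite h3; ring.
Qed.

Lemma rev_continuant_coprime i : (i <= j)%N -> coprime (P i) (Q i).
Proof.
move=> ij; have [_ _ h] := rev_continuant_det ij.
rewrite /coprime -dvdn1.
have : (Posz (gcdn (P i) (Q i)) %| (-1) ^+ i)%Z.
  rewrite -[X in (_ %| X)%Z]opprK -h dvdzE /=.
  have : (Posz (gcdn (P i) (Q i)) %| - (Posz (P i) * Posz (Q' i) - Posz (P' i) * Posz (Q i)))%Z.
    rewrite rpredN rpredB//; first by apply: dvdz_mulr; rewrite dvdzE /= dvdn_gcdl.
    by apply: dvdz_mull; rewrite dvdzE /= dvdn_gcdr.
  by rewrite dvdzE.
by rewrite dvdzE /= abszX /= exp1n.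
Qed.

Lemma rev_continuant_approx i : (i < j)%N ->
  (Q i * q' j = P i * q j + q' (j - i) \/ Q i * q' j + q' (j - i) = P i * q j)%N.
Proof.
move=> ij; have [h _ _] := rev_continuant_det (ltnW ij).
move: h; rewrite -signr_odd; case: (odd i) => /= h; [right|left].
  by apply/eqP; rewrite -eqz_nat PoszD !PoszM -subr_eq0; apply/eqP; rewrite expr1 in h; lia.
by apply/eqP; rewrite -eqz_nat PoszD !PoszM -subr_eq0; apply/eqP; rewrite expr0 in h; lia.
Qed.

Lemma rev_continuant_small i : (i <= j)%N -> (Q i * q' (j - i) <= q j)%N.
Proof.
move=> ij; rewrite -(rev_continuant_split ij); apply: leq_trans (leq_addr _ _).
by rewrite leq_mul2l continuant_snd_le ?orbT.
Qed.

Lemma rev_continuant_full : Q j = q j.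
Proof. by have := rev_continuant_split (leqnn j); rewrite subnn /=; lia. Qed.

End Reverse.
End Continuants.

(** * Convergents of [alpha] and the distances [|q_k alpha - p_k|] *)

Section ContinuedFraction.
Variables (R : realType) (alpha : R).
Hypothesis irr : irrational alpha.

(** The index is shifted so that the digit [b k] is measured against [pq k]. *)
Definition pq (k : nat) := cf_an alpha k.+1.

Lemma cf_qq_continuant k : cf_qq alpha k = continuant pq 1 0 k.
Proof. by elim: k => //= k ->. Qed.

Definition qprev (k : nat) : nat := (cf_qq alpha k).2.

Lemma cf_qE k : cf_q alpha k = (continuant pq 1 0 k).1.
Proof. by rewrite /cf_q cf_qq_continuant. Qed.

Lemma qprevE k : qprev k = (continuant pq 1 0 k).2.
Proof. by rewrite /qprev cf_qq_continuant. Qed.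

Lemma cf_qS k : cf_q alpha k.+1 = (pq k * cf_q alpha k + qprev k)%N.
Proof. by rewrite cf_qE continuantS -cf_qE -qprevE. Qed.

Lemma qprevS k : qprev k.+1 = cf_q alpha k.
Proof. by rewrite qprevE continuantS -cf_qE. Qed.

Lemma rational_int (z : int) : rational (z%:~R : R).
Proof. by exists z%:~R => //; rewrite ratr_int. Qed.

Lemma rationalD_int (x : R) (z : int) : rational (x - z%:~R) -> rational x.
Proof.
move=> [r _ rE]; exists (r + z%:~R) => //.
by rewrite rmorphD /= ratr_int rE subrK.
Qed.

Lemma rationalV (x : R) : rational x^-1 -> rational x.
Proof. by move=> [r _ rE]; exists r^-1 => //; rewrite fmorphV /= rE invrK. Qed.

Lemma cf_x_irrational k : ~ rational (cf_x alpha k).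
Proof.
elim: k => [|k IH] /=.
  by move=> /rationalD_int; exact: irr.
by move=> /rationalD_int /rationalV; exact: IH.
Qed.

Lemma cf_x_bounds k : 0 < cf_x alpha k < 1.
Proof.
have n0 : cf_x alpha k != 0.
  by apply/eqP => e; apply: (@cf_x_irrational k); rewrite e; exact: (rational_int 0).
have frac (y : R) : 0 <= y - (Num.floor y)%:~R < 1.
  by rewrite subr_ge0 ge_floor /= ltrBlDl -[X in _ + X]/(1%:~R) -intrD lt_succ_floor.
rewrite lt_def n0 /=; case: k {n0} => [|k] /=; exact: frac.
Qed.

Lemma cf_x_inv k : (cf_x alpha k)^-1 = (pq k)%:R + cf_x alpha k.+1.
Proof.
have /andP[x0 x1] := cf_x_bounds k.
have i1 : 1 <= (cf_x alpha k)^-1 by rewrite -invr1 lef_pV2 ?posrE// ltW.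
have f0 : 0 <= Num.floor (cf_x alpha k)^-1.
  by rewrite floor_ge0 (le_trans _ i1).
rewrite /pq /cf_an /cf_a natr_absz ger0_norm//= addrC subrK//.
Qed.

Lemma pq_gt0 k : (0 < pq k)%N.
Proof.
rewrite -(ltr_nat R); have := cf_x_inv k.
have /andP[x0 x1] := cf_x_bounds k; have /andP[y0 y1] := cf_x_bounds k.+1.
have i1 : 1 < (cf_x alpha k)^-1 by rewrite invf_gt1.
rewrite lt_neqAle ler0n andbT => e; apply/eqP => z; rewrite -z in e; lra.
Qed.

(** The product formula for [|q_(k-1) alpha - p_(k-1)|]. The sign and the congruence modulo 1 are in
    [cf_q_alpha], where an unnamed integer replaces [p_k]. *)
Definition cf_h (k : nat) : R := \prod_(i < k) cf_x alpha i.

Lemma cf_hS k : cf_h k.+1 = cf_h k * cf_x alpha k.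
Proof. by rewrite /cf_h big_ord_recr. Qed.

Lemma cf_h_gt0 k : 0 < cf_h k.
Proof. by apply: prodr_gt0 => i _; have /andP[] := cf_x_bounds i. Qed.

Lemma cf_h_rec k : cf_h k = (pq k)%:R * cf_h k.+1 + cf_h k.+2.
Proof.
have /andP[x0 x1] := cf_x_bounds k.
have e : cf_x alpha k * cf_x alpha k.+1 = 1 - cf_x alpha k * (pq k)%:R.
  by have := mulfV (lt0r_neq0 x0); rewrite cf_x_inv mulrDr => e; apply/eqP; rewrite eq_sym subr_eq addrC e.
by rewrite !cf_hS -[X in _ + X]mulrA e; ring.
Qed.

Lemma cf_h_leS k : cf_h k.+1 <= cf_h k.
Proof.
have /andP[x0 x1] := cf_x_bounds k.
by rewrite cf_hS -[leRHS]mulr1 ler_pM2l ?cf_h_gt0// ltW.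
Qed.

Lemma cf_q_h k : (cf_q alpha k)%:R * cf_h k + (qprev k)%:R * cf_h k.+1 = 1.
Proof.
elim: k => [|k IH]; first by rewrite /cf_q /qprev /= mul1r mul0r addr0 /cf_h big_ord0.
rewrite cf_qS qprevS natrD natrM; apply: etrans IH; rewrite (cf_h_rec k); ring.
Qed.

Lemma cf_q_alpha k :
  (exists z : int, (cf_q alpha k)%:R * alpha = z%:~R + (-1) ^+ k * cf_h k.+1) /\
  (exists z : int, (qprev k)%:R * alpha = z%:~R - (-1) ^+ k * cf_h k).
Proof.
elim: k => [|k [[z hz] [z' hz']]].
  split; [exists (Num.floor alpha)|exists 1]; rewrite /cf_q /qprev /cf_h ?big_ord1 ?big_ord0 /=; ring.
split; last by exists z; rewrite qprevS hz exprS; ring.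
exists (Posz (pq k) * z + z').
rewrite cf_qS natrD natrM mulrDl -mulrA hz hz' intrD intrM (cf_h_rec k) exprS.
by rewrite -[(Posz _)%:~R]/((pq k)%:R); ring.
Qed.

Lemma cf_total k : (pq k)%:R * ((cf_q alpha k)%:R * cf_h k.+1) + (qprev k)%:R * cf_h k.+1
  + (cf_q alpha k)%:R * cf_h k.+2 = 1.
Proof. by apply: etrans (cf_q_h k); rewrite (cf_h_rec k); ring. Qed.

End ContinuedFraction.

Lemma cf_weight_ge0 (R : realType) (Q : nat -> nat) J :
  (forall i, (0 < Q i)%N) -> (forall i, (Q i <= Q i.+1)%N) -> 0 <= cf_weight R Q J.
Proof.
move=> Q0 QS; apply: sumr_ge0 => i _; rewrite divr_ge0// addr_ge0// ln_ge0//.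
by rewrite ler_pdivlMr ?ltr0n// mul1r ler_nat.
Qed.

(** * The block at level [j], above a part [L < q_j] formed by lower digits *)

Section Level.
Variables (R : realType) (alpha : R).
Hypothesis irr : irrational alpha.
Variables (j L : nat).
Local Notation q := (cf_q alpha j).
Local Notation A := (qprev alpha j).
Local Notation a := (pq alpha).
Hypothesis L_lt : (L < q)%N.

Let apos := pq_gt0 irr.

Lemma cf_q_gt0 k : (0 < cf_q alpha k)%N.
Proof. by rewrite cf_qE; apply: continuant_gt0. Qed.

Lemma qprev_le k : (qprev alpha k <= cf_q alpha k)%N.
Proof. by rewrite cf_qE qprevE; apply: continuant_snd_le. Qed.

Lemma coprime_qprev k : coprime (qprev alpha k) (cf_q alpha k).
Proof.
elim: k => [|k IH]; first by rewrite /cf_q /qprev /= coprimen1.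
rewrite qprevS cf_qS /coprime gcdnMDl gcdnC; exact: IH.
Qed.

(** The element of [[L + 1, L + q]] congruent to [s A] modulo [q]. Modulo 1, [A * alpha] is about
    [1 / q] up to sign, so this enumeration lists the multiples of [alpha] in their order on the
    circle. *)
Definition shifted_residue (s : nat) : nat := (L.+1 + (s * A + (q - L.+1)) %% q)%N.
Definition offset (s : nat) : R := (shifted_residue s)%:R / q%:R - 1.

Let qr : (0 : R) < q%:R. Proof. by rewrite ltr0n cf_q_gt0. Qed.

Lemma shifted_residue0 : shifted_residue 0 = q.
Proof. by rewrite /shifted_residue mul0n add0n modn_small; lia. Qed.

Lemma shifted_residue_bounds s : (L < shifted_residue s <= L + q)%N.
Proof.
have := ltn_pmod (s * A + (q - L.+1)) (cf_q_gt0 j).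
by rewrite /shifted_residue; lia.
Qed.

Lemma offset0 : offset 0 = 0.
Proof. by rewrite /offset shifted_residue0 divff ?subrr// gt_eqF. Qed.

Lemma offset_le1 s : `|offset s| <= 1.
Proof.
have /andP[h1 h2] := shifted_residue_bounds s.
have h3 : (shifted_residue s <= 2 * q)%N by lia.
have h3' : (shifted_residue s)%:R <= 2 * q%:R :> R by rewrite -natrM ler_nat.
have x1 : (shifted_residue s)%:R / q%:R <= 2 :> R by rewrite ler_pdivrMr.
have x0 : 0 <= (shifted_residue s)%:R / q%:R :> R by rewrite divr_ge0.
by rewrite /offset ler_norml; apply/andP; split; lra.
Qed.

Lemma offset1_le : offset 1 <= A%:R / q%:R.
Proof.
have h : (shifted_residue 1 <= A + q)%N.
  by have := leq_mod (1 * A + (q - L.+1)) q; rewrite /shifted_residue mul1n; lia.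
rewrite /offset lerBlDr -[X in _ <= _ + X](divff (lt0r_neq0 qr)) -mulrDl ler_pM2r ?invr_gt0//.
by rewrite -natrD ler_nat.
Qed.

(** After subtracting the drift, which records the position of the block, the offset is the sawtooth
    of [saw_block] with [A / q = q_(j-1) / q_j]. *)
Lemma offset_block i s : (i < j)%N ->
  `|\sum_(t < (continuant (rev_digit a j) 1 0 i).1) (offset (s + t)%N - (L.+1%:R / q%:R - 1 / 2))| <= 5.
Proof.
move=> ij; set Q := (continuant _ 1 0 i).1.
have Q0 : (0 < Q)%N by apply: continuant_gt0 => k; exact: apos.
have cop : coprime (continuant (rev_digit a j) 0 1 i).1 Q by apply: rev_continuant_coprime => //; exact: ltnW.
have app := rev_continuant_approx a ij.
have sm := rev_continuant_small apos (ltnW ij).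
rewrite -cf_qE -!qprevE in app sm.
have := @saw_block R q A Q _ _ (s * A + (q - L.+1)) (cf_q_gt0 j) Q0 cop app sm.
congr (`|_| <= _); apply: eq_bigr => t _.
rewrite /offset /shifted_residue natrD mulrDl.
have -> : ((s + t) * A + (q - L.+1) = t * A + (s * A + (q - L.+1)))%N by lia.
by field; rewrite gt_eqF.
Qed.

(** Here [b] is the digit below. If it leaves room [r] on both sides, then [s A] causes no wrap for
    [s <= r], and the offsets at [s] and [q - s] are exactly [s A / q] and its negative. This is
    where a digit near an end of its range costs a logarithm. *)
Lemma offset_small b L' s r : (0 < j)%N -> L = (b * A + L')%N -> (L' < A)%N -> (r <= b)%N ->
  (r + b.+1 <= a j.-1)%N -> (0 < s <= r)%N -> (s < q)%N ->
  `|offset s| <= s%:R / r%:R /\ `|offset (q - s)%N| <= s%:R / r%:R.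
Proof.
move=> j0 LE L'A rb rba /andP[s0 sr] sq.
have aA : (a j.-1 * A <= q)%N.
  by case: (j) j0 => // k _; rewrite cf_qS qprevS leq_addr.
have r0 : (0 < r)%N by exact: leq_trans sr.
have bound : (s * A)%:R / q%:R <= s%:R / r%:R :> R.
  rewrite ler_pdivrMr// mulrAC ler_pdivlMr ?ltr0n// -!natrM ler_nat -mulnA leq_mul2l.
  apply/orP; right; rewrite mulnC; apply: leq_trans aA; rewrite leq_mul2r; apply/orP; right.
  by apply: leq_trans rba; exact: leq_addr.
have b0 : 0 <= (s * A)%:R / q%:R :> R by rewrite divr_ge0.
split.
  have sL : (s * A <= L)%N.
    by rewrite LE; apply: leq_trans (leq_addr _ _); rewrite leq_mul2r (leq_trans sr rb) orbT.
  have E : shifted_residue s = (s * A + q)%N.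
    by rewrite /shifted_residue modn_small; lia.
  by rewrite /offset E natrD mulrDl divff ?gt_eqF// addrK ger0_norm.
have sL : (s * A + L.+1 <= q)%N.
  apply: leq_trans aA; apply: (@leq_trans ((r + b.+1) * A)%N).
    have h1 : (s * A <= r * A)%N by rewrite leq_mul2r sr orbT.
    have h2 : (L.+1 <= b.+1 * A)%N by rewrite LE mulSn addnC -addSn leq_add2r.
    by rewrite mulnDl leq_add.
  by rewrite leq_mul2r rba orbT.
have E : shifted_residue (q - s)%N = (q - s * A)%N.
  rewrite /shifted_residue mulnBl.
  have -> : (q * A - s * A + (q - L.+1) = (q - L.+1 - s * A) + A * q)%N.
    have : (s * A <= q * A)%N by rewrite leq_mul2r ltnW ?orbT.
    lia.
  by rewrite addnC [X in (X %% _)%N]addnC modnMDl modn_small; lia.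
rewrite /offset E natrB; last by lia.
by rewrite mulrBl divff ?gt_eqF// addrAC subrr add0r normrN ger0_norm.
Qed.

Definition window_radius (b c : nat) : nat := maxn 1 (minn b (c - b.+1)).

Lemma offset_cot b L' w : (0 < j)%N -> L = (b * A + L')%N -> (L' < A)%N -> (b <= a j.-1)%N ->
  0 <= w <= q%:R^-1 ->
  `|\sum_(2 <= s < q) offset s * ctg (s%:R / q%:R - w)| <=
    300 * (1 + ln ((a j.-1)%:R / (window_radius b (a j.-1))%:R)
      + cf_weight R (fun i => (continuant (rev_digit a j) 1 0 i).1) j) * q%:R.
Proof.
move=> j0 LE L'A ba w01.
have Qpos : forall i, (0 < (continuant (rev_digit a j) 1 0 i).1)%N.
  by move=> i; apply: continuant_gt0 => k; exact: apos.
have Qle : forall i, ((continuant (rev_digit a j) 1 0 i).1 <= (continuant (rev_digit a j) 1 0 i.+1).1)%N.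
  by move=> i; apply: continuant_leS => k; exact: apos.
have Q1E : (continuant (rev_digit a j) 1 0 1).1 = a j.-1.
  by rewrite /= /rev_digit subn1; lia.
have r0 : (0 < window_radius b (a j.-1))%N by rewrite /window_radius leq_max.
have rQ : (window_radius b (a j.-1) <= (continuant (rev_digit a j) 1 0 1).1)%N.
  by rewrite Q1E /window_radius geq_max apos (leq_trans (geq_minl _ _)).
have small s : (0 < s <= window_radius b (a j.-1))%N -> (s < q)%N ->
    `|offset s| <= s%:R / (window_radius b (a j.-1))%:R /\ `|offset (q - s)%N| <= s%:R / (window_radius b (a j.-1))%:R.
  move=> sr sq; have [r1|r1] := leqP (minn b (a j.-1 - b.+1)) 0.
    have e : window_radius b (a j.-1) = 1%N by rewrite /window_radius; lia.
    rewrite e divr1; have s1 : (1 : R) <= s%:R by rewrite ler1n; move: sr => /andP[].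
    by split; apply: le_trans (offset_le1 _) s1.
  have e : window_radius b (a j.-1) = minn b (a j.-1 - b.+1) by rewrite /window_radius; lia.
  apply: (offset_small j0 LE L'A) => //; rewrite ?e; lia.
have [q3|q3] := ltnP 2 q; last first.
  rewrite big_geq// normr0; apply: mulr_ge0; last exact: ltW.
  apply: mulr_ge0; first exact: ler0n.
  rewrite addr_ge0 ?cf_weight_ge0// addr_ge0// ln_ge0// ler_pdivlMr ?ltr0n// mul1r ler_nat.
  by apply: leq_trans rQ _; rewrite Q1E.
have qQ : (q <= (continuant (rev_digit a j) 1 0 j).1)%N.
  by rewrite rev_continuant_full// cf_qE.
have := @cotangent_sum_le R offset (L.+1%:R / q%:R - 1 / 2) (fun i => (continuant (rev_digit a j) 1 0 i).1)
  j q (window_radius b (a j.-1)) erefl Qpos Qle j0 qQ q3 offset_le1 (fun i s ij => @offset_block i s ij) r0 rQ small w w01.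
by rewrite /cf_bound Q1E mulrAC.
Qed.

(** Each of [A], [q] and [V] times [alpha] is reduced modulo 1. The denominator [q] enters through
    [q h_j + A h_(j+1) = 1], and the common sign disappears by evenness of [lsin]. *)
Lemma lsin_offset (V b s : nat) (u : R) (z : int) : V%:R * alpha = z%:~R + (-1) ^+ j * u ->
  let p := q%:R * cf_h alpha j.+1 in
  lsin ((shifted_residue s + b * q + V)%:R * alpha) =
  lsin ((s%:R - block_shift p (q%:R * u) b - offset s * p) / q%:R).
Proof.
move=> hV p.
have [[z1 h1] [z2 h2]] := cf_q_alpha irr j.
pose t := ((s * A + (q - L.+1)) %/ q)%N.
have mE : (shifted_residue s)%:R = s%:R * A%:R + q%:R - t%:R * q%:R :> R.
  rewrite -!natrM -natrD; apply/eqP; rewrite eq_sym subr_eq -natrD eqr_nat; apply/eqP.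
  by have := divn_eq (s * A + (q - L.+1)) q; rewrite -/t /shifted_residue; lia.
have hh : cf_h alpha j = (1 - A%:R * cf_h alpha j.+1) / q%:R.
  by apply: (mulfI (lt0r_neq0 qr)); rewrite mulrCA divff ?gt_eqF// mulr1; have := cf_q_h irr j; lra.
set x := (_ / q%:R : R).
have E : (shifted_residue s + b * q + V)%:R * alpha = (s%:R * z2%:~R + (1 - t%:R + b%:R) * z1%:~R + z%:~R) - (-1) ^+ j * x.
  rewrite /x /block_shift /offset (natrD _ _ V) (natrD _ _ (b * q)) natrM mE.
  transitivity (s%:R * (A%:R * alpha) + (1 - t%:R + b%:R) * (q%:R * alpha) + V%:R * alpha); first by ring.
  rewrite h1 h2 hV hh /p -natr1; field; rewrite gt_eqF//.
rewrite E; have -> : s%:R * z2%:~R + (1 - t%:R + b%:R) * z1%:~R + z%:~R = (Posz s * z2 + (1 - Posz t + Posz b) * z1 + z)%:~R :> R.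
  by rewrite !(rmorphD, rmorphN, rmorphM, rmorph1) /= -!pmulrn.
rewrite addrC lsinDz -signr_odd; case: (odd j); first by rewrite expr1 mulN1r opprK.
by rewrite expr0 mul1r lsinN.
Qed.

Lemma sum_lsin_block_offset (V b : nat) (u : R) (z : int) : V%:R * alpha = z%:~R + (-1) ^+ j * u ->
  let p := q%:R * cf_h alpha j.+1 in
  \sum_(0 <= r < q) lsin ((L.+1 + r + b * q + V)%:R * alpha) = block q p (q%:R * u) offset b.
Proof.
move=> hV p; rewrite /block !big_mkord.
have := @sum_modn_coprime R q A (q - L.+1) (fun r => lsin ((L.+1 + r + b * q + V)%:R * alpha)) (cf_q_gt0 j) (coprime_qprev j).
move=> <-; apply: eq_bigr => s _; exact: (lsin_offset b s hV).
Qed.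

End Level.

(** * Bounding the weight of the reversed continued fraction *)

Section WeightBound.
Variable R : realType.

Lemma sum_inv_continuant_le (a : nat -> nat) n : (forall k, (0 < a k)%N) ->
  \sum_(0 <= i < n) ((continuant a 1 0 i).1%:R : R)^-1 <= 4.
Proof.
move=> apos; pose Q i := (continuant a 1 0 i).1.
have Q0 i : (0 : R) < (Q i)%:R by rewrite ltr0n continuant_gt0.
have inv1 i : ((Q i)%:R : R)^-1 <= 1.
  by rewrite invf_le1// ler1n continuant_gt0.
suff : forall m, (m <= n)%N -> \sum_(0 <= i < m) ((Q i)%:R : R)^-1 <= 4 by move=> /(_ n (leqnn n)).
elim: n => [|n IH] m; first by rewrite leqn0 => /eqP ->; rewrite big_geq.
case: m => [|[|m]] mn; first by rewrite big_geq.
  by rewrite big_nat1; apply: le_trans (inv1 _) _; lra.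
rewrite big_ltn// big_ltn// !big_add1 /=.
have h : \sum_(0 <= i < m) ((Q i.+2)%:R : R)^-1 <= \sum_(0 <= i < m) (1 / 2 * ((Q i)%:R : R)^-1).
  apply: ler_sum_nat => i _; rewrite div1r -invfM lef_pV2 ?posrE ?mulr_gt0//.
  by rewrite -natrM ler_nat continuant_double.
rewrite -mulr_sumr in h.
have := IH m ltac:(lia); have := inv1 0%N; have := inv1 1%N; lra.
Qed.

Lemma continuant_ge_id (a : nat -> nat) i : (forall k, (0 < a k)%N) -> (i <= (continuant a 1 0 i).1)%N.
Proof.
move=> apos; case: i => // i; elim: i => [|i IH]; first exact: continuant_gt0.
have -> : (continuant a 1 0 i.+2).1 = (a i.+1 * (continuant a 1 0 i.+1).1 + (continuant a 1 0 i).1)%N.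
  by rewrite (continuantS _ _ _ i.+1) (continuantS _ _ _ i).
have := continuant_gt0 apos i; have := apos i.+1; move: IH.
move: (continuant a 1 0 i.+1).1 (continuant a 1 0 i).1 (a i.+1) => u v w h w0 v0.
have : (u <= w * u)%N by rewrite leq_pmull.
lia.
Qed.

Lemma sum_indicator_le (d : R) (m n : nat) : 0 <= d ->
  \sum_(0 <= i < n) (if (i < m)%N then d else 0) <= m%:R * d.
Proof.
move=> d0; apply: (@le_trans _ _ ((minn n m)%:R * d)); last first.
  by rewrite ler_wpM2r// ler_nat geq_minr.
elim: n => [|n IH]; first by rewrite big_geq// mulr_ge0.
rewrite big_nat_recr//=; apply: le_trans (lerD IH (lexx _)) _.
case: ltnP => nm; last by rewrite addr0 ler_wpM2r// ler_nat; lia.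
by rewrite -[X in _ + X]mul1r -mulrDl ler_wpM2r// natr1 ler_nat; lia.
Qed.

Lemma ln_nat_ge0 (n : nat) : 0 <= ln (n%:R : R).
Proof. by case: n => [|n]; [rewrite ln0|rewrite ln_ge0// ler1n]. Qed.

Section Weight.
Variables (a : nat -> nat) (T : R) (k0 : nat).
Hypothesis apos : forall k, (0 < a k)%N.
Hypothesis T_ge1 : 1 <= T.
(* [a k] is the partial quotient of index [k + 1]. *)
Hypothesis log_le : forall k, (k0 <= k.+1)%N -> ln ((a k)%:R : R) / (a k.+1)%:R <= T.

(** The growth hypothesis bounds the logarithm of a reversed digit by [T] times the preceding
    reversed digit, and [Q i] is at least that digit times [Q (i - 1)]; so a term is
    [O(1 / Q i) + T / Q (i - 1)]. The first digits of [alpha] escape the hypothesis but sit at the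
    far end, where [Q i >= i] is large. The total is [3 * 4 + 4 T + 1]. *)
Lemma cf_weight_le : exists k1 : nat, forall j, (k1 <= j)%N ->
  cf_weight R (fun i => (continuant (rev_digit a j) 1 0 i).1) j <= 13 + 4 * T.
Proof.
have T1 := T_ge1; have T0 : 0 <= T by lra.
pose M : R := \sum_(0 <= k < k0) ln ((a k)%:R : R).
have M0 : 0 <= M by apply: sumr_ge0 => k _; exact: ln_nat_ge0.
have ML k : (k < k0)%N -> ln ((a k)%:R : R) <= M.
  move=> kk; rewrite /M (big_cat_nat _ (n := k)) ?(ltnW kk)//= [X in _ + X]big_ltn//.
  rewrite addrCA lerDl addr_ge0// sumr_ge0// => i _; exact: ln_nat_ge0.
(* Chosen so that each of the fewer than [k0] exceptional terms is at most [1 / (k0 + 1)]. *)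
pose n0 := Num.bound (k0.+1%:R * M).
have n0E : k0.+1%:R * M <= n0%:R by apply/ltW/archi_boundP; rewrite mulr_ge0.
exists (k0 + n0).+1 => j jk.
pose Q i := (continuant (rev_digit a j) 1 0 i).1.
have rpos k : (0 < rev_digit a j k)%N by exact: apos.
have Q0 i : (0 : R) < (Q i)%:R by rewrite ltr0n continuant_gt0.
pose d : R := k0.+1%:R^-1.
have d0 : 0 <= d by rewrite invr_ge0.
have term i : (1 <= i < j)%N -> (ln ((Q i.+1)%:R / (Q i)%:R) + 2) / (Q i)%:R <=
    3 * ((Q i)%:R : R)^-1 + T * ((Q i.-1)%:R : R)^-1 + (if (j - i < k0)%N then d else 0).
  move=> /andP[i1 ij].
  have c0 : (0 : R) < (rev_digit a j i)%:R by rewrite ltr0n.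
  have ratio : ln ((Q i.+1)%:R / (Q i)%:R) <= 1 + ln ((rev_digit a j i)%:R : R).
    apply: le_trans (lerD (ln2_le1 R) (lexx _)); rewrite -lnM ?posrE//.
    have g1 : 0 < (Q i.+1)%:R / (Q i)%:R :> R by rewrite divr_gt0.
    have g2 : 0 < 2 * (rev_digit a j i)%:R :> R by rewrite mulr_gt0.
    rewrite ler_ln ?posrE// ler_pdivrMr// -!natrM ler_nat.
    apply: leq_trans (continuant_ratio rpos i) _; rewrite leq_mul2r; apply/orP; right.
    by have := rpos i; lia.
  have lnc : ln ((rev_digit a j i)%:R : R) / (Q i)%:R <= T / (Q i.-1)%:R + (if (j - i < k0)%N then d else 0).
    have cE : rev_digit a j i = a (j - i).-1 by rewrite /rev_digit; congr a; lia.
    case: ltnP => jik.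
      apply: (@le_trans _ _ d); last by rewrite lerDr divr_ge0.
      have lM : ln ((rev_digit a j i)%:R : R) <= M by rewrite cE; apply: ML; lia.
      rewrite ler_pdivrMr//; apply: le_trans lM _.
      rewrite /d mulrC ler_pdivlMr ?ltr0n// mulrC; apply: le_trans n0E _.
      by rewrite ler_nat; apply: leq_trans (continuant_ge_id i rpos); lia.
    rewrite addr0 ler_pdivrMr// mulrAC ler_pdivlMr//.
    have := log_le (k := (j - i).-1) ltac:(lia).
    rewrite prednK; last by lia.
    rewrite ler_pdivrMr ?ltr0n// -cE => h.
    apply: (@le_trans _ _ (T * (a (j - i))%:R * (Q i.-1)%:R)); first by rewrite ler_wpM2r// ltW.
    rewrite -mulrA ler_wpM2l//.
    rewrite -natrM ler_nat.
    have := continuant_ge_mul (rev_digit a j) i.-1; rewrite prednK//.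
    by rewrite {1}/rev_digit prednK.
  rewrite mulrDl; move: (Q0 i) => Qi.
  have h1 : ln ((Q i.+1)%:R / (Q i)%:R) / (Q i)%:R <= (1 + ln ((rev_digit a j i)%:R : R)) / (Q i)%:R.
    by rewrite ler_pM2r ?invr_gt0.
  rewrite mulrDl mul1r in h1.
  move: h1 lnc; lra.
rewrite /cf_weight -/Q.
apply: le_trans (ler_sum_nat term) _.
rewrite !big_split /= -!mulr_sumr.
have s1 : \sum_(1 <= i < j) ((Q i)%:R : R)^-1 <= 4.
  apply: le_trans (sum_inv_continuant_le j rpos).
  rewrite [leRHS]big_ltn; last by lia.
  by rewrite lerDr invr_ge0.
have s2 : \sum_(1 <= i < j) ((Q i.-1)%:R : R)^-1 <= 4.
  by rewrite big_add1; exact: (sum_inv_continuant_le j.-1 rpos).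
have s3 : \sum_(1 <= i < j) (if (j - i < k0)%N then d else 0) <= 1.
  rewrite big_nat_rev /= add1n.
  apply: (@le_trans _ _ (\sum_(0 <= i < j) (if (i < k0)%N then d else 0))).
    rewrite [leRHS]big_ltn; last by lia.
    have h0 : 0 <= (if (0 < k0)%N then d else 0) by case: ifP.
    apply: le_trans (_ : _ <= 0 + _) _; last by rewrite lerD.
    rewrite add0r; apply: ler_sum_nat => i /andP[i1 ij].
    by have -> : (j - (j.+1 - i.+1) = i)%N by lia.
  apply: le_trans (sum_indicator_le k0 j d0) _.
  by rewrite /d ler_pdivrMr ?ltr0n// mul1r ler_nat.
have : T * \sum_(1 <= i < j) ((Q i.-1)%:R : R)^-1 <= T * 4 by rewrite ler_wpM2l.
lra.
Qed.

End Weight.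

Definition extreme_digit (b c : nat) : bool := ~~ ((c < 100 * b) && (100 * b <= 99 * c))%N.

Lemma window_ratio_le (b c : nat) : (0 < c)%N -> (b <= c)%N ->
  ln ((c%:R : R) / (window_radius b c)%:R) <= 200 + (if extreme_digit b c then ln (c%:R : R) else 0).
Proof.
move=> c0 bc; have r1 : (0 < window_radius b c)%N by rewrite /window_radius leq_max.
have cr : (0 : R) < c%:R by rewrite ltr0n.
have rr : (0 : R) < (window_radius b c)%:R by rewrite ltr0n.
case: ifPn => [_|]; last first.
  rewrite negbK => /andP[h1 h2].
  have h : (c <= 200 * window_radius b c)%N by rewrite /window_radius; lia.
  have h' : c%:R / (window_radius b c)%:R <= 200 :> R by rewrite ler_pdivrMr// -natrM ler_nat.
  rewrite addr0; apply: le_trans h'; apply/ltW/ln_sublinear; exact: divr_gt0.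
apply: (@le_trans _ _ (ln c%:R)); last by rewrite lerDr.
rewrite ler_ln ?posrE ?divr_gt0// ler_pdivrMr// -[leLHS]mulr1 ler_pM2l//.
by rewrite ler1n.
Qed.

End WeightBound.

(** * Replacing the digits of [N] level by level *)

Section Switching.
Variables (R : realType) (alpha : R).
Hypothesis irr : irrational alpha.
Local Notation q := (cf_q alpha).
Local Notation a := (pq alpha).
Local Notation s := (bstar alpha).

Let apos := pq_gt0 irr.

Lemma bstar_bounds k : (s k)%:R <= 5 / 6 * (a k)%:R :> R /\ 5 / 6 * (a k)%:R < (s k).+1%:R :> R.
Proof.
set x : R := 5 / 6 * (a k)%:R.
have x0 : 0 <= x by rewrite mulr_ge0.
have f0 : 0 <= Num.floor x by rewrite floor_ge0.
have sE : (s k)%:R = (Num.floor x)%:~R :> R.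
  by rewrite /bstar natr_absz ger0_norm.
split; first by rewrite sE ge_floor.
by rewrite -natr1 sE -[X in _ + X]/(1%:~R) -intrD lt_succ_floor.
Qed.

Lemma norm_sin_piDz (x : R) (z : int) : `|sin (pi * (x + z%:~R))| = `|sin (pi * x)|.
Proof.
have nat_case (y : R) (n : nat) : `|sin (pi * (y + n%:R))| = `|sin (pi * y)|.
  elim: n => [|n IH]; first by rewrite addr0.
  by rewrite -natr1 addrA mulrDr mulr1 sinDpi normrN.
case: z => n; first exact: nat_case.
by rewrite NegzE -[in RHS](subrK n.+1%:R x) nat_case rmorphN.
Qed.

Lemma sin_pi_irrational (n : nat) : (0 < n)%N -> sin (pi * (n%:R * alpha)) != 0.
Proof.
move=> n0; set x := n%:R * alpha; pose f := x - (Num.floor x)%:~R.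
have nr : (n%:R : R) != 0 by rewrite pnatr_eq0 -lt0n.
have f01 : 0 <= f < 1.
  by rewrite /f subr_ge0 ge_floor /= ltrBlDl -[X in _ + X]/(1%:~R) -intrD lt_succ_floor.
have fn : f != 0.
  apply/eqP => /eqP; rewrite subr_eq0 => /eqP e; apply: irr.
  exists ((Num.floor x)%:~R / n%:R) => //.
  rewrite fmorph_div /= ratr_int ratr_nat -e /x mulrAC divff// mul1r//.
have sf : 0 < sin (pi * f).
  by apply: sin_pi_gt0; rewrite lt_def fn; move: f01 => /andP[-> ->].
have E : `|sin (pi * x)| = `|sin (pi * f)|.
  have xE : x = f + (Num.floor x)%:~R by rewrite /f subrK.
  by rewrite [in LHS]xE norm_sin_piDz.
by rewrite -normr_gt0 E normr_gt0 gt_eqF.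
Qed.

Definition lnP (n : nat) : R := \sum_(1 <= m < n.+1) lsin (m%:R * alpha).

Lemma ln_sudler n : ln (sudler alpha n) = lnP n.
Proof.
have pos m : (0 < m)%N -> 0 < `|2 * sin (pi * (m%:R * alpha))|.
  by move=> m0; rewrite normr_gt0 mulf_neq0// sin_pi_irrational.
suff [//] : ln (sudler alpha n) = lnP n /\ 0 < sudler alpha n.
elim: n => [|n [IH IH0]].
  by rewrite /sudler /lnP !big_geq// ln1.
rewrite /sudler /lnP big_nat_recr//= -/(sudler alpha n); split; last by rewrite mulr_gt0// pos.
by rewrite lnM ?posrE ?pos// IH [in RHS]big_nat_recr.
Qed.

Lemma lnP_add m n : lnP (m + n) = lnP m + \sum_(0 <= r < n) lsin ((m.+1 + r)%:R * alpha).
Proof.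
rewrite /lnP (big_cat_nat _ (n := m.+1))//=; last by rewrite ltnS leq_addr.
congr (_ + _); rewrite -{1}[m.+1]add0n big_addn.
have -> : ((m + n).+1 - m.+1 = n)%N by lia.
by apply: eq_bigr => r _; rewrite addnC.
Qed.

Lemma lnP_add_blocks Q m n : lnP (m + n * Q) = lnP m +
  \sum_(0 <= b < n) \sum_(0 <= r < Q) lsin ((m.+1 + r + b * Q)%:R * alpha).
Proof.
elim: n => [|n IH]; first by rewrite mul0n addn0 big_geq// addr0.
have -> : (m + n.+1 * Q = m + n * Q + Q)%N by lia.
rewrite lnP_add IH big_nat_recr//= addrA; congr (_ + _).
by apply: eq_bigr => r _; rewrite !addSn addnAC.
Qed.

(** Adding a starred digit maps [u] to [- s h - u] with [h] the current distance. The interval is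
    preserved thanks to [s <= 5 a / 6] and the recursion of [cf_h]. *)
Lemma tail_shift k n : exists (z : int) (u : R),
  (\sum_(0 <= i < n) s (k.+1 + i) * q (k.+1 + i))%:R * alpha = z%:~R + (-1) ^+ k * u /\
  - (5 / 6) * cf_h alpha k.+1 <= u <= 5 / 6 * cf_h alpha k.+2.
Proof.
elim: n k => [|n IH] k.
  exists 0, 0; rewrite big_geq// mul0r mulr0 addr0; split => //.
  have := cf_h_gt0 irr k.+1; have := cf_h_gt0 irr k.+2.
  by move=> *; apply/andP; split; lra.
have [z [u [e /andP[u1 u2]]]] := IH k.+1.
have [[z1 h1] _] := cf_q_alpha irr k.+1.
have [sl sg] := bstar_bounds k.+1.
have hp := cf_h_gt0 irr k.+2.
exists (Posz (s k.+1) * z1 + z), (- (s k.+1)%:R * cf_h alpha k.+2 - u); split.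
  rewrite big_nat_recl// addn0 natrD mulrDl natrM -mulrA h1.
  under eq_bigr do rewrite addnS -addSn.
  rewrite e !(rmorphD, rmorphM) /= -!pmulrn exprS; ring.
have m0 : 0 <= (s k.+1)%:R * cf_h alpha k.+2 by rewrite mulr_ge0// ltW.
have m1 : (s k.+1)%:R * cf_h alpha k.+2 <= 5 / 6 * (a k.+1)%:R * cf_h alpha k.+2 by rewrite ler_wpM2r// ltW.
rewrite mulNr (cf_h_rec irr k.+1); apply/andP; split; lra.
Qed.

Section Expansion.
Variables (K N : nat) (b : nat -> nat).
Hypothesis ost : ostrowski alpha K b N.

Lemma ostrowski_le k : (k < K)%N -> (b k <= a k)%N.
Proof. by case: ost => _ _ h _; exact: h. Qed.

Definition low (k : nat) : nat := (\sum_(i < k) b i * q i)%N.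

Lemma lowS k : low k.+1 = (low k + b k * q k)%N.
Proof. by rewrite /low big_ord_recr. Qed.

(** A full digit empties the one below, so the induction then falls back two levels; hence the
    strengthening to all [m <= k]. *)
Lemma low_lt k : (k <= K)%N -> (low k < q k)%N.
Proof.
suff H : forall m, (m <= k)%N -> (k <= K)%N -> (low m < q m)%N by exact: H.
elim: k => [|k IH] m mk kK.
  by move: mk; rewrite leqn0 => /eqP ->; rewrite /low big_ord0 cf_q_gt0.
move: mk; rewrite leq_eqVlt => /orP[/eqP ->|mk]; last by apply: IH => //; exact: ltnW.
have lk := IH k (leqnn _) (ltnW kK).
case: ost => _ b0 ble bfull.
have := ble k kK; rewrite leq_eqVlt => /orP[/eqP bk|bk]; last first.
  rewrite lowS cf_qS; apply: (@leq_trans ((b k).+1 * q k)%N); first by rewrite mulSn ltn_add2r.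
  apply: leq_trans (leq_addr _ _); rewrite leq_mul2r; apply/orP; right; exact: bk.
case: k IH kK lk bk => [|k] IH kK lk bk.
  by have := b0 (leq_trans _ kK); rewrite bk ltnn => /(_ isT).
have bz : b k = 0%N := bfull k.+1 isT kK bk.
rewrite lowS bk (cf_qS _ k.+1) qprevS addnC ltn_add2l lowS bz mul0n addn0.
by apply: IH => //; apply: ltnW.
Qed.

(** Original digits below [j], starred ones from [j] on: the first keep the lower part under [q_j],
    the second make [tail_shift] applicable. *)
Definition switched (j : nat) : nat := (low j + \sum_(j <= k < K) s k * q k)%N.

Definition level_diff (j : nat) : R := lnP (switched j) - lnP (switched j.+1).

Lemma sum_level_diff : ln (sudler alpha N) = ln (sudler alpha (Nstar alpha K)) - \sum_(j < K) level_diff j.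
Proof.
rewrite -(big_mkord xpredT level_diff) !ln_sudler.
have -> : N = switched K by case: ost => -> _ _ _; rewrite /switched big_geq// addn0.
have -> : Nstar alpha K = switched 0 by rewrite /switched /low big_ord0 add0n big_mkord.
have -> : \sum_(0 <= j < K) level_diff j = - \sum_(0 <= j < K) (lnP (switched j.+1) - lnP (switched j)).
  by rewrite -sumrN; apply: eq_bigr => j _; rewrite opprB.
by rewrite telescope_sumr// opprK addrC subrK.
Qed.

Lemma level_diffE j : (j < K)%N -> exists U : R,
  - (5 / 6) * ((q j)%:R * cf_h alpha j.+1) <= U <= 5 / 6 * ((q j)%:R * cf_h alpha j.+2) /\
  level_diff j = digit_sum (s j) (block (q j) ((q j)%:R * cf_h alpha j.+1) U (offset alpha j (low j))) (b j).
Proof.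
move=> jK; pose V := (\sum_(0 <= i < K - j.+1) s (j.+1 + i) * q (j.+1 + i))%N.
have [z [u [hV /andP[u1 u2]]]] := tail_shift j (K - j.+1).
have qr : (0 : R) < (q j)%:R by rewrite ltr0n cf_q_gt0.
exists ((q j)%:R * u); split.
  by rewrite !(mulrCA _ (q j)%:R (cf_h _ _)) !ler_pM2l// u1 u2.
have VE : (\sum_(j.+1 <= k < K) s k * q k = V)%N.
  rewrite -{1}[j.+1]add0n big_addn /V.
  by apply: eq_bigr => i _; rewrite addnC.
have e1 : switched j = (low j + V + s j * q j)%N.
  by rewrite /switched big_ltn// VE; lia.
have e2 : switched j.+1 = (low j + V + b j * q j)%N.
  by rewrite /switched lowS VE; lia.
rewrite /level_diff e1 e2 !lnP_add_blocks /digit_sum.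
have blk n : \sum_(0 <= r < q j) lsin (((low j + V).+1 + r + n * q j)%:R * alpha) =
    block (q j) ((q j)%:R * cf_h alpha j.+1) ((q j)%:R * u) (offset alpha j (low j)) n.
  rewrite -(sum_lsin_block_offset irr (low_lt (ltnW jK)) n hV).
  by apply: eq_bigr => r _; rewrite !addSn -!addnA [(V + _)%N]addnC !addnA.
under eq_bigr do rewrite blk.
under [in X in _ - X]eq_bigr do rewrite blk.
by rewrite opprD addrACA subrr add0r.
Qed.

End Expansion.
End Switching.

Lemma level_const_ge1 (R : realType) : 1 <= 100 * 100 * 12 :> R. Proof. lra. Qed.

Lemma level_const_ge2 (R : realType) : 100 * 16 <= 100 * 100 * 12 :> R. Proof. lra. Qed.

Lemma level_sub_aux (R : realType) (x p r t e : R) : e <= r + t -> x - (p + r) - t <= x - p - e.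
Proof. lra. Qed.

Lemma slope_ge0 (R : realType) (T : R) : 1 <= T -> 0 <= 100 * 12 * (214 + 4 * T).
Proof.
move=> T1; have T0 := le_trans ler01 T1.
exact: mulr_ge0 (mulr_ge0 (ler0n R 100) (ler0n R 12)) (addr_ge0 (ler0n R 214) (mulr_ge0 (ler0n R 4) T0)).
Qed.

(** * The estimates for one level difference *)

Section LevelEstimates.
Variables (R : realType) (alpha : R).
Hypothesis irr : irrational alpha.
Local Notation q := (cf_q alpha).
Local Notation a := (pq alpha).
Local Notation s := (bstar alpha).
Local Notation h := (cf_h alpha).

Let apos := pq_gt0 irr.
Let qpos := cf_q_gt0 irr.

Lemma level_data k : [/\ 0 < (q k)%:R * h k.+1,
  0 < (q k)%:R * h k.+2 <= (q k)%:R * h k.+1,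
  0 <= (qprev alpha k)%:R * h k.+1 <= (q k)%:R * h k.+1 &
  (a k)%:R * ((q k)%:R * h k.+1) + (qprev alpha k)%:R * h k.+1 + (q k)%:R * h k.+2 = 1].
Proof.
have qr : (0 : R) < (q k)%:R by rewrite ltr0n qpos.
have h1 := cf_h_gt0 irr k.+1; have h2 := cf_h_gt0 irr k.+2.
split; last exact: cf_total.
- exact: mulr_gt0.
- by rewrite mulr_gt0//= ler_pM2l// cf_h_leS.
- by rewrite mulr_ge0 ?(ltW h1)//= ler_pM2r// ler_nat qprev_le.
Qed.

Definition digit_bound (k : nat) : R :=
  (2 * (a k)%:R) * ((q k)%:R * (2 + `|ln (((q k)%:R * h k.+2 / (6 * (q k)%:R)) ^+ 2)|)).

Section Digits.
Variables (K N : nat) (b : nat -> nat).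
Hypothesis ost : ostrowski alpha K b N.
Local Notation D := (level_diff alpha K b).

Lemma offset1_level k : (k < K)%N -> offset alpha k (low alpha b k) 1 * ((q k)%:R * h k.+1) <= (qprev alpha k)%:R * h k.+1.
Proof.
move=> kK; have qr : (0 : R) < (q k)%:R by rewrite ltr0n qpos.
have h1 := offset1_le irr (low_lt irr ost (ltnW kK)).
have hp := cf_h_gt0 irr k.+1.
rewrite mulrA ler_pM2r//.
by rewrite -ler_pdivlMr.
Qed.

Lemma level_abs_le k : (k < K)%N -> `|D k| <= digit_bound k.
Proof.
move=> kK; have [p0 Gp Bp tot] := level_data k.
have [U [Ub ->]] := level_diffE irr ost kK.
have LQ := low_lt irr ost (ltnW kK).
have bl i : (i < a k)%N -> `|block (q k) ((q k)%:R * h k.+1) U (offset alpha k (low alpha b k)) i| <=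
    (q k)%:R * (2 + `|ln (((q k)%:R * h k.+2 / (6 * (q k)%:R)) ^+ 2)|).
  move=> ia; apply: (block_abs_le (qpos k) (apos k) p0 Gp Bp Ub tot) => //.
  - exact: offset0.
  - exact: offset_le1.
  - move=> _; exact: offset1_level.
move: bl; set c : R := (q k)%:R * (2 + _) => bl.
have sum_le n : (n <= a k)%N -> `|\sum_(0 <= i < n) block (q k) ((q k)%:R * h k.+1) U (offset alpha k (low alpha b k)) i| <= (a k)%:R * c.
  move=> na; apply: le_trans (ler_norm_sum _ _ _) _.
  apply: (@le_trans _ _ (\sum_(0 <= i < n) c)).
    by apply: ler_sum_nat => i /andP[_ iN]; apply: bl; exact: leq_trans na.
  rewrite sumr_const_nat subn0 -[leLHS]mulr_natl ler_wpM2r// ?ler_nat//.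
  by rewrite mulr_ge0// addr_ge0.
have sk : (s k <= a k)%N.
  have [sl _] := bstar_bounds alpha k; rewrite -(ler_nat R); apply: le_trans sl _.
  have : 0 <= (a k)%:R :> R by [].
  lra.
rewrite /digit_sum; apply: le_trans (ler_normB _ _) _.
apply: le_trans (lerD (sum_le _ sk) (sum_le _ (ostrowski_le ost kK))) _.
by rewrite le_eqVlt; apply/orP; left; apply/eqP; rewrite /digit_bound -/c; ring.
Qed.

Lemma level_cot k w : (0 < k)%N -> (k < K)%N -> 0 <= w <= (q k)%:R^-1 ->
  `|\sum_(2 <= i < q k) offset alpha k (low alpha b k) i * ctg (i%:R / (q k)%:R - w)| <=
    300 * (1 + ln ((a k.-1)%:R / (window_radius (b k.-1) (a k.-1))%:R)
      + cf_weight R (fun i => (continuant (rev_digit a k) 1 0 i).1) k) * (q k)%:R.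
Proof.
case: k => // k _ kK w01.
apply: (@offset_cot R alpha irr k.+1 _ _ (b k) (low alpha b k)) => //.
- exact: (low_lt irr ost (ltnW kK)).
- by rewrite lowS qprevS addnC.
- by rewrite qprevS; apply: (low_lt irr ost); rewrite ltnW// ltnW.
- exact: (ostrowski_le ost (ltnW kK)).
Qed.

Definition edge_log (c n : nat) : R := if extreme_digit c n then ln n%:R else 0.

Lemma edge_log_ge0 c n : 0 <= edge_log c n.
Proof. by rewrite /edge_log; case: ifP => // _; exact: ln_nat_ge0. Qed.

(** The logarithmic loss at level [k] caused by an extreme digit at level [k - 1]: at most [a k]
    blocks, each losing [4 * 300 / a k] times the logarithm. *)
Definition transfer (k : nat) : R := if b k == s k then 0 else 100 * 12 * edge_log (b k.-1) (a k.-1).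

Lemma dist_digit_le k : (k < K)%N -> `|(b k)%:R - (s k)%:R| / (a k)%:R <= 1 :> R.
Proof.
move=> kK; have ar : (0 : R) < (a k)%:R by rewrite ltr0n apos.
rewrite ler_pdivrMr// mul1r.
have [sl _] := bstar_bounds alpha k.
have bk : (b k)%:R <= (a k)%:R :> R by rewrite ler_nat (ostrowski_le ost).
have b0 : 0 <= (b k)%:R :> R by []; have s0 : 0 <= (s k)%:R :> R by [].
by rewrite ler_norml; apply/andP; split; lra.
Qed.

Lemma level_estimates_aux (T : R) k : 1 <= T -> (k < K)%N ->
  `|(b k)%:R - (s k)%:R| * (4 * (300 * (214 + 4 * T + edge_log (b k.-1) (a k.-1))) / (a k)%:R) <=
    100 * 12 * (214 + 4 * T) * (`|(b k)%:R - (s k)%:R| / (a k)%:R + low_log R (a k) (b k)) + transfer k.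
Proof.
move=> T1 kK; have X0 := edge_log_ge0 (b k.-1) (a k.-1); have d1 := dist_digit_le kK.
have l0 := @low_log_ge0 R _ (apos k) (b k).
set X := edge_log _ _ in X0 *; set l := low_log _ _ _ in l0 *.
have T0 := slope_ge0 T1.
have main : 100 * 12 * X * (`|(b k)%:R - (s k)%:R| / (a k)%:R) <= transfer k.
  rewrite /transfer; case: eqP => [->|_]; first by rewrite subrr normr0 mul0r mulr0.
  rewrite -[leRHS]mulr1; apply: ler_wpM2l d1.
  exact: mulr_ge0 (mulr_ge0 (ler0n R 100) (ler0n R 12)) X0.
rewrite (_ : _ * (4 * _ / _) = 100 * 12 * (214 + 4 * T) * (`|(b k)%:R - (s k)%:R| / (a k)%:R) +
    100 * 12 * X * (`|(b k)%:R - (s k)%:R| / (a k)%:R)); last first.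
  by rewrite !mulrA; ring.
apply: lerD main; rewrite ler_wpM2l// lerDl//.
Qed.

Definition level_const (T : R) : R := 100 * (100 * 100 * 12 + 1) + 100 * 12 * (214 + 4 * T).

(** The number 214 inside [Z] is [1 + 200 + 13]: from [cf_bound], [window_ratio_le] and
    [cf_weight_le]. *)
Lemma level_estimates (T : R) k : 1 <= T -> (0 < k)%N -> (k < K)%N ->
  cf_weight R (fun i => (continuant (rev_digit a k) 1 0 i).1) k <= 13 + 4 * T ->
  ((b k)%:R <= 99 / 100 * (a k)%:R :> R ->
    `|D k - mainterm R (a k) (b k) (s k)| <=
      level_const T * (`|(b k)%:R - (s k)%:R| / (a k)%:R + low_log R (a k) (b k)) + transfer k) /\
  kappa R * ((b k)%:R - (s k)%:R) ^+ 2 / (a k)%:R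
    - level_const T * (`|(b k)%:R - (s k)%:R| / (a k)%:R + low_log R (a k) (b k)) - transfer k <= D k.
Proof.
move=> T1 k0 kK wt; have [p0 Gp Bp tot] := level_data k.
have [U [Ub DE]] := level_diffE irr ost kK.
have LQ := low_lt irr ost (ltnW kK).
have [sl sg] := bstar_bounds alpha k.
have qr : (0 : R) < (q k)%:R by rewrite ltr0n qpos.
have ar : (0 : R) < (a k)%:R by rewrite ltr0n apos.
have bk := ostrowski_le ost kK.
set X := edge_log (b k.-1) (a k.-1).
have X0 : 0 <= X by exact: edge_log_ge0.
pose Z : R := 300 * (214 + 4 * T + X).
have cot w : 0 <= w <= (q k)%:R^-1 ->
    `|\sum_(2 <= i < q k) offset alpha k (low alpha b k) i * ctg (i%:R / (q k)%:R - w)| <= Z * (q k)%:R.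
  move=> w01; apply: le_trans (level_cot k0 kK w01) _; rewrite ler_pM2r//.
  apply: ler_wpM2l; first exact: ler0n.
  have kK' : (k.-1 < K)%N := leq_ltn_trans (leq_pred k) kK.
  have := @window_ratio_le R _ _ (apos k.-1) (ostrowski_le ost kK').
  rewrite -/(edge_log _ _) -/X; lra.
have off0 : offset alpha k (low alpha b k) 0 = 0 by exact: offset0.
have off1 : (1 < q k)%N -> offset alpha k (low alpha b k) 1 * ((q k)%:R * h k.+1) <= (qprev alpha k)%:R * h k.+1.
  by move=> _; exact: offset1_level.
have near := block_near (qpos k) (apos k) p0 Gp Bp Ub tot off0 (offset_le1 irr LQ) off1 cot.
have up := block_le (qpos k) (apos k) p0 Gp Bp Ub tot off0 (offset_le1 irr LQ) off1 cot.
have up' i : (i < a k)%N -> 99 / 100 * (a k)%:R < i.+1%:R :> R ->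
    block (q k) ((q k)%:R * h k.+1) U (offset alpha k (low alpha b k)) i <= 100 * 100 * 12 / (a k)%:R + 4 * Z / (a k)%:R.
  move=> i1 i2; apply: le_trans (up _ i1 i2) _; rewrite lerD2r ler_pM2r ?invr_gt0//.
  exact: level_const_ge2.
have aux := level_estimates_aux T1 kK; rewrite -/X -/Z in aux.
have l0 := @low_log_ge0 R _ (apos k) (b k).
have d0 : 0 <= `|(b k)%:R - (s k)%:R| / (a k)%:R :> R by rewrite divr_ge0.
have split_const (y : R) : level_const T * y = 100 * (100 * 100 * 12 + 1) * y + 100 * 12 * (214 + 4 * T) * y.
  by rewrite /level_const mulrDl.
rewrite !split_const; split.
  move=> b99; have := digit_sum_near (apos k) sl sg (level_const_ge1 R) near b99.
  rewrite -DE => /le_trans; apply.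
  rewrite -addrA; apply: lerD aux; apply: ler_wpM2r; first exact: addr_ge0.
  by apply: ler_wpM2l => //; rewrite lerDl.
have := digit_sum_lower (apos k) sl sg (level_const_ge1 R) near up' bk.
rewrite -DE; apply: le_trans.
exact: level_sub_aux.
Qed.

End Digits.
End LevelEstimates.

(** * Choosing the cost of one level *)

Section Assembly.
Variable R : realType.

(** Projection onto [[- t, t]]: it removes as much of a deviation as may be carried, so that a
    deviation of at most [w + t] leaves at most [w]. *)
Definition clamp (t y : R) : R := Num.max (- t) (Num.min t y).

Lemma norm_clamp_le t y : 0 <= t -> `|clamp t y| <= t.
Proof.
move=> t0; rewrite /clamp ler_norml le_max lexx /= ge_max ge_min lexx /= andbT.
by lra.
Qed.

Lemma sub_clamp_le t y w : 0 <= t -> 0 <= w -> `|y| <= w + t -> `|y - clamp t y| <= w.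
Proof.
move=> t0 w0; rewrite /clamp !ler_norml => /andP[y1 y2].
rewrite maxEle minEle; by case: (leP t y) => h1; [case: (leP (- t) t)|case: (leP (- t) y)] => h2; apply/andP; split; lra.
Qed.

Lemma quad_le (c e x : R) : 0 < e -> 0 <= c -> 0 <= x -> c * x - e * x ^+ 2 <= c ^+ 2 / e.
Proof.
move=> e0 c0 x0; rewrite ler_pdivlMr//.
have : 0 <= (e * x - c) ^+ 2 by exact: sqr_ge0.
have : 0 <= c * (e * x) by rewrite mulr_ge0// mulr_ge0// ltW.
rewrite !expr2; lra.
Qed.

Definition gam : R := (23 * 100 + 26) / (100 * 100).
Definition eta : R := 3 / (100 * 100 * 100).

Lemma eta_gt0 : 0 < eta.
Proof. by rewrite /eta -!natrM divr_gt0 ?ltr0n. Qed.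

Lemma kappa_eta : kappa R = gam + eta.
Proof. by []. Qed.

Lemma gam_ge0 : 0 <= gam.
Proof. by rewrite /gam -!natrM -natrD divr_ge0 ?ler0n. Qed.

Lemma gam_le1 : gam <= 1.
Proof. by rewrite /gam; lra. Qed.

Lemma edge_log_le_low (b a : nat) : (b%:R : R) <= 99 / 100 * a%:R -> edge_log R b a <= low_log R a b.
Proof.
move=> ba; rewrite /edge_log; case: ifP => [|_]; last first.
  by rewrite /low_log; case: ifP => // _; exact: ln_nat_ge0.
have ba' : (100 * b <= 99 * a)%N by rewrite -(ler_nat R) !natrM; lra.
rewrite /extreme_digit ba' andbT -leqNgt => ab.
by rewrite /low_log ifT//; move: ab; rewrite -(ler_nat R) natrM => ab; lra.
Qed.

Lemma edge_log_le (b a : nat) : edge_log R b a <= ln (a%:R : R).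
Proof. by rewrite /edge_log; case: ifP => // _; exact: ln_nat_ge0. Qed.

Lemma low_log_le (a b : nat) : low_log R a b <= ln (a%:R : R).
Proof. by rewrite /low_log; case: ifP => // _; exact: ln_nat_ge0. Qed.

Lemma low_log0 (a b : nat) : ~~ extreme_digit b a -> low_log R a b = 0.
Proof.
rewrite negbK => /andP[ab _]; rewrite /low_log ifN// -ltNge.
by move: ab; rewrite -(ltr_nat R) natrM => ab; lra.
Qed.

(** In the extreme case the loss is at most slope times [a (1 + ln a)] and the gain at least
    [deficit_curv * a^2], as [0.15^2 >= 2 / 100]. Bounding [ln a] by [a / m + ln m] with
    [m = 2 * slope / curv] spends half of the gain; the other half absorbs the linear rest by
    [quad_le]. *)
Definition deficit_slope (C : R) : R := C + 40 + 100 * 12.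
Definition deficit_curv : R := eta * (2 / 100).
Definition deficit_lin (C : R) : R :=
  deficit_slope C * (1 + ln (2 * deficit_slope C / deficit_curv)).
Definition deficit_const (C : R) : R :=
  deficit_slope C ^+ 2 / eta + deficit_lin C ^+ 2 / (deficit_curv / 2).

Lemma deficit_curv_gt0 : 0 < deficit_curv.
Proof. by rewrite /deficit_curv mulr_gt0 ?eta_gt0. Qed.

Lemma deficit_aux (x l c y u v w z p : R) : x + l <= u -> v * y <= c -> u <= w + v / 2 * y ->
  w - v / 2 * y <= z -> 0 <= p -> x - c + l <= p + z.
Proof. by move=> *; lra. Qed.

(* The slack [kappa - gam] absorbs the linear and logarithmic errors; when the digit is extreme, [|b - s|] is proportional to [a]. *)
Lemma deficit_le (C : R) (a b s : nat) : 0 <= C -> (0 < a)%N -> (b <= a)%N -> b != s ->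
  s%:R <= 5 / 6 * a%:R :> R -> 5 / 6 * a%:R < s.+1%:R :> R ->
  gam * (b%:R - s%:R) ^+ 2 / a%:R - (kappa R * (b%:R - s%:R) ^+ 2 / a%:R
    - (C + 40) * (`|b%:R - s%:R| / a%:R + low_log R a b) - 100 * 12 * edge_log R b a)
  <= deficit_const C / a%:R.
Proof.
move=> C0 a0 ba ne sl sg; have ar : (0 : R) < a%:R by rewrite ltr0n.
have ar1 : (1 : R) <= a%:R by rewrite ler1n.
set d : R := `|b%:R - s%:R|.
have d0 : 0 <= d by exact: normr_ge0.
have dd : (b%:R - s%:R) ^+ 2 = d ^+ 2 :> R by rewrite real_normK// num_real.
have e0 := eta_gt0; have k0 := deficit_curv_gt0.
have S0 : 0 < deficit_slope C by rewrite /deficit_slope; lra.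
have P1 : 0 <= deficit_slope C ^+ 2 / eta by rewrite divr_ge0 ?exprn_ge0// ltW.
have P2 : 0 <= deficit_lin C ^+ 2 / (deficit_curv / 2) by rewrite divr_ge0 ?sqr_ge0// divr_ge0// ltW.
rewrite dd kappa_eta.
have -> : gam * d ^+ 2 / a%:R - ((gam + eta) * d ^+ 2 / a%:R - (C + 40) * (d / a%:R + low_log R a b) - 100 * 12 * edge_log R b a)
  = ((C + 40) * d - eta * d ^+ 2 + a%:R * ((C + 40) * low_log R a b + 100 * 12 * edge_log R b a)) / a%:R.
  by field; rewrite gt_eqF.
rewrite ler_pM2r ?invr_gt0//.
have [ext|nex] := boolP (extreme_digit b a); last first.
  rewrite low_log0// /edge_log (negPf nex) !mulr0 addr0 mulr0 addr0.
  apply: (@le_trans _ _ (deficit_slope C * d - eta * d ^+ 2)).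
    by rewrite lerD2r ler_wpM2r// /deficit_slope; lra.
  by apply: le_trans (quad_le e0 (ltW S0) d0) _; rewrite lerDl.
have l0 := ln_nat_ge0 R a.
have dlow : 15 / 100 * a%:R <= d.
  move: ext; rewrite /extreme_digit negb_and -leqNgt -ltnNge => /orP[ab|ab]; last first.
    have ab' : 99 * a%:R < 100 * b%:R :> R by rewrite -!natrM ltr_nat.
    by apply: le_trans (ler_norm _); lra.
  have ab' : 100 * b%:R <= a%:R :> R by rewrite -natrM ler_nat.
  (* For [a = 1] an extreme low digit would be [0 = s], which is excluded. *)
  have a2 : 2 <= a%:R :> R.
    rewrite ler_nat ltnNge; apply/negP => a1; apply/negP: ne; rewrite negbK.
    have ae : a = 1%N by apply/eqP; rewrite eqn_leq a1 a0.
    rewrite ae in ab sl; have b0 : b = 0%N by move: ab; clear; lia.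
    have s0 : (s < 1)%N by rewrite -(ltr_nat R); lra.
    by rewrite b0; case: (s) s0.
  rewrite /d distrC; apply: le_trans (ler_norm _).
  by rewrite -natr1 in sg; lra.
have dhi : d <= a%:R.
  have br : (b%:R : R) <= a%:R by rewrite ler_nat.
  have b0 : 0 <= b%:R :> R by []; have s0 : 0 <= s%:R :> R by [].
  by rewrite /d ler_norml; apply/andP; split; lra.
set m := 2 * deficit_slope C / deficit_curv.
have m0 : 0 < m by rewrite /m divr_gt0// mulr_gt0.
have lnm : ln (a%:R : R) <= a%:R / m + ln m.
  have am : 0 < a%:R / m by rewrite divr_gt0.
  rewrite -[X in ln X](divfK (lt0r_neq0 m0)) lnM ?posrE// lerD2r.
  exact/ltW/ln_sublinear.
have lin : (C + 40) * d + a%:R * ((C + 40) * low_log R a b + 100 * 12 * edge_log R b a)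
    <= a%:R * (deficit_slope C * (1 + ln a%:R)).
  have h1 : (C + 40) * d <= (C + 40) * a%:R by rewrite ler_wpM2l//; lra.
  have h2 : (C + 40) * low_log R a b <= (C + 40) * ln a%:R by rewrite ler_wpM2l ?low_log_le//; lra.
  have h3 : 100 * 12 * edge_log R b a <= 100 * 12 * ln a%:R by rewrite ler_wpM2l ?edge_log_le// mulr_ge0.
  have h4 : a%:R * ((C + 40) * low_log R a b + 100 * 12 * edge_log R b a) <= a%:R * ((C + 40) * ln a%:R + 100 * 12 * ln a%:R).
    by rewrite ler_pM2l// lerD.
  apply: le_trans (lerD h1 h4) _.
  have -> : a%:R * (deficit_slope C * (1 + ln a%:R)) = (C + 40) * a%:R + a%:R * ((C + 40) * ln a%:R + 100 * 12 * ln a%:R) + 100 * 12 * a%:R.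
    by rewrite /deficit_slope; ring.
  by rewrite lerDl mulr_ge0// mulr_ge0.
have curv : deficit_curv * a%:R ^+ 2 <= eta * d ^+ 2.
  rewrite /deficit_curv -mulrA ler_pM2l//.
  have dl0 : 0 <= 15 / 100 * a%:R :> R by rewrite mulr_ge0.
  have := ler_pM dl0 dl0 dlow dlow; rewrite !expr2 => h; apply: le_trans h.
  have : 0 <= a%:R * a%:R :> R by rewrite mulr_ge0.
  lra.
have log_part : a%:R * (deficit_slope C * (1 + ln a%:R)) <= deficit_lin C * a%:R + deficit_curv / 2 * a%:R ^+ 2.
  apply: (@le_trans _ _ (a%:R * (deficit_slope C * (1 + (a%:R / m + ln m))))).
    by rewrite ler_pM2l// ler_pM2l// lerD2l.
  rewrite le_eqVlt; apply/orP; left; apply/eqP.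
  rewrite /deficit_lin -/m mulrDr mulrDr mulrDr.
  have -> : deficit_slope C * (a%:R / m) = deficit_curv / 2 * a%:R.
    by rewrite /m; field; rewrite !gt_eqF.
  ring.
have lin0 : 0 <= deficit_lin C.
  rewrite /deficit_lin mulr_ge0 ?(ltW S0)// addr_ge0// ln_ge0// -/m /m ler_pdivlMr// mul1r.
  have : deficit_curv <= 1 by rewrite /deficit_curv /eta; lra.
  by rewrite /deficit_slope; lra.
have k2 : 0 < deficit_curv / 2 by rewrite divr_gt0.
have q2 := quad_le k2 lin0 (ltW ar).
exact: (deficit_aux lin curv log_part q2 P1).
Qed.

Section LevelChoice.
Variables (a b s : nat) (C D t e : R).
Hypothesis a_gt0 : (0 < a)%N.
Hypothesis b_le : (b <= a)%N.
Hypothesis s_le : s%:R <= 5 / 6 * a%:R :> R.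
Hypothesis s_gt : 5 / 6 * a%:R < s.+1%:R :> R.
Hypothesis C_ge0 : 0 <= C.
Hypothesis t_ge0 : 0 <= t.
Local Notation M := (mainterm R a b s).
Local Notation x := (`|b%:R - s%:R| / a%:R : R).
Hypothesis D_near : b%:R <= 99 / 100 * a%:R :> R -> `|D - M| <= C * (x + low_log R a b) + t.
Hypothesis D_lower : kappa R * (b%:R - s%:R) ^+ 2 / a%:R - C * (x + low_log R a b) - t <= D.
Hypothesis e_le : `|e| <= 100 * 12 * edge_log R b a.

(* The part of [D] that is charged to the digit below. *)
Definition carried : R := if b%:R <= 99 / 100 * a%:R :> R then clamp t (D - M) else - t.
(** [e] is the carry received from the level above. The maximum enforces (i); by [deficit_le] it
    raises the value by at most [O(1 / a)], which goes into the sum of [1 / a_k]. *)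
Definition chosen : R := if b == s then 0 else Num.max (D - carried + e) (gam * (b%:R - s%:R) ^+ 2 / a%:R).

Let ar : (0 : R) < a%:R. Proof. by rewrite ltr0n. Qed.
Let x_ge0 : 0 <= x. Proof. by rewrite divr_ge0. Qed.
Let low_ge0 : 0 <= low_log R a b. Proof. exact: low_log_ge0. Qed.
Let err_ge0 : 0 <= C * (x + low_log R a b). Proof. by rewrite mulr_ge0// addr_ge0. Qed.

Lemma norm_carried_le : `|carried| <= t.
Proof. by rewrite /carried; case: ifP => _; rewrite ?norm_clamp_le// normrN ger0_norm. Qed.

Lemma carried_near : b%:R <= 99 / 100 * a%:R :> R ->
  `|D - carried - M| <= C * (x + low_log R a b).
Proof.
move=> b99; rewrite /carried b99 addrAC; apply: sub_clamp_le => //; exact: D_near.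
Qed.

(** For digits above [0.99 a] only the lower bound with loss [t] is known, and [carried = - t]
    restores that loss. Otherwise the bound is inherited from the main term, at the price of the
    [40] in [mainterm_ge]. *)
Lemma carried_lower :
  kappa R * (b%:R - s%:R) ^+ 2 / a%:R - (C + 40) * (x + low_log R a b) <= D - carried.
Proof.
have x0 := x_ge0; have l0 := low_ge0; have er := err_ge0.
have E : (C + 40) * (x + low_log R a b) = C * (x + low_log R a b) + 40 * x + 40 * low_log R a b by ring.
have [b99|b99] := leP (b%:R : R) (99 / 100 * a%:R).
  have := carried_near b99; rewrite ler_norml => /andP[h _].
  have := mainterm_ge a_gt0 s_le s_gt b99.
  rewrite E; move: h; lra.
have cE : carried = - t by rewrite /carried leNgt b99.
have := D_lower; rewrite cE E; lra.
Qed.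

Lemma mainterm_sqr_le : b%:R <= 99 / 100 * a%:R :> R ->
  gam * (b%:R - s%:R) ^+ 2 / a%:R <= M + 40 * x.
Proof.
move=> b99; have := mainterm_ge a_gt0 s_le s_gt b99.
have : 0 <= eta * (b%:R - s%:R) ^+ 2 / a%:R.
  by rewrite divr_ge0// mulr_ge0 ?sqr_ge0// ltW ?eta_gt0.
by rewrite kappa_eta !mulrDl; lra.
Qed.

Lemma chosen_ge : gam * (b%:R - s%:R) ^+ 2 / a%:R <= chosen.
Proof.
rewrite /chosen; case: eqP => [->|_]; first by rewrite subrr expr0n mulr0 mul0r.
by rewrite le_max lexx orbT.
Qed.

Lemma mainterm_refl : b = s -> M = 0.
Proof. by move=> ->; rewrite mainterm_le// J_refl mulr0. Qed.

Lemma chosen_near : b%:R <= 99 / 100 * a%:R :> R ->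
  `|chosen - M| <= (C + 100 * 13) * (x + low_log R a b).
Proof.
move=> b99; have x0 := x_ge0; have l0 := low_ge0; have er := err_ge0.
rewrite /chosen; case: eqP => [/mainterm_refl ->|_].
  by rewrite subrr normr0 mulr_ge0 ?addr_ge0.
have E : (C + 100 * 13) * (x + low_log R a b) = C * (x + low_log R a b) + 100 * 13 * x + 100 * 13 * low_log R a b by ring.
have := carried_near b99; have := le_trans e_le (ler_wpM2l (mulr_ge0 (ler0n R 100) (ler0n R 12)) (edge_log_le_low b99)).
have := mainterm_sqr_le b99.
rewrite E !ler_norml => h1 /andP[h2 h3] /andP[h4 h5].
set Y := D - carried + e; set G := gam * _ / _ in h1 *.
by rewrite maxEle; case: (leP Y G) => h6; rewrite /Y in h6 *; apply/andP; split; lra.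
Qed.

Lemma chosen_deficit : b != s ->
  `|chosen - (D - carried + e)| <= deficit_const C / a%:R.
Proof.
move=> ne; rewrite /chosen (negPf ne).
have := deficit_le C_ge0 a_gt0 b_le ne s_le s_gt.
have := carried_lower; have := e_le; rewrite ler_norml => /andP[h1 _] h2 h3.
have dc : 0 <= deficit_const C / a%:R.
  have e0 := eta_gt0; have k0 := deficit_curv_gt0.
  by rewrite divr_ge0// addr_ge0// divr_ge0 ?sqr_ge0 ?(ltW e0)// divr_ge0// ltW.
set Y := D - carried + e; set G := gam * _ / _ in h3 *.
rewrite maxEle; case: (leP Y G) => h4; last by rewrite subrr normr0.
rewrite ger0_norm ?subr_ge0//; apply: le_trans h3.
by rewrite /Y; lra.
Qed.

End LevelChoice.

End Assembly.

(** * The costs for all levels and their sum *)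

Section Final.
Variables (R : realType) (alpha : R).
Hypothesis irr : irrational alpha.
Local Notation q := (cf_q alpha).
Local Notation a := (pq alpha).
Local Notation s := (bstar alpha).

Let apos := pq_gt0 irr.

Variables (T : R) (k1 : nat).
Hypothesis T_ge1 : 1 <= T.
Hypothesis k1_gt0 : (0 < k1)%N.
Hypothesis weight_le : forall j, (k1 <= j)%N ->
  cf_weight R (fun i => (continuant (rev_digit a j) 1 0 i).1) j <= 13 + 4 * T.

Lemma level_const_ge0 : 0 <= level_const T.
Proof.
apply: addr_ge0 (slope_ge0 T_ge1).
by rewrite -!natrM natr1 -natrM ler0n.
Qed.

(** The starred digit is extreme only for [a = 1], where the logarithm vanishes. So it receives no
    carry, as the equality case of (i) demands. *)
Lemma edge_log_bstar k : edge_log R (s k) (a k) = 0.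
Proof.
have [sl sg] := bstar_bounds alpha k; have a0 := apos k.
rewrite /edge_log; case: ifP => //; rewrite /extreme_digit.
have s1 : (6 * s k <= 5 * a k)%N by rewrite -(ler_nat R) !natrM; lra.
have s2 : (5 * a k < 6 * (s k).+1)%N by rewrite -(ltr_nat R) !natrM; lra.
move=> ext; have -> : a k = 1%N by move: s1 s2 a0 ext; clear; lia.
by rewrite ln1.
Qed.

(** Summing over all possible digits [c] makes the bound independent of [N]. The last term pays for
    the carry arriving from above. *)
Definition low_level_const (k : nat) : R :=
  (\sum_(0 <= c < (a k).+1) `|mainterm R (a k) c (s k)|) + (a k)%:R + digit_bound alpha k + 100 * 12 * ln (a k)%:R.

Lemma low_level_const_ge0 k : 0 <= low_level_const k.
Proof.
rewrite /low_level_const; apply: addr_ge0; last by rewrite mulr_ge0 ?ln_nat_ge0// mulr_ge0.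
apply: addr_ge0; first by rewrite addr_ge0// sumr_ge0.
by rewrite /digit_bound mulr_ge0 ?mulr_ge0// addr_ge0.
Qed.

Lemma sum_below_le (f : nat -> R) (m n : nat) : (forall k, 0 <= f k) ->
  \sum_(0 <= k < n) (if (k < m)%N then f k else 0) <= \sum_(0 <= k < m) f k.
Proof.
move=> f0; have [nm|mn] := leqP n m.
  rewrite [leRHS](big_cat_nat _ (n := n))//= -[leLHS]addr0 lerD ?sumr_ge0//.
  by apply: ler_sum_nat => k /andP[_ kn]; rewrite (leq_trans kn nm).
rewrite (big_cat_nat _ (n := m)) ?(ltnW mn)//= [X in _ + X]big1_seq.
  by rewrite addr0; apply: ler_sum_nat => k /andP[_ ->].
by move=> k /=; rewrite mem_index_iota => /andP[mk _]; rewrite ltnNge mk.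
Qed.

Section Digits.
Variables (K N : nat) (b : nat -> nat).
Hypothesis ost : ostrowski alpha K b N.
Local Notation D := (level_diff alpha K b).
Local Notation t := (transfer alpha b).
Local Notation C := (level_const T).
Local Notation M k := (mainterm R (a k) (b k) (s k)).
Local Notation x k := (`|(b k)%:R - (s k)%:R| / (a k)%:R : R).

Lemma transfer_ge0 k : 0 <= t k.
Proof. by rewrite /transfer; case: ifP => // _; exact: mulr_ge0 (mulr_ge0 (ler0n R 100) (ler0n R 12)) (edge_log_ge0 R _ _). Qed.

Lemma level_diff_bstar k : (k < K)%N -> b k = s k -> D k = 0.
Proof. by move=> kK e; have [U [_ ->]] := level_diffE irr ost kK; rewrite e /digit_sum subrr. Qed.

(** It vanishes below [k1] and from [K] on, so the telescoping sum of carries has no boundary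
    terms. *)
Definition carry (k : nat) : R :=
  if (k1 <= k < K)%N then carried (a k) (b k) (s k) (D k) (t k) else 0.

(** Below [k1] the level difference has no uniform estimate, so the main term itself, raised to the
    quadratic, serves as cost; the mismatch is absorbed by [low_level_const]. *)
Definition digit_cost (k : nat) : R :=
  if (k < k1)%N then
    (if b k == s k then 0 else Num.max (M k) (gam R * ((b k)%:R - (s k)%:R) ^+ 2 / (a k)%:R))
  else chosen (a k) (b k) (s k) (D k) (t k) (carry k.+1).

Lemma norm_carry_le k : `|carry k.+1| <= 100 * 12 * edge_log R (b k) (a k).
Proof.
have e0 := edge_log_ge0 R (b k) (a k).
have r0 : 0 <= 100 * 12 * edge_log R (b k) (a k) by rewrite mulr_ge0// mulr_ge0.
rewrite /carry; case: ifP => // _; last by rewrite normr0.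
apply: le_trans (norm_carried_le _ _ _ _ (transfer_ge0 _)) _.
by rewrite /transfer; case: ifP.
Qed.

Lemma digit_cost_ge k : gam R * ((b k)%:R - (s k)%:R) ^+ 2 / (a k)%:R <= digit_cost k.
Proof.
rewrite /digit_cost; case: ifP => _; last exact: chosen_ge.
case: eqP => [->|_]; first by rewrite subrr expr0n mulr0 mul0r.
by rewrite le_max lexx orbT.
Qed.

Lemma digit_cost_bstar k : b k = s k -> digit_cost k = 0.
Proof. by move=> e; rewrite /digit_cost /chosen e eqxx; case: ifP. Qed.

Lemma digit_cost_near k : (k < K)%N -> (b k)%:R <= 99 / 100 * (a k)%:R :> R ->
  `|digit_cost k - M k| <= (C + 100 * 13) * (x k + low_log R (a k) (b k)).
Proof.
move=> kK b99; have [sl sg] := bstar_bounds alpha k.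
have C0 := level_const_ge0; have T1 := T_ge1.
have x0 : 0 <= x k by rewrite divr_ge0.
have l0 := @low_log_ge0 R _ (apos k) (b k).
rewrite /digit_cost; case: ltnP => kk.
  have r0 : 0 <= (C + 100 * 13) * (x k + low_log R (a k) (b k)).
    by apply: mulr_ge0; apply: addr_ge0 => //; rewrite mulr_ge0.
  case: eqP => [e|_].
    by rewrite (mainterm_refl R (apos k) e) subrr normr0.
  have h := mainterm_sqr_le (apos k) sl sg b99.
  set G := gam R * _ / _ in h *.
  have h40 : 40 * x k <= (C + 100 * 13) * (x k + low_log R (a k) (b k)).
    apply: ler_pM => //; first lra.
    by rewrite lerDl.
  rewrite maxEle; case: (leP (M k) G) => hG; last by rewrite subrr normr0.
  by rewrite ger0_norm ?subr_ge0// lerBlDr addrC; apply: le_trans h _; rewrite lerD2l.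
have k0 : (0 < k)%N by exact: leq_trans kk.
have [e1 e2] := level_estimates irr ost T1 k0 kK (weight_le kk).
exact: (chosen_near (apos k) sl sg C0 (transfer_ge0 k) e1 (norm_carry_le k) b99).
Qed.

Lemma digit_cost_deficit k : (k < K)%N ->
  `|digit_cost k - (D k - carry k + carry k.+1)| <=
    deficit_const C / (a k)%:R + (if (k < k1)%N then low_level_const k else 0).
Proof.
move=> kK; have [sl sg] := bstar_bounds alpha k.
have C0 := level_const_ge0; have T1 := T_ge1.
have ar : (0 : R) < (a k)%:R by rewrite ltr0n.
have dc : 0 <= deficit_const C / (a k)%:R.
  have e0 := eta_gt0 R; have k0 := deficit_curv_gt0 R.
  by rewrite divr_ge0// addr_ge0// divr_ge0 ?sqr_ge0 ?(ltW e0)// divr_ge0// ltW.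
rewrite /digit_cost; case: ltnP => kk; last first.
  have k0 : (0 < k)%N by exact: leq_trans kk.
  have [e1 e2] := level_estimates irr ost T1 k0 kK (weight_le kk).
  have cE : carry k = carried (a k) (b k) (s k) (D k) (t k) by rewrite /carry kk kK.
  rewrite addr0 cE; have [e|ne] := eqVneq (b k) (s k); last first.
    exact: (chosen_deficit (apos k) (ostrowski_le ost kK) sl sg C0 (transfer_ge0 k) e1 e2 (norm_carry_le k) ne).
  (* An unchanged digit neither passes on nor receives anything, and its level difference is
     zero. *)
  have t0 : t k = 0 by rewrite /transfer e eqxx.
  have := norm_carried_le (a k) (b k) (s k) (D k) (transfer_ge0 k).
  rewrite t0 normr_le0 => /eqP ->.
  have := norm_carry_le k; rewrite e edge_log_bstar mulr0 normr_le0 => /eqP ->.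
  by rewrite /chosen -e eqxx (level_diff_bstar kK e) subr0 addr0 subrr normr0.
have cE : carry k = 0 by rewrite /carry leqNgt kk.
rewrite cE subr0 -[leLHS]add0r lerD//.
have hD := level_abs_le irr ost kK.
have hc := le_trans (norm_carry_le k) (ler_wpM2l (mulr_ge0 (ler0n R 100) (ler0n R 12)) (edge_log_le R (b k) (a k))).
have bk := ostrowski_le ost kK.
have S0 : 0 <= \sum_(0 <= c < (a k).+1) `|mainterm R (a k) c (s k)| by apply: sumr_ge0.
have hM : `|M k| <= \sum_(0 <= c < (a k).+1) `|mainterm R (a k) c (s k)|.
  rewrite (bigD1_seq (b k)) ?iota_uniq ?mem_index_iota//=.
  by rewrite lerDl sumr_ge0.
have hG : gam R * ((b k)%:R - (s k)%:R) ^+ 2 / (a k)%:R <= (a k)%:R.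
  rewrite ler_pdivrMr//; have d1 := dist_digit_le irr ost kK.
  rewrite ler_pdivrMr// mul1r in d1.
  rewrite -[leRHS]mul1r; apply: ler_pM; rewrite ?sqr_ge0 ?gam_ge0 ?gam_le1//.
  by rewrite -real_normK ?num_real// expr2; apply: ler_pM.
have G0 : 0 <= gam R * ((b k)%:R - (s k)%:R) ^+ 2 / (a k)%:R.
  by rewrite divr_ge0// mulr_ge0 ?gam_ge0 ?sqr_ge0.
have hd : `|if b k == s k then 0 else Num.max (M k) (gam R * ((b k)%:R - (s k)%:R) ^+ 2 / (a k)%:R)| <=
    \sum_(0 <= c < (a k).+1) `|mainterm R (a k) c (s k)| + (a k)%:R.
  case: ifP => _; first by rewrite normr0 addr_ge0.
  set G := gam R * _ / _ in hG G0 *.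
  rewrite maxEle; case: (leP (M k) G) => _; last by rewrite (le_trans hM)// lerDl.
  by rewrite ger0_norm// (le_trans hG)// lerDr.
rewrite opprD addrA; apply: le_trans (ler_normB _ _) _.
rewrite /low_level_const; apply: lerD hc; apply: le_trans (ler_normB _ _) _.
exact: lerD.
Qed.

Lemma sum_digit_cost :
  `|\sum_(k < K) digit_cost k - \sum_(k < K) D k| <=
    deficit_const C * (\sum_(k < K) (a k)%:R^-1) + \sum_(0 <= k < k1) low_level_const k.
Proof.
have telescope : \sum_(0 <= k < K) D k = \sum_(0 <= k < K) (D k - carry k + carry k.+1).
  have -> : \sum_(0 <= k < K) (D k - carry k + carry k.+1) = \sum_(0 <= k < K) D k + \sum_(0 <= k < K) (carry k.+1 - carry k).
    by rewrite -big_split; apply: eq_bigr => k _ /=; rewrite -addrA [- _ + _]addrC.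
  rewrite telescope_sumr// /carry ltnn andbF leqNgt k1_gt0 /= subrr addr0//.
rewrite -(big_mkord xpredT digit_cost) -(big_mkord xpredT D) -(big_mkord xpredT (fun k => (a k)%:R^-1)) telescope -sumrB mulr_sumr.
apply: le_trans (ler_norm_sum _ _ _) _.
apply: le_trans (lerD (lexx _) (sum_below_le k1 K low_level_const_ge0)).
rewrite -big_split /=; apply: ler_sum_nat => k /andP[_ kK]; exact: digit_cost_deficit.
Qed.

End Digits.
End Final.

Unset Implicit Arguments.

Theorem theorem1 (R : realType) (T : R) (hT : 1 <= T) :
  exists CT : R,
  forall (alpha : R) (k0 : nat),
    @irrational R alpha -> (1 <= k0)%N ->
    (forall k : nat, (k0 <= k)%N ->
       ln ((cf_an alpha k)%:R) / (cf_an alpha k.+1)%:R <= T) ->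
  exists Calpha : R,
  forall (N K : nat) (b : nat -> nat),
    ostrowski alpha K b N ->
  exists d : nat -> R,
    `| ln (sudler alpha N)
       - (ln (sudler alpha (Nstar alpha K)) - \sum_(k < K) d k) |
      <= CT * (\sum_(1 <= k < K.+1) ((cf_an alpha k)%:R)^-1) + Calpha
    /\ (forall k : nat, (k < K)%N ->
          (2326%:R / (100%:R * 100%:R) : R) * ((b k)%:R - (bstar alpha k)%:R) ^+ 2
              / (cf_an alpha k.+1)%:R <= d k
          /\ (b k = bstar alpha k -> d k = 0))
    /\ (forall k : nat, (k < K)%N ->
          ((b k)%:R : R) <= (99%:R / 100%:R : R) * (cf_an alpha k.+1)%:R ->
          `| d k - (cf_an alpha k.+1)%:R *
                 oint ((b k)%:R / (cf_an alpha k.+1)%:R)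
                      ((bstar alpha k)%:R / (cf_an alpha k.+1)%:R)
                      (fun x => ln `|2 * sin (pi * x)|) |
            <= CT * (`|(b k)%:R - (bstar alpha k)%:R| / (cf_an alpha k.+1)%:R
                     + (if ((b k)%:R : R) <= (1%:R / 100%:R : R) * (cf_an alpha k.+1)%:R
                        then ln ((cf_an alpha k.+1)%:R) else 0))).
Proof.
have T1 : 1 <= T := hT.
have C0 := level_const_ge0 T1.
pose CT : R := deficit_const (level_const T) + (level_const T + 100 * 13).
have dc0 : 0 <= deficit_const (level_const T).
  have e0 := eta_gt0 R; have k0' := deficit_curv_gt0 R.
  by rewrite addr_ge0// divr_ge0 ?sqr_ge0 ?(ltW e0)// divr_ge0// ltW.
have lc0 : 0 <= level_const T + 100 * 13 by apply: addr_ge0 => //; rewrite mulr_ge0.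
exists CT => alpha k0 irr k0_gt0 log_le.
have apos := pq_gt0 irr.
have [k1 hk1] := cf_weight_le apos T1 (fun k h => log_le k.+1 h).
(* The threshold is raised by one to be positive: level 0 has no digit below to charge. *)
have weight j : (k1.+1 <= j)%N -> cf_weight R (fun i => (continuant (rev_digit (pq alpha) j) 1 0 i).1) j <= 13 + 4 * T.
  by move=> kj; apply: hk1; exact: ltnW.
exists (\sum_(0 <= k < k1.+1) low_level_const alpha k) => N K b ost.
exists (digit_cost alpha k1.+1 K b).
split; last split.
- have cancel (u v w : R) : u - v - (u - w) = w - v by ring.
  rewrite (sum_level_diff irr ost) cancel.
  rewrite big_add1 /= big_mkord.
  apply: le_trans (sum_digit_cost irr T1 (ltn0Sn k1) weight ost) _.
  rewrite lerD2r; apply: ler_wpM2r; last by rewrite /CT lerDl.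
  by apply: sumr_ge0 => k _; rewrite invr_ge0.
- move=> k kK; split; last exact: digit_cost_bstar.
  apply: le_trans (digit_cost_ge _ _ _ _ _).
  suff -> : 2326%:R = 23 * 100 + 26 :> R by [].
  by rewrite -natrM -natrD.
- move=> k kK b99.
  have near := digit_cost_near irr T1 (ltn0Sn k1) weight ost kK b99.
  rewrite /mainterm /low_log /pq in near; apply: (le_trans near).
  rewrite ler_wpM2r// ?addr_ge0 ?divr_ge0//; last by rewrite /CT lerDr.
  exact: (@low_log_ge0 R _ (apos k) (b k)).
Qed.
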